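(* Let $\phi\in\mathscr{P}_\beta([0,T])$. Suppose $U(T,0;\omega)$ is discretized into $L$ short-time segments with step size $\tau=T/L$, and write each segment as $U(j\tau,(j-1)\tau;\omega)=\exp(-i(a_jX+b_jY+c_jZ))$, $j=1,\dots,L$. Let $\widetilde\psi_j:=\arctan(b_j/a_j)$, an estimator which exploits the full nonlinear dependence in the short-time evolution. When learning from experimental data obtained with finite measurement shots (for which the largest amplitude used must satisfy $\omega_{\max}\tau\approx\pi/2$, so that $\omega\tau$ is bounded by a constant of this order), the systematic bias satisfies $$\max_{j=1,\dots,L}|\widetilde\psi_j-\bar\phi_j|\le O\!\left(\beta^2T^2/L^2\right),$$ where $\bar\phi_j=\frac1\tau\int_{(j-1)\tau}^{j\tau}\phi(s)\,ds$ is the average pulse value on each subinterval.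
   Context: $\mathscr{P}_\beta([0,T])$ is the set of real $\phi\in C^\infty([0,T])$ for which there is $C>0$ with $\sup_{[0,T]}|\phi^{(k)}|\le C\beta^k$ for all $k\in\mathbb{N}$. $X,Y,Z$ are the Pauli matrices. $U(t,s;\omega)$ is the propagator from time $s$ to time $t$ of $\frac{d}{dt}U=-i\omega(\cos\phi(t)X+\sin\phi(t)Y)U$, with $U(s,s;\omega)=I$, and $U(T,0;\omega)=U(L\tau,(L-1)\tau;\omega)\cdots U(\tau,0;\omega)$. The real coefficients $a_j,b_j,c_j$ are those of the Magnus generator (the convergent Magnus series) of the segment; they depend on $\omega,\tau,\phi$. The arctangent is understood on the appropriate branch (equivalently $\mathrm{atan2}(b_j,a_j)$, angles compared modulo $2\pi$). The $O(\cdot)$ is for small step size $\tau$ (large $L$). *)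

(* Defs.v *)
From Stdlib Require Import Reals Arith.
From Coquelicot Require Import Coquelicot.
Open Scope R_scope.

(** Derivative relative to a domain [D]: Coquelicot's [is_derive] with the
    filter [locally x] restricted to [D], hence one-sided at the end points of
    a closed interval. *)
Definition is_derive_on {V : NormedModule R_AbsRing}
    (D : R -> Prop) (f : R -> V) (x : R) (l : V) : Prop :=
  filterdiff (K := R_AbsRing) (U := R_NormedModule)
    f (within D (locally x)) (fun y : R => scal y l).

(** [phi] is C^oo on [[0,T]] with |phi^(k)| <= M * beta^k for all k; here
    [D k] is the k-th derivative.  The class P_beta([0,T]) is the union of
    these sets over M > 0. *)
Definition pulse_class (M beta T : R) (phi : R -> R) : Prop :=
  exists D : nat -> R -> R,
    (forall x, 0 <= x <= T -> D 0%nat x = phi x) /\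
    forall (k : nat) (x : R), 0 <= x <= T ->
      is_derive_on (fun y => 0 <= y <= T) (D k) x (D (S k) x) /\
      Rabs (D k x) <= M * beta ^ k.

Definition mat2 : Ring := @matrix_Ring C_Ring 2.

Definition entry (A : mat2) (i j : nat) : C :=
  @coeff_mat C 2 2 (RtoC 0) A i j.

Definition mat2_of (x00 x01 x10 x11 : C) : mat2 :=
  @mk_matrix C 2 2 (fun i j =>
    match i, j with
    | O, O => x00 | O, _ => x01
    | _, O => x10 | _, _ => x11
    end).

Definition mscal (z : C) (A : mat2) : mat2 :=
  @mk_matrix C 2 2 (fun i j => Cmult z (entry A i j)).

(* Limits of matrices are taken entrywise, C being a real normed module. *)

Definition mat_is_derive_on (D : R -> Prop) (F : R -> mat2) (x : R) (L : mat2)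
  : Prop :=
  forall i j : nat, (i < 2)%nat -> (j < 2)%nat ->
    is_derive_on (V := C_R_NormedModule) D (fun t => entry (F t) i j) x
      (entry L i j).

Definition mat_RInt (F : R -> mat2) (a b : R) : mat2 :=
  @mk_matrix C 2 2 (fun i j =>
    RInt (V := C_R_CompleteNormedModule) (fun t => entry (F t) i j) a b).

Definition mat_is_series (F : nat -> mat2) (S : mat2) : Prop :=
  forall i j : nat, (i < 2)%nat -> (j < 2)%nat ->
    is_series (V := C_R_NormedModule) (fun n => entry (F n) i j) (entry S i j).

Definition is_mat_exp (A E : mat2) : Prop :=
  mat_is_series (fun n => mscal (RtoC (/ INR (fact n))) (pow_n A n)) E.

Definition commutator (A B : mat2) : mat2 := minus (mult A B) (mult B A).

Definition pauliX : mat2 := mat2_of (RtoC 0) (RtoC 1) (RtoC 1) (RtoC 0).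
Definition pauliY : mat2 := mat2_of (RtoC 0) (Copp Ci) Ci (RtoC 0).
Definition pauliZ : mat2 := mat2_of (RtoC 1) (RtoC 0) (RtoC 0) (RtoC (-1)).

Definition pauli_generator (a b c : R) : mat2 :=
  mscal (Copp Ci)
    (plus (plus (mscal (RtoC a) pauliX) (mscal (RtoC b) pauliY))
          (mscal (RtoC c) pauliZ)).

Definition pulse_rhs (omega : R) (phi : R -> R) (t : R) : mat2 :=
  pauli_generator (omega * cos (phi t)) (omega * sin (phi t)) 0.

(** [U t s] stands for U(t,s;omega), 0 <= s <= t <= T. *)
Definition is_propagator (T omega : R) (phi : R -> R) (U : R -> R -> mat2)
  : Prop :=
  forall s, 0 <= s <= T ->
    U s s = one /\
    forall t, s <= t <= T ->
      mat_is_derive_on (fun y => s <= y <= T) (fun y => U y s) t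
        (mult (pulse_rhs omega phi t) (U t s)).

(** Course-of-values recursion: [strong_rec d step n = step n f], where
    [f k = strong_rec d step k] for k < n (and [f k = d] for k >= n). *)
Fixpoint rec_table {V : Type} (d : V) (step : nat -> (nat -> V) -> V) (n : nat)
  : nat -> V :=
  match n with
  | O => fun _ => d
  | S m => fun k =>
      if Nat.eqb k m then step m (rec_table d step m) else rec_table d step m k
  end.

Definition strong_rec {V : Type} (d : V) (step : nat -> (nat -> V) -> V)
    (n : nat) : V :=
  step n (rec_table d step n).

(** Bernoulli numbers, with B_1 = -1/2:
    B_0 = 1 and (n+1) B_n = - sum_(k<n) binom(n+1,k) B_k. *)
Definition bernoulli : nat -> R :=
  strong_rec 0 (fun n B =>
    match n with
    | O => 1
    | S m => - sum_n (fun k => Binomial.C (S n) k * B k) m / INR (S n)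
    end).

(** The matrices S_n^(j) of the recursive Magnus expansion: the degree-n part
    of ad_Omega^j (A), where Omega = sum_m Omega_m, Omega_m has degree m and
    A has degree 1. *)
Fixpoint magnus_S (Om : nat -> R -> mat2) (A : R -> mat2) (j n : nat) (u : R)
  : mat2 :=
  match j with
  | O => if Nat.eqb n 1 then A u else zero
  | S i =>
      sum_n_m (fun m => commutator (Om m u) (magnus_S Om A i (n - m) u))
        1 (n - 1)
  end.

(** Magnus terms of U' = A U started at time s: Omega_1(t) = int_s^t A and
    Omega_n(t) = sum_(1 <= j < n) B_j / j! int_s^t S_n^(j)(u) du  for n >= 2
    (the j = 0 summand contributes for n = 1 only). *)
Definition magnus_term (A : R -> mat2) (s : R) : nat -> R -> mat2 :=
  strong_rec (fun _ => zero) (fun n Om t =>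
    mat_RInt (fun u =>
      sum_n_m (fun j => mscal (RtoC (bernoulli j / INR (fact j)))
                          (magnus_S Om A j n u)) 0 (n - 1)) s t).

(** The Magnus series of U' = A U on [[s,t]] converges, with sum [Omega]. *)
Definition is_magnus_generator (A : R -> mat2) (s t : R) (Omega : mat2)
  : Prop :=
  mat_is_series (fun n => magnus_term A s (S n) t) Omega.

(** arctan (b / a) on the appropriate branch, with values in (-PI, PI]. *)
Definition atan2 (b a : R) : R :=
  if Rlt_dec 0 a then atan (b / a)
  else if Rlt_dec a 0 then
    if Rle_dec 0 b then atan (b / a) + PI else atan (b / a) - PI
  else if Rlt_dec 0 b then PI / 2
  else if Rlt_dec b 0 then - (PI / 2)
  else 0.

(** |x - y| <= e, for angles modulo 2 PI. *)
Definition angle_dist_le (x y e : R) : Prop :=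
  exists k : Z, Rabs (x - y - 2 * PI * IZR k) <= e.

(* Main.v *)
Require Import Defs.
From Stdlib Require Import Reals.
From Coquelicot Require Import Coquelicot.
From Stdlib Require Import Lra Lia Psatz Factorial Wf_nat FunctionalExtensionality.
Open Scope R_scope.

(** The unit quaternion of a segment is exp(-i(aX + bY + cZ)), so the direction
    of (a,b) can be read off the propagator once |(a,b,c)| < PI.

    For that bound, scale the amplitude by z.  As formal power series in z, the
    Magnus recursion is w' = z sum_j (B_j/j!) ad_w^j(alpha), whose exponential
    solves the scaled equation; this reduces to r cot r being the generating
    function of the Bernoulli numbers.  Where the Magnus series converges the
    formal identity becomes an identity of functions on 0 <= z < 1.  Since
    omega tau < PI and the pulse is nearly constant, exp(w(z)) never reaches -1,
    so |w(z)| cannot cross PI, and Abel's theorem passes to z = 1.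

    For the direction, let theta be the value of phi at the midpoint of the
    segment.  In the frame rotated by theta the component transverse to the
    rotation axis is, to first order, an integral of phi - theta against a
    kernel even about the midpoint; the linear part of phi - theta drops out,
    both there and in the average of phi, leaving O((beta tau)^2). *)

(** * Formal power series *)

(** The bound by PI decides the branch: for |(a,b,c)| between PI and 2 PI the factor sin r / r is
    negative and the direction read off the propagator would be off by PI. This is why z is kept
    formal: the equation in t is used coefficient by coefficient, where each degree involves
    finitely many Magnus terms, and z < 1 turns convergence at 1 into absolute convergence. The
    limit z -> 1 yields only |(a,b,c)| <= PI. Equality is excluded afterwards, because cos r is the
    scalar part of the propagator itself and stays above -1. The bias is uniform in omega since the
    component along the axis and the transverse bound are both proportional to x = omega tau: the
    first is at least c0 x / 2 with c0 = cos (kappa / 2) ^ 2, positive for kappa < PI, and x cancels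
    in the quotient. *)

Definition fps := nat -> R.

Definition fps_const (x : R) : fps := fun n => match n with O => x | S _ => 0 end.
Definition fps_add (f g : fps) : fps := fun n => f n + g n.
Definition fps_opp (f : fps) : fps := fun n => - f n.
Definition fps_sub (f g : fps) : fps := fun n => f n - g n.
Definition fps_mul (f g : fps) : fps := PS_mult f g.
Definition fps_tl (f : fps) : fps := fun n => f (S n).
Definition fps_shift (f : fps) : fps := fun n => match n with O => 0 | S m => f m end.

Lemma fps_mul_0 f g : fps_mul f g 0%nat = f 0%nat * g 0%nat.
Proof. reflexivity. Qed.

(** Peels the head off the left factor; the next lemma does it on the right. With this pair the ring
    laws are inductions on the degree instead of rearrangements of double sums. *)
Lemma fps_mul_S f g n :
  fps_mul f g (S n) = f 0%nat * g (S n) + fps_mul (fps_tl f) g n.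
Proof.
  unfold fps_mul, PS_mult. rewrite decomp_sum by lia. simpl pred.
  f_equal.
Qed.

Lemma fps_mul_S_r f g n :
  fps_mul f g (S n) = fps_mul f (fps_tl g) n + f (S n) * g 0%nat.
Proof.
  unfold fps_mul, PS_mult. rewrite tech5. rewrite Nat.sub_diag. f_equal.
  apply sum_eq. intros i Hi. unfold fps_tl. f_equal. f_equal. lia.
Qed.

Lemma fps_mul_ext n f f' g g' :
  (forall k, (k <= n)%nat -> f k = f' k) ->
  (forall k, (k <= n)%nat -> g k = g' k) ->
  fps_mul f g n = fps_mul f' g' n.
Proof.
  intros H1 H2. unfold fps_mul, PS_mult. apply sum_eq. intros i Hi.
  rewrite H1, H2 by lia. reflexivity.
Qed.

Lemma fps_mulC f g : fps_mul f g = fps_mul g f.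
Proof.
  apply functional_extensionality. intros n. revert f g.
  induction n as [|n IH]; intros f g.
  - rewrite !fps_mul_0. ring.
  - rewrite fps_mul_S, fps_mul_S_r, IH. ring.
Qed.

Lemma fps_mulDl f g h :
  fps_mul (fps_add f g) h = fps_add (fps_mul f h) (fps_mul g h).
Proof.
  apply functional_extensionality. intros n.
  unfold fps_mul, fps_add, PS_mult. rewrite <- plus_sum.
  apply sum_eq. intros; ring.
Qed.

Lemma fps_mul_scal_l (x : R) f g n :
  fps_mul (fun k => x * f k) g n = x * fps_mul f g n.
Proof.
  unfold fps_mul, PS_mult. rewrite scal_sum. apply sum_eq. intros; ring.
Qed.

Lemma fps_mulA f g h : fps_mul f (fps_mul g h) = fps_mul (fps_mul f g) h.
Proof.
  apply functional_extensionality. intros n. revert f.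
  induction n as [|n IH]; intros f.
  - rewrite !fps_mul_0. ring.
  - rewrite !fps_mul_S, fps_mul_0, IH.
    replace (fps_tl (fps_mul f g))
      with (fps_add (fun k => f 0%nat * fps_tl g k) (fps_mul (fps_tl f) g)).
    2:{ apply functional_extensionality. intros k. unfold fps_add.
        unfold fps_tl at 3. rewrite fps_mul_S. reflexivity. }
    rewrite fps_mulDl. unfold fps_add. rewrite fps_mul_scal_l. ring.
Qed.

Lemma fps_const_mul x f n : fps_mul (fps_const x) f n = x * f n.
Proof.
  destruct n as [|n]; [reflexivity|]. rewrite fps_mul_S.
  replace (fps_tl (fps_const x)) with (fun k : nat => 0 * f k).
  2:{ apply functional_extensionality. intros k. unfold fps_tl; simpl. ring. }
  rewrite fps_mul_scal_l. simpl. ring.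
Qed.

Lemma fps_shift_mul f g : fps_mul (fps_shift f) g = fps_shift (fps_mul f g).
Proof.
  apply functional_extensionality. intros [|n].
  - rewrite fps_mul_0. simpl. ring.
  - rewrite fps_mul_S. simpl. change (fps_tl (fps_shift f)) with f. ring.
Qed.

(** By extensionality equality of series is Leibniz equality, so [ring] can act on whole series. *)
Definition fps_ring_theory :
  ring_theory (fps_const 0) (fps_const 1) fps_add fps_mul fps_sub fps_opp eq.
Proof.
  split; intros;
    try (apply functional_extensionality; intros n;
         unfold fps_add, fps_sub, fps_opp; try (destruct n; simpl; ring); ring).
  - apply functional_extensionality. intros n. rewrite fps_const_mul. ring.
  - apply fps_mulC.
  - apply fps_mulA.
  - apply fps_mulDl.
Qed.

Add Ring fps_ring : fps_ring_theory.

Declare Scope fps_scope.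
Delimit Scope fps_scope with fps.
Ltac fps_ring_at n := apply (f_equal (fun F : fps => F n)); ring.

Infix "+" := fps_add : fps_scope.
Infix "-" := fps_sub : fps_scope.
Infix "*" := fps_mul : fps_scope.
Notation "- f" := (fps_opp f) : fps_scope.
Notation "c %:F" := (fps_const c) (at level 2, format "c %:F").
Notation "'zF" := (fps_shift (fps_const 1)).

Lemma fps_X_mul f : ('zF * f)%fps = fps_shift f.
Proof.
  rewrite fps_shift_mul. f_equal. apply functional_extensionality.
  intros n. rewrite fps_const_mul. ring.
Qed.

(** Serves as division by z. *)
Lemma fps_shift_inj f g : ('zF * f)%fps = ('zF * g)%fps -> f = g.
Proof.
  rewrite !fps_X_mul. intros H. apply functional_extensionality. intros n.
  exact (f_equal (fun h => h (S n)) H).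
Qed.

Lemma fps_const_add x y : (x + y)%:F = (x%:F + y%:F)%fps.
Proof.
  apply functional_extensionality. intros [|n]; unfold fps_add; simpl; ring.
Qed.

Lemma fps_const_mulr x y : (x * y)%:F = (x%:F * y%:F)%fps.
Proof.
  apply functional_extensionality. intros n. rewrite fps_const_mul.
  destruct n; simpl; ring.
Qed.

Lemma fps_const_opp x : (- x)%:F = (- x%:F)%fps.
Proof.
  apply functional_extensionality. intros [|n]; unfold fps_opp; simpl; ring.
Qed.

(** * Composition of formal power series *)

Fixpoint fps_pow (f : fps) (k : nat) : fps :=
  match k with O => 1%:F | S k => (f * fps_pow f k)%fps end.

(** Composition; meaningful only when [f 0 = 0]. *)
Definition fps_comp (c f : fps) : fps :=
  fun n => sum_f_R0 (fun k => c k * fps_pow f k n) n.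

(** Without constant term, f^k starts in degree k; hence the cut at n in [fps_comp] loses
    nothing. *)
Lemma fps_pow_low f k n : f 0%nat = 0 -> (n < k)%nat -> fps_pow f k n = 0.
Proof.
  intros H0. revert n. induction k as [|k IH]; intros n Hn; [lia|].
  simpl. destruct n as [|n].
  - rewrite fps_mul_0, H0. ring.
  - rewrite fps_mul_S, H0. unfold fps_mul, PS_mult.
    rewrite sum_eq_R0; [ring|]. intros i Hi. rewrite IH by lia. ring.
Qed.

Lemma sum_f_R0_extend u n N :
  (n <= N)%nat -> (forall k, (n < k)%nat -> u k = 0) ->
  sum_f_R0 u N = sum_f_R0 u n.
Proof.
  intros H Hu. induction H as [|N H IH]; [reflexivity|].
  rewrite tech5, IH, Hu by lia. ring.
Qed.

Lemma fps_comp_extend c f n N : f 0%nat = 0 -> (n <= N)%nat ->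
  fps_comp c f n = sum_f_R0 (fun k => c k * fps_pow f k n) N.
Proof.
  intros H0 H. symmetry. apply sum_f_R0_extend; [exact H|].
  intros k Hk. rewrite fps_pow_low by assumption. ring.
Qed.

Lemma fps_sum_mul f (u : nat -> fps) N n :
  fps_mul f (fun m => sum_f_R0 (fun k => u k m) N) n
  = sum_f_R0 (fun k => fps_mul f (u k) n) N.
Proof.
  induction N as [|N IH]; [reflexivity|].
  rewrite tech5, <- IH.
  change (fun m => sum_f_R0 (fun k => u k m) (S N))
    with (fps_add (fun m => sum_f_R0 (fun k => u k m) N) (u (S N))).
  rewrite fps_mulC, fps_mulDl, !(fps_mulC _ f). reflexivity.
Qed.

(** Horner's rule. As f has no constant term, degree n on the right needs the inner composition only
    below n; strong induction on n then gives multiplicativity and the chain rule. *)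
Lemma fps_comp_rec c f : f 0%nat = 0 ->
  fps_comp c f = ((c 0%nat)%:F + f * fps_comp (fps_tl c) f)%fps.
Proof.
  intros H0. apply functional_extensionality. intros n.
  rewrite (fps_comp_extend c f n (S n)) by (auto; lia).
  rewrite decomp_sum by lia. simpl pred.
  unfold fps_add. f_equal.
  - change (fps_pow f 0) with (1%:F). destruct n; simpl; ring.
  - transitivity (fps_mul f
      (fun m => sum_f_R0 (fun k => fps_tl c k * fps_pow f k m) n) n).
    + rewrite (fps_sum_mul f (fun k m => fps_tl c k * fps_pow f k m)).
      apply sum_eq. intros i Hi.
      rewrite (fps_mulC f (fun m => fps_tl c i * fps_pow f i m)).
      rewrite fps_mul_scal_l, fps_mulC. reflexivity.
    + apply fps_mul_ext; [reflexivity|]. intros k Hk. symmetry.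
      apply fps_comp_extend; assumption.
Qed.

Lemma fps_mul_low_ext n f g h : f 0%nat = 0 ->
  (forall k, (k < n)%nat -> g k = h k) -> fps_mul f g n = fps_mul f h n.
Proof.
  intros H0 H. destruct n as [|n].
  - rewrite !fps_mul_0, H0. ring.
  - rewrite !fps_mul_S, H0. rewrite !Rmult_0_l. f_equal.
    apply fps_mul_ext; [reflexivity|]. intros k Hk. apply H. lia.
Qed.

Lemma fps_comp_add c d f : fps_comp (c + d)%fps f = (fps_comp c f + fps_comp d f)%fps.
Proof.
  apply functional_extensionality. intros n. unfold fps_comp, fps_add.
  rewrite <- plus_sum. apply sum_eq. intros; ring.
Qed.

Lemma fps_comp_scal x c f : fps_comp (x%:F * c)%fps f = (x%:F * fps_comp c f)%fps.
Proof.
  apply functional_extensionality. intros n. rewrite fps_const_mul.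
  unfold fps_comp. rewrite scal_sum. apply sum_eq. intros k _.
  rewrite fps_const_mul. ring.
Qed.

Lemma fps_tl_mul c d :
  fps_tl (c * d)%fps = ((c 0%nat)%:F * fps_tl d + fps_tl c * d)%fps.
Proof.
  apply functional_extensionality. intros n. unfold fps_tl at 1, fps_add.
  rewrite fps_mul_S, fps_const_mul. reflexivity.
Qed.

Lemma fps_comp_mul c d f : f 0%nat = 0 ->
  fps_comp (c * d)%fps f = (fps_comp c f * fps_comp d f)%fps.
Proof.
  intros H0. apply functional_extensionality. intros n. revert c.
  induction n as [n IH] using lt_wf_ind. intros c.
  rewrite (fps_comp_rec (c * d)%fps), (fps_comp_rec c) by exact H0.
  rewrite fps_tl_mul, fps_comp_add, fps_comp_scal.
  rewrite fps_mul_0, fps_const_mulr.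
  transitivity (((c 0%nat)%:F * ((d 0%nat)%:F + f * fps_comp (fps_tl d) f)
                 + f * fps_comp (fps_tl c * d) f)%fps n).
  { fps_ring_at n. }
  rewrite <- fps_comp_rec by exact H0.
  transitivity (((c 0%nat)%:F * fps_comp d f
                 + f * (fps_comp (fps_tl c) f * fps_comp d f))%fps n).
  2:{ fps_ring_at n. }
  unfold fps_add. f_equal. apply fps_mul_low_ext; [exact H0|].
  intros k Hk. apply IH. exact Hk.
Qed.

Lemma fps_comp_X f : f 0%nat = 0 -> fps_comp 'zF f = f.
Proof.
  intros H0. rewrite fps_comp_rec by exact H0.
  change (fps_tl 'zF) with (1%:F).
  replace (fps_comp 1%:F f) with (1%:F).
  { simpl. ring. }
  rewrite fps_comp_rec by exact H0.
  replace (fps_comp (fps_tl 1%:F) f) with (0%:F); [simpl; ring|].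
  apply functional_extensionality. intros n. unfold fps_comp.
  rewrite sum_eq_R0; [destruct n; reflexivity|].
  intros k _. unfold fps_tl; simpl. ring.
Qed.

(** Derivative in time, coefficient by coefficient; the amplitude variable z stays formal and no
    convergence is involved. *)
Definition fps_is_derive (F : R -> fps) (t : R) (G : fps) : Prop :=
  forall n, is_derive (fun u => F u n) t (G n).

Lemma fps_is_derive_ext F F' t G G' : (forall u, F u = F' u) -> G = G' ->
  fps_is_derive F t G -> fps_is_derive F' t G'.
Proof.
  intros H -> HF n. apply is_derive_ext with (f := fun u => F u n); [|apply HF].
  intros u. rewrite H. reflexivity.
Qed.

Lemma fps_is_derive_const (f : fps) t : fps_is_derive (fun _ => f) t 0%:F.
Proof.
  intros n. replace (0%:F n) with 0 by (destruct n; reflexivity).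
  apply (is_derive_const (f n) t).
Qed.

Lemma fps_is_derive_add F G t F' G' :
  fps_is_derive F t F' -> fps_is_derive G t G' ->
  fps_is_derive (fun u => F u + G u)%fps t (F' + G')%fps.
Proof.
  intros HF HG n.
  apply (is_derive_plus (fun u => F u n) (fun u => G u n)); auto.
Qed.

Lemma fps_is_derive_mul F G t F' G' :
  fps_is_derive F t F' -> fps_is_derive G t G' ->
  fps_is_derive (fun u => F u * G u)%fps t (F' * G t + F t * G')%fps.
Proof.
  intros HF HG n. revert F F' HF.
  induction n as [|n IH]; intros F F' HF.
  - unfold fps_add. rewrite !fps_mul_0.
    apply (is_derive_mult (fun u => F u 0%nat) (fun u => G u 0%nat)); auto.
    intros; apply Rmult_comm.
  - unfold fps_add. rewrite !fps_mul_S.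
    apply is_derive_ext with
      (f := fun u => F u 0%nat * G u (S n) + fps_mul (fps_tl (F u)) (G u) n).
    { intros u. rewrite fps_mul_S. reflexivity. }
    replace (F' 0%nat * G t (S n) + fps_mul (fps_tl F') (G t) n
             + (F t 0%nat * G' (S n) + fps_mul (fps_tl (F t)) G' n))
      with (plus (F' 0%nat * G t (S n) + F t 0%nat * G' (S n))
             ((fps_tl F' * G t + fps_tl (F t) * G')%fps n)).
    2:{ unfold plus, fps_add; simpl. ring. }
    apply @is_derive_plus.
    + apply (is_derive_mult (fun u => F u 0%nat) (fun u => G u (S n))); auto.
      intros; apply Rmult_comm.
    + apply (IH (fun u => fps_tl (F u))). intros k. apply HF.
Qed.

Definition fps_deriv (c : fps) : fps := fun n => INR (S n) * c (S n).

Lemma fps_deriv_rec c : fps_deriv c = (fps_tl c + 'zF * fps_deriv (fps_tl c))%fps.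
Proof.
  rewrite fps_X_mul. apply functional_extensionality. intros [|n];
  unfold fps_deriv, fps_add, fps_tl, fps_shift.
  - simpl. ring.
  - rewrite (S_INR (S n)). ring.
Qed.

Lemma fps_is_derive_comp c F t F' : (forall u, F u 0%nat = 0) ->
  fps_is_derive F t F' ->
  fps_is_derive (fun u => fps_comp c (F u)) t
    (fps_comp (fps_deriv c) (F t) * F')%fps.
Proof.
  intros H0 HF n. revert c.
  induction n as [n IH] using lt_wf_ind. intros c.
  (* The constant coefficient vanishes for all times, hence so does its derivative; this lets [F']
     too ignore degree n of its cofactor. *)
  assert (HF0 : F' 0%nat = 0).
  { pose proof (is_derive_unique _ _ _ (HF 0%nat)) as HD.
    rewrite <- HD. rewrite (Derive_ext _ (fun _ => 0)); [|exact H0].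
    apply Derive_const. }
  apply is_derive_ext with
    (f := fun u => ((c 0%nat)%:F + F u * fps_comp (fps_tl c) (F u))%fps n).
  { intros u. rewrite <- fps_comp_rec by apply H0. reflexivity. }
  (* The induction hypothesis differentiates the inner composition only below degree n. Replacing
     the rest by 0 gives a family differentiable in every degree, and degree n of the product does
     not see the change. *)
  set (Q := fun m => match Compare_dec.lt_dec m n with
                     | left _ => fun u => fps_comp (fps_tl c) (F u) m
                     | right _ => fun _ => 0 end).
  set (Q' := fun m => if Compare_dec.lt_dec m n
                     then (fps_comp (fps_deriv (fps_tl c)) (F t) * F')%fps m else 0).
  assert (HQ : fps_is_derive (fun u m => Q m u) t Q').
  { intros m. unfold Q, Q'. destruct (Compare_dec.lt_dec m n) as [Hm|Hm].
    - apply IH. exact Hm.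
    - apply (is_derive_const 0 t). }
  apply is_derive_ext with
    (f := fun u => ((c 0%nat)%:F + F u * (fun m => Q m u))%fps n).
  { intros u. unfold fps_add. f_equal. apply fps_mul_low_ext; [apply H0|].
    intros k Hk. unfold Q. destruct (Compare_dec.lt_dec k n); [reflexivity|lia]. }
  pose proof (fps_is_derive_add _ _ _ _ _
    (fps_is_derive_const ((c 0%nat)%:F) t)
    (fps_is_derive_mul _ _ _ _ _ HF HQ) n) as HD.
  replace ((fps_comp (fps_deriv c) (F t) * F')%fps n)
    with ((0%:F + (F' * (fun m => Q m t) + F t * Q'))%fps n); [exact HD|].
  rewrite fps_deriv_rec, fps_comp_add, fps_comp_mul, fps_comp_X by apply H0.
  transitivity ((F' * fps_comp (fps_tl c) (F t)
     + F t * (fps_comp (fps_deriv (fps_tl c)) (F t) * F'))%fps n).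
  2:{ fps_ring_at n. }
  transitivity ((F' * (fun m => Q m t) + F t * Q')%fps n).
  { fps_ring_at n. }
  unfold fps_add. f_equal; apply fps_mul_low_ext; auto;
    intros k Hk; unfold Q, Q'; destruct (Compare_dec.lt_dec k n); auto; lia.
Qed.

(** * Bernoulli numbers and r cot r *)

Lemma rec_table_spec {V : Type} (d : V) step n k :
  rec_table d step n k = if Nat.ltb k n then strong_rec d step k else d.
Proof.
  induction n as [|n IH]; [reflexivity|]. simpl rec_table.
  destruct (Nat.eqb_spec k n) as [->|Hk].
  - replace (Nat.ltb n (S n)) with true by (symmetry; apply Nat.ltb_lt; lia).
    reflexivity.
  - rewrite IH.
    destruct (Nat.ltb_spec k n); destruct (Nat.ltb_spec k (S n));
      reflexivity || lia.
Qed.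

Lemma strong_rec_eq {V : Type} (d : V) step n :
  strong_rec d step n
  = step n (fun k => if Nat.ltb k n then strong_rec d step k else d).
Proof.
  unfold strong_rec at 1. f_equal. apply functional_extensionality.
  intros k. apply rec_table_spec.
Qed.

Definition fps_exp (a : R) : fps := fun n => a ^ n / INR (fact n).

Lemma fps_exp_add a b : (fps_exp a * fps_exp b)%fps = fps_exp (a + b).
Proof.
  apply functional_extensionality. intros n. unfold fps_mul, PS_mult, fps_exp.
  rewrite Binomial.binomial. unfold Rdiv. rewrite Rmult_comm, scal_sum.
  apply sum_eq. intros i Hi. unfold Binomial.C.
  field. repeat split; apply INR_fact_neq_0.
Qed.

Lemma fps_exp_0 : fps_exp 0 = 1%:F.
Proof.
  apply functional_extensionality. intros [|n]; unfold fps_exp; simpl; [lra|].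
  unfold Rdiv. ring.
Qed.

Lemma fps_X_tl f : f = ((f 0%nat)%:F + 'zF * fps_tl f)%fps.
Proof.
  rewrite fps_X_mul. apply functional_extensionality.
  intros [|n]; unfold fps_add, fps_tl, fps_shift; simpl; ring.
Qed.

(** The substitution f(a z), used with a = -1 for the parity of Bernoulli numbers and a = 2 for the
    hyperbolic cotangent. *)
Definition fps_scale (a : R) (f : fps) : fps := fun n => a ^ n * f n.

Lemma fps_scale_mul a f g :
  fps_scale a (f * g)%fps = (fps_scale a f * fps_scale a g)%fps.
Proof.
  apply functional_extensionality. intros n.
  unfold fps_scale, fps_mul, PS_mult. rewrite scal_sum.
  apply sum_eq. intros i Hi.
  replace (a ^ n) with (a ^ i * a ^ (n - i)); [ring|].
  rewrite <- pow_add. f_equal. lia.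
Qed.

Lemma fps_scale_exp a b : fps_scale a (fps_exp b) = fps_exp (a * b).
Proof.
  apply functional_extensionality. intros n. unfold fps_scale, fps_exp.
  rewrite Rpow_mult_distr. unfold Rdiv. ring.
Qed.

Lemma fps_scale_X a : fps_scale a 'zF = (a%:F * 'zF)%fps.
Proof.
  rewrite fps_mulC, fps_X_mul. apply functional_extensionality.
  intros [|[|n]]; unfold fps_scale, fps_shift; simpl; ring.
Qed.

Lemma fps_scale_const a b : fps_scale a b%:F = b%:F.
Proof.
  apply functional_extensionality. intros [|n]; unfold fps_scale; simpl; ring.
Qed.

Lemma fps_scale_sub a f g :
  fps_scale a (f - g)%fps = (fps_scale a f - fps_scale a g)%fps.
Proof.
  apply functional_extensionality. intros n. unfold fps_scale, fps_sub. ring.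
Qed.

(** Coefficients of x / (e^x - 1). *)
Definition bern : fps := fun n => bernoulli n / INR (fact n).

Lemma bernoulli_0 : bernoulli 0 = 1.
Proof. unfold bernoulli. rewrite strong_rec_eq. reflexivity. Qed.

Lemma bernoulli_S m :
  bernoulli (S m)
  = - sum_n (fun k => Binomial.C (S (S m)) k * bernoulli k) m / INR (S (S m)).
Proof.
  unfold bernoulli at 1. rewrite strong_rec_eq.
  f_equal. f_equal. apply sum_n_ext_loc. intros k Hk.
  replace (Nat.ltb k (S m)) with true; [reflexivity|].
  symmetry. apply Nat.ltb_lt. lia.
Qed.

Lemma bern_0 : bern 0%nat = 1.
Proof. unfold bern. rewrite bernoulli_0. simpl. lra. Qed.

(** Divided by (n+1)!, the defining recursion of the Bernoulli numbers says that the coefficient of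
    degree n >= 1 of x / (e^x - 1) times (e^x - 1) / x vanishes. *)
Lemma bern_inv : (bern * fps_tl (fps_exp 1))%fps = 1%:F.
Proof.
  apply functional_extensionality. intros [|m].
  - rewrite fps_mul_0, bern_0. unfold fps_tl, fps_exp. simpl. field.
  - rewrite fps_mul_S_r.
    replace (fps_tl (fps_exp 1) 0%nat) with 1 by (unfold fps_tl, fps_exp; simpl; field).
    replace (bern (S m)) with (bernoulli (S m) / INR (fact (S m))) by reflexivity.
    rewrite bernoulli_S, sum_n_Reals.
    unfold fps_mul, PS_mult.
    assert (HS : INR (fact (S (S m))) <> 0) by apply INR_fact_neq_0.
    assert (H : sum_f_R0 (fun k => Binomial.C (S (S m)) k * bernoulli k) m
      = INR (fact (S (S m))) * sum_f_R0 (fun k => bern k *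
          fps_tl (fps_tl (fps_exp 1)) (m - k)%nat) m).
    { rewrite scal_sum. apply sum_eq. intros k Hk.
      unfold Binomial.C, bern, fps_tl, fps_exp. rewrite pow1.
      replace (S (S (m - k)))%nat with (S (S m) - k)%nat by lia.
      field. split; apply INR_fact_neq_0. }
    rewrite H. change (fact (S (S m))) with (S (S m) * fact (S m))%nat.
    rewrite mult_INR. simpl (1%:F _). field.
    split; [apply not_0_INR; lia|apply INR_fact_neq_0].
Qed.

Lemma bern_exp : (bern * (fps_exp 1 - 1%:F))%fps = 'zF.
Proof.
  rewrite (fps_X_tl (fps_exp 1)).
  replace (fps_exp 1 0%nat) with 1 by (unfold fps_exp; simpl; lra).
  transitivity ('zF * (bern * fps_tl (fps_exp 1)))%fps; [ring|].
  rewrite bern_inv. ring.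
Qed.

Lemma fps_exp_inv : (fps_exp 1 * fps_exp (-1))%fps = 1%:F.
Proof. rewrite fps_exp_add, <- fps_exp_0. apply f_equal. ring. Qed.

(** From -x / (e^(-x) - 1) = x e^x / (e^x - 1). *)
Lemma bern_reflect : fps_scale (-1) bern = (bern + 'zF)%fps.
Proof.
  assert (H1 := f_equal (fps_scale (-1)) bern_exp).
  assert (Hm : (-1)%:F = (- 1%:F)%fps).
  { rewrite <- fps_const_opp. apply f_equal. ring. }
  rewrite fps_scale_mul, fps_scale_sub, fps_scale_exp, fps_scale_X,
    fps_scale_const, Rmult_1_r, Hm in H1.
  assert (H2 := bern_exp). assert (H3 := fps_exp_inv).
  set (b' := fps_scale (-1) bern) in *.
  set (e := fps_exp 1) in *. set (e' := fps_exp (-1)) in *.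
  assert (H4 : (b' * (e - 1%:F) = 'zF * e)%fps).
  { transitivity (- (e * (b' * (e' - 1%:F))) + b' * (e * e') - b')%fps; [ring|].
    rewrite H1, H3. ring. }
  (* Multiplying by [bern] turns the factor e^x - 1 into x, which can be cancelled. *)
  assert (H5 : ('zF * (b' - (bern + 'zF)) = 'zF * 0%:F)%fps).
  { transitivity (bern * (e - 1%:F) * (b' - (bern + 'zF)))%fps.
    { rewrite H2. reflexivity. }
    transitivity (bern * (b' * (e - 1%:F) - bern * (e - 1%:F)
                          - 'zF * (e - 1%:F)))%fps; [ring|].
    rewrite H4, H2. ring. }
  apply fps_shift_inj in H5.
  transitivity ((b' - (bern + 'zF)) + (bern + 'zF))%fps; [ring|].
  rewrite H5. ring.
Qed.

(** Reflection changes the sign in odd degrees. Degree 1 is left out because the extra summand of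
    [bern_reflect] lives there. *)
Lemma bern_odd k : bern (2 * k + 3)%nat = 0.
Proof.
  pose proof (f_equal (fun f : fps => f (2 * k + 3)%nat) bern_reflect) as H.
  unfold fps_scale, fps_add in H.
  replace (2 * k + 3)%nat with (S (2 * (S k))) in * by lia.
  rewrite pow_1_odd in H.
  replace ('zF (S (2 * S k))) with 0 in H; [lra|].
  replace (2 * S k)%nat with (S (S (2 * k))) by lia. reflexivity.
Qed.

Lemma bern_1 : bern 1%nat = - / 2.
Proof.
  pose proof (f_equal (fun f : fps => f 1%nat) bern_reflect) as H.
  unfold fps_scale, fps_add in H. simpl in H. lra.
Qed.

(** This is b(2x) + x = x coth x for b(x) = x / (e^x - 1), with the denominator 2 sinh x cleared. *)
Lemma bern_coth :
  ((fps_scale 2 bern + 'zF) * (fps_exp 1 - fps_exp (-1))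
   = 'zF * (fps_exp 1 + fps_exp (-1)))%fps.
Proof.
  assert (H1 := f_equal (fps_scale 2) bern_exp).
  rewrite fps_scale_mul, fps_scale_sub, fps_scale_exp, fps_scale_X,
    fps_scale_const, Rmult_1_r in H1.
  replace 2 with (1 + 1) in H1 at 2 by ring.
  replace 2 with (1 + 1) in H1 at 2 by ring.
  rewrite fps_const_add, <- fps_exp_add in H1.
  assert (H3 := fps_exp_inv).
  set (b := fps_scale 2 bern) in *.
  set (e := fps_exp 1) in *. set (e' := fps_exp (-1)) in *.
  transitivity (e' * (b * (e * e - 1%:F)) + b * e * (1%:F - e * e')
                + 'zF * (e - e'))%fps; [ring|].
  rewrite H1, H3. ring.
Qed.

Lemma sum_f_R0_even_odd u n :
  sum_f_R0 u (2 * n + 1) = sum_f_R0 (fun m => u (2 * m)%nat + u (2 * m + 1)%nat) n.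
Proof.
  induction n as [|n IH]; [reflexivity|].
  replace (2 * S n + 1)%nat with (S (S (2 * n + 1))) by lia.
  rewrite !tech5, IH.
  replace (S (2 * n + 1)) with (2 * S n)%nat by lia.
  replace (S (2 * S n)) with (2 * S n + 1)%nat by lia. ring.
Qed.

(** With the power series in rho = r^2: [cos_n], [sin_n] are those of cos r and
    sin r / r, and r cot r = 1 - 4 rho [bern_even] rho. *)
Definition bern_even : fps := fun k => bern (2 * k + 2)%nat * (-4) ^ k.

(** The coefficient of degree 2n+1 of [bern_coth], multiplied by (-1)^n: this is the substitution x
    = i r. Odd indices of the first factor drop out since e^x - e^(-x) has only odd coefficients. *)
Lemma sin_n_cot : (sin_n * (1%:F - 4%:F * ('zF * bern_even)) = cos_n)%fps.
Proof.
  assert (Hh : (1%:F - 4%:F * ('zF * bern_even))%fps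
               = fun m => bern (2 * m)%nat * (-4) ^ m).
  { rewrite fps_X_mul. apply functional_extensionality. intros m.
    unfold fps_sub. rewrite fps_const_mul. destruct m as [|m].
    - simpl. rewrite bern_0. ring.
    - unfold fps_shift, bern_even.
      replace (2 * m + 2)%nat with (2 * S m)%nat by lia. simpl (1%:F _).
      simpl ((-4) ^ S m). ring. }
  rewrite Hh, fps_mulC. apply functional_extensionality. intros n.
  pose proof (f_equal (fun f : fps => f (2 * n + 1)%nat) bern_coth) as H.
  cbv beta in H. rewrite fps_X_mul in H.
  replace (fps_shift (fps_exp 1 + fps_exp (-1))%fps (2 * n + 1)%nat)
    with (2 / INR (fact (2 * n))) in H.
  2:{ replace (2 * n + 1)%nat with (S (2 * n)) by lia.
      unfold fps_shift, fps_add, fps_exp. rewrite pow1, pow_1_even.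
      field. apply INR_fact_neq_0. }
  unfold fps_mul, PS_mult in H. rewrite sum_f_R0_even_odd in H.
  rewrite (sum_eq _ (fun m => bern (2 * m)%nat * 4 ^ m / INR (fact (2 * (n - m) + 1)) * 2))
    in H.
  - rewrite <- scal_sum in H.
    unfold fps_mul, PS_mult, cos_n.
    rewrite (sum_eq _ (fun m => bern (2 * m)%nat * 4 ^ m
       / INR (fact (2 * (n - m) + 1)) * (-1) ^ n)).
    + rewrite <- scal_sum. unfold Rdiv at 2. f_equal. lra.
    + intros m Hm. unfold sin_n.
      replace ((-1) ^ n) with ((-1) ^ m * (-1) ^ (n - m)).
      2:{ rewrite <- pow_add. f_equal. lia. }
      replace (-4) with (4 * -1) by ring. rewrite Rpow_mult_distr.
      unfold Rdiv. ring.
  - intros m Hm. unfold fps_sub, fps_exp, fps_add, fps_scale.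
    replace (2 * n + 1 - 2 * m)%nat with (S (2 * (n - m))) by lia.
    replace (2 * n + 1 - (2 * m + 1))%nat with (2 * (n - m))%nat by lia.
    rewrite !pow1, pow_1_odd, pow_1_even.
    replace (2 * (n - m) + 1)%nat with (S (2 * (n - m))) by lia.
    replace (2 ^ (2 * m)) with (4 ^ m) by (rewrite pow_mult; f_equal; ring).
    assert (Hz : ('zF (2 * m)%nat) = 0).
    { destruct m as [|m]; [reflexivity|].
      replace (2 * S m)%nat with (S (S (2 * m))) by lia. reflexivity. }
    rewrite Hz. field. split; apply INR_fact_neq_0.
Qed.

Lemma cos_n_deriv : fps_deriv cos_n = ((- / 2)%:F * sin_n)%fps.
Proof.
  apply functional_extensionality. intros n. rewrite fps_const_mul.
  unfold fps_deriv, cos_n, sin_n.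
  replace (2 * S n)%nat with (S (2 * n + 1)) by lia.
  change (fact (S (2 * n + 1))) with (S (2 * n + 1) * fact (2 * n + 1))%nat.
  rewrite mult_INR. replace (S (2 * n + 1)) with (2 * S n)%nat by lia.
  rewrite mult_INR. simpl pow. change (INR 2) with 2. field.
  split; [apply INR_fact_neq_0|apply not_0_INR; lia].
Qed.

(** The derivative of sin r / r in rho = r^2 is (cos r - sin r / r) / (2 rho). By [sin_n_cot] the
    numerator is a multiple of rho, so rho cancels. *)
Lemma sin_n_deriv : fps_deriv sin_n = ((-2)%:F * (sin_n * bern_even))%fps.
Proof.
  apply fps_shift_inj.
  transitivity ((/ 2)%:F * (cos_n - sin_n))%fps.
  - rewrite fps_X_mul. apply functional_extensionality. intros [|n];
      rewrite fps_const_mul; unfold fps_shift, fps_deriv, fps_sub, cos_n, sin_n.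
    + simpl. field.
    + replace (2 * S n + 1)%nat with (S (2 * S n)) by lia.
      change (fact (S (2 * S n))) with (S (2 * S n) * fact (2 * S n))%nat.
      rewrite mult_INR. rewrite (S_INR (2 * S n)), mult_INR.
      change (INR 2) with 2. assert (H := pos_INR (S n)). field.
      split; [apply INR_fact_neq_0|lra].
  - rewrite <- sin_n_cot.
    transitivity (((/ 2)%:F * 4%:F) * (- ('zF * (sin_n * bern_even))))%fps; [ring|].
    rewrite <- fps_const_mulr. replace (/ 2 * 4) with 2 by field.
    replace (-2) with (- (2)) by ring. rewrite fps_const_opp. ring.
Qed.

(** * The formal exponential *)

Definition fps_norm2 (w1 w2 w3 : fps) : fps := (w1 * w1 + w2 * w2 + w3 * w3)%fps.

Section FormalExp.

Variables (w1 w2 w3 : R -> fps) (x y t : R).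
Hypothesis w1_0 : forall u, w1 u 0%nat = 0.
Hypothesis w2_0 : forall u, w2 u 0%nat = 0.
Hypothesis w3_0 : forall u, w3 u 0%nat = 0.

Let rho u := fps_norm2 (w1 u) (w2 u) (w3 u).
(** With r = |w|, [g] is (1 - r cot r) / r^2, and [p] is the scalar product of w with (x, y, 0). *)
Let g := (4%:F * fps_comp bern_even (rho t))%fps.
Let p := (w1 t * x%:F + w2 t * y%:F)%fps.

(** Closed form of w' = z sum_j (B_j / j!) ad_w^j (x, y, 0) for ad_w = 2 w ×,
    because (w ×)^3 = - |w|^2 (w ×). *)
Hypothesis w1_derive : fps_is_derive w1 t
  ('zF * (x%:F + w3 t * y%:F + g * (w1 t * p - rho t * x%:F)))%fps.
Hypothesis w2_derive : fps_is_derive w2 t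
  ('zF * (y%:F - w3 t * x%:F + g * (w2 t * p - rho t * y%:F)))%fps.
Hypothesis w3_derive : fps_is_derive w3 t
  ('zF * (w2 t * x%:F - w1 t * y%:F + g * (w3 t * p)))%fps.

(** cos |w| and sin |w| / |w|: the unit quaternion of w has scalar part [C0] and vector part [S0]
    times w. *)
Let C0 u := fps_comp cos_n (rho u).
Let S0 u := fps_comp sin_n (rho u).

Lemma rho_0 u : rho u 0%nat = 0.
Proof.
  unfold rho, fps_norm2, fps_add. rewrite !fps_mul_0, w1_0, w2_0, w3_0. ring.
Qed.

(** The commutator part of w' and the part carrying [g] are orthogonal to w, so the derivative of
    |w|^2 contains no Bernoulli series. *)
Lemma rho_derive :
  fps_is_derive rho t ((1%:F + 1%:F) * ('zF * p))%fps.
Proof.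
  pose proof (fps_is_derive_mul _ _ _ _ _ w1_derive w1_derive) as H1.
  pose proof (fps_is_derive_mul _ _ _ _ _ w2_derive w2_derive) as H2.
  pose proof (fps_is_derive_mul _ _ _ _ _ w3_derive w3_derive) as H3.
  pose proof (fps_is_derive_add _ _ _ _ _
    (fps_is_derive_add _ _ _ _ _ H1 H2) H3) as H.
  refine (fps_is_derive_ext _ _ _ _ _ (fun u => eq_refl) _ H).
  unfold p. generalize g. intros g0. unfold rho, fps_norm2. ring.
Qed.

Lemma S0_cot : (C0 t = S0 t - S0 t * rho t * g)%fps.
Proof.
  unfold C0, S0, g. rewrite <- sin_n_cot at 1.
  assert (H0 := rho_0 t).
  replace (1%:F - 4%:F * ('zF * bern_even))%fps
    with (1%:F + (-1)%:F * (4%:F * ('zF * bern_even)))%fps.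
  2:{ replace (-1) with (- (1)) by ring. rewrite fps_const_opp. ring. }
  rewrite fps_comp_mul, fps_comp_add, !fps_comp_scal, fps_comp_mul, fps_comp_X
    by exact H0.
  replace (fps_comp 1%:F (rho t)) with (1%:F).
  - replace (-1) with (- (1)) by ring. rewrite fps_const_opp. ring.
  - rewrite fps_comp_rec by exact H0.
    replace (fps_comp (fps_tl 1%:F) (rho t)) with (0%:F); [simpl; ring|].
    apply functional_extensionality. intros n. unfold fps_comp.
    rewrite sum_eq_R0; [destruct n; reflexivity|].
    intros k _. unfold fps_tl; simpl. ring.
Qed.

Lemma C0_derive : fps_is_derive C0 t (- ('zF * (p * S0 t)))%fps.
Proof.
  eapply fps_is_derive_ext;
    [reflexivity| |apply fps_is_derive_comp; [apply rho_0|apply rho_derive]].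
  rewrite cos_n_deriv, fps_comp_scal.
  transitivity ((- / 2)%:F * (1%:F + 1%:F) * ('zF * (p * S0 t)))%fps; [unfold S0; ring|].
  rewrite <- fps_const_add, <- fps_const_mulr.
  replace (- / 2 * (1 + 1)) with (- (1)) by field.
  rewrite fps_const_opp. ring.
Qed.

Lemma S0_derive : fps_is_derive S0 t (- (g * (S0 t * ('zF * p))))%fps.
Proof.
  eapply fps_is_derive_ext;
    [reflexivity| |apply fps_is_derive_comp; [apply rho_0|apply rho_derive]].
  rewrite sin_n_deriv, fps_comp_scal, fps_comp_mul by apply rho_0.
  unfold g, S0.
  replace (-2) with (- (2)) by ring. rewrite fps_const_opp.
  replace 4 with (2 * (1 + 1)) by ring. rewrite fps_const_mulr, fps_const_add.
  ring.
Qed.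

(** The components of E' = z (x, y, 0) E for the quaternion E of w. Once cos |w| is expressed
    through [S0_cot], all terms in [g] cancel; this is what the Bernoulli coefficients are made
    for. *)
Lemma formal_exp_derive :
  fps_is_derive C0 t
    (- ('zF * (x%:F * (S0 t * w1 t) + y%:F * (S0 t * w2 t))))%fps /\
  fps_is_derive (fun u => S0 u * w1 u)%fps t
    ('zF * (x%:F * C0 t + y%:F * (S0 t * w3 t)))%fps /\
  fps_is_derive (fun u => S0 u * w2 u)%fps t
    ('zF * (y%:F * C0 t - x%:F * (S0 t * w3 t)))%fps /\
  fps_is_derive (fun u => S0 u * w3 u)%fps t
    ('zF * (x%:F * (S0 t * w2 t) - y%:F * (S0 t * w1 t)))%fps.
Proof.
  rewrite S0_cot.
  split; [|split; [|split]].
  - eapply fps_is_derive_ext; [reflexivity| |apply C0_derive]. unfold p. ring.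
  - eapply fps_is_derive_ext; [reflexivity| |
      apply fps_is_derive_mul; [apply S0_derive|apply w1_derive]]. ring.
  - eapply fps_is_derive_ext; [reflexivity| |
      apply fps_is_derive_mul; [apply S0_derive|apply w2_derive]]. ring.
  - eapply fps_is_derive_ext; [reflexivity| |
      apply fps_is_derive_mul; [apply S0_derive|apply w3_derive]]. ring.
Qed.

End FormalExp.

(** * Evaluation of power series *)

(** A bound on the weighted l1 norm, which is submultiplicative; phrased by partial sums, so no
    limit has to exist beforehand. *)
Definition fps_l1_le (r : R) (f : fps) (P : R) : Prop :=
  forall N, sum_f_R0 (fun n => Rabs (f n) * r ^ n) N <= P.

Lemma l1_mul_partial r f g N : 0 <= r ->
  sum_f_R0 (fun n => Rabs (fps_mul f g n) * r ^ n) N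
  <= sum_f_R0 (fun n => Rabs (f n) * r ^ n) N
     * sum_f_R0 (fun n => Rabs (g n) * r ^ n) N.
Proof.
  intros Hr. revert f. induction N as [|N IH]; intros f.
  - simpl. rewrite fps_mul_0, Rabs_mult. lra.
  - rewrite (decomp_sum (fun n => Rabs (fps_mul f g n) * r ^ n)),
      (decomp_sum (fun n => Rabs (f n) * r ^ n)) by lia.
    simpl pred. specialize (IH (fps_tl f)).
    set (F := sum_f_R0 (fun i => Rabs (f (S i)) * r ^ S i) N).
    assert (HF : F = r * sum_f_R0 (fun n => Rabs (fps_tl f n) * r ^ n) N).
    { unfold F. rewrite scal_sum. apply sum_eq. intros i _.
      unfold fps_tl. simpl. ring. }
    assert (HF0 : 0 <= F).
    { apply cond_pos_sum. intros i. apply Rmult_le_pos;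
        [apply Rabs_pos|apply pow_le; exact Hr]. }
    set (G := sum_f_R0 (fun n => Rabs (g n) * r ^ n) (S N)).
    assert (HG : G = Rabs (g 0%nat) +
        sum_f_R0 (fun n => Rabs (g (S n)) * r ^ S n) N).
    { unfold G. rewrite decomp_sum by lia. simpl. ring. }
    assert (HG' : sum_f_R0 (fun n => Rabs (g n) * r ^ n) N <= G).
    { unfold G. rewrite tech5.
      assert (0 <= Rabs (g (S N)) * r ^ S N); [|lra].
      apply Rmult_le_pos; [apply Rabs_pos|apply pow_le; exact Hr]. }
    assert (HT : sum_f_R0 (fun i => Rabs (fps_mul f g (S i)) * r ^ S i) N
      <= Rabs (f 0%nat) * sum_f_R0 (fun n => Rabs (g (S n)) * r ^ S n) N
         + r * sum_f_R0 (fun n => Rabs (fps_mul (fps_tl f) g n) * r ^ n) N).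
    { rewrite !scal_sum, <- plus_sum. apply sum_Rle. intros i _.
      rewrite fps_mul_S.
      assert (Hp : 0 <= r ^ S i) by (apply pow_le; exact Hr).
      pose proof (Rabs_triang (f 0%nat * g (S i)) (fps_mul (fps_tl f) g i)) as Ht.
      rewrite Rabs_mult in Ht.
      apply (Rmult_le_compat_r _ _ _ Hp) in Ht.
      eapply Rle_trans; [exact Ht|]. simpl. right. ring. }
    rewrite fps_mul_0, Rabs_mult.
    assert (HM : r * sum_f_R0 (fun n => Rabs (fps_mul (fps_tl f) g n) * r ^ n) N
                 <= F * G).
    { rewrite HF, Rmult_assoc. apply Rmult_le_compat_l; [exact Hr|].
      eapply Rle_trans; [exact IH|]. apply Rmult_le_compat_l; [|exact HG'].
      apply cond_pos_sum. intros i. apply Rmult_le_pos;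
        [apply Rabs_pos|apply pow_le; exact Hr]. }
    rewrite pow_O, !Rmult_1_r. rewrite Rmult_plus_distr_r.
    rewrite HG at 1. lra.
Qed.

Lemma l1_pos r f P : 0 <= r -> fps_l1_le r f P -> 0 <= P.
Proof.
  intros Hr H. specialize (H 0%nat). simpl in H.
  pose proof (Rabs_pos (f 0%nat)). lra.
Qed.

Lemma l1_mul r f g P Q : 0 <= r -> fps_l1_le r f P -> fps_l1_le r g Q ->
  fps_l1_le r (f * g)%fps (P * Q).
Proof.
  intros Hr Hf Hg N. eapply Rle_trans; [apply l1_mul_partial, Hr|].
  apply Rmult_le_compat; auto; apply cond_pos_sum; intros n;
    (apply Rmult_le_pos; [apply Rabs_pos|apply pow_le, Hr]).
Qed.

Lemma l1_add r f g P Q : 0 <= r -> fps_l1_le r f P -> fps_l1_le r g Q ->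
  fps_l1_le r (f + g)%fps (P + Q).
Proof.
  intros Hr Hf Hg N. specialize (Hf N). specialize (Hg N).
  eapply Rle_trans; [|apply Rplus_le_compat; [exact Hf|exact Hg]].
  rewrite <- plus_sum. apply sum_Rle. intros n _.
  rewrite <- Rmult_plus_distr_r. apply Rmult_le_compat_r; [apply pow_le, Hr|].
  apply Rabs_triang.
Qed.

Lemma l1_pow r f P k : 0 <= r -> fps_l1_le r f P ->
  fps_l1_le r (fps_pow f k) (P ^ k).
Proof.
  intros Hr Hf. induction k as [|k IH].
  - intros N. simpl fps_pow. simpl pow.
    rewrite (sum_f_R0_extend _ 0 N).
    + simpl. rewrite Rabs_R1. lra.
    + lia.
    + intros [|j] Hj; [lia|]. simpl. rewrite Rabs_R0. ring.
  - apply l1_mul; assumption.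
Qed.

Lemma l1_coeff r f P n : 0 <= r -> fps_l1_le r f P -> Rabs (f n) * r ^ n <= P.
Proof.
  intros Hr H. eapply Rle_trans; [|apply (H n)].
  destruct n as [|n]; [simpl; lra|]. rewrite tech5.
  assert (0 <= sum_f_R0 (fun k => Rabs (f k) * r ^ k) n); [|lra].
  apply cond_pos_sum. intros k.
  apply Rmult_le_pos; [apply Rabs_pos|apply pow_le, Hr].
Qed.

Lemma l1_radius r z f P : 0 <= z < r -> fps_l1_le r f P ->
  Rbar_lt (Rabs z) (CV_radius f).
Proof.
  intros Hz H. apply Rbar_lt_le_trans with (Finite r).
  - simpl. rewrite Rabs_pos_eq; lra.
  - apply CV_radius_bounded. exists P. intros n.
    rewrite Rabs_mult, <- RPow_abs, (Rabs_pos_eq r) by lra.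
    apply l1_coeff; [lra|exact H].
Qed.

Lemma l1_is_pseries r z f P : 0 <= z < r -> fps_l1_le r f P ->
  is_pseries f z (PSeries f z).
Proof.
  intros Hz H. apply PSeries_correct, CV_radius_inside.
  apply (l1_radius r z f P); assumption.
Qed.

Lemma is_pseries_fps_mul r z f g P Q a b : 0 <= z < r ->
  fps_l1_le r f P -> fps_l1_le r g Q ->
  is_pseries f z a -> is_pseries g z b -> is_pseries (f * g)%fps z (a * b).
Proof.
  intros Hz Hf Hg Ha Hb. apply is_pseries_mult; auto;
    eapply l1_radius; eassumption.
Qed.

Lemma is_pseries_fps_pow r z f P a k : 0 <= z < r ->
  fps_l1_le r f P -> is_pseries f z a -> is_pseries (fps_pow f k) z (a ^ k).
Proof.
  intros Hz Hf Ha. induction k as [|k IH].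
  - apply is_pseries_R. apply is_series_Reals. intros e He. exists 0%nat.
    intros n _. simpl fps_pow.
    rewrite (sum_f_R0_extend _ 0 n); [|lia|].
    + unfold R_dist. simpl. replace (1 * 1 - 1) with 0 by ring.
      rewrite Rabs_R0. exact He.
    + intros [|j] Hj; [lia|]. simpl. ring.
  - simpl. eapply is_pseries_fps_mul; eauto. apply l1_pow; [lra|exact Hf].
Qed.

(** The bound is linear in [C]: it will be applied to the powers f^k with C = P^k and one rate q for
    all k. *)
Lemma geometric_tail d q C l N : 0 <= q < 1 ->
  (forall n, Rabs (d n) <= C * q ^ n) -> is_series d l ->
  Rabs (sum_f_R0 d N - l) <= C * (q ^ S N / (1 - q)).
Proof.
  intros Hq Hd Hl.
  assert (HC : 0 <= C).
  { specialize (Hd 0%nat). pose proof (Rabs_pos (d 0%nat)). simpl in Hd. lra. }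
  assert (Hm : forall m, Rabs (sum_f_R0 d N - sum_f_R0 d (N + m))
    <= C * (q ^ S N / (1 - q)) - C * (q ^ S (N + m) / (1 - q))).
  { induction m as [|m IH].
    - rewrite Nat.add_0_r. replace (sum_f_R0 d N - sum_f_R0 d N) with 0 by ring.
      rewrite Rabs_R0. lra.
    - rewrite Nat.add_succ_r, tech5.
      replace (sum_f_R0 d N - (sum_f_R0 d (N + m) + d (S (N + m))))
        with ((sum_f_R0 d N - sum_f_R0 d (N + m)) - d (S (N + m))) by ring.
      eapply Rle_trans; [apply Rabs_triang|]. rewrite Rabs_Ropp.
      specialize (Hd (S (N + m))).
      assert (HE : C * (q ^ S (N + m) / (1 - q)) - C * q ^ S (N + m)
                   = C * (q ^ S (S (N + m)) / (1 - q))).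
      { simpl. field. lra. }
      lra. }
  assert (HB : forall n, (N <= n)%nat ->
    Rabs (sum_f_R0 d N - sum_f_R0 d n) <= C * (q ^ S N / (1 - q))).
  { intros n Hn. replace n with (N + (n - N))%nat by lia.
    eapply Rle_trans; [apply Hm|].
    assert (0 <= C * (q ^ S (N + (n - N)) / (1 - q))); [|lra].
    apply Rmult_le_pos; [exact HC|]. apply Rmult_le_pos; [apply pow_le; lra|].
    left. apply Rinv_0_lt_compat. lra. }
  apply le_epsilon. intros e He.
  apply is_series_Reals in Hl. destruct (Hl e He) as [n0 Hn0].
  specialize (Hn0 (max n0 N) ltac:(lia)). unfold R_dist in Hn0.
  specialize (HB (max n0 N) ltac:(lia)).
  replace (sum_f_R0 d N - l) with
    ((sum_f_R0 d N - sum_f_R0 d (max n0 N)) + (sum_f_R0 d (max n0 N) - l)) by ring.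
  eapply Rle_trans; [apply Rabs_triang|]. lra.
Qed.

Lemma sum_f_R0_exchange (u : nat -> nat -> R) N M :
  sum_f_R0 (fun n => sum_f_R0 (fun k => u n k) M) N
  = sum_f_R0 (fun k => sum_f_R0 (fun n => u n k) N) M.
Proof.
  induction N as [|N IH]; [reflexivity|].
  rewrite tech5, IH, <- plus_sum. reflexivity.
Qed.

(** The rearrangement is justified by [|(f^k)_n| r^n <= P^k]. *)
Lemma is_pseries_fps_comp r z c f P K a b : 0 <= z < r -> f 0%nat = 0 ->
  fps_l1_le r f P -> fps_l1_le P c K ->
  is_pseries f z a -> is_pseries c a b -> is_pseries (fps_comp c f) z b.
Proof.
  intros Hz H0 Hf Hc Ha Hb.
  assert (HP := l1_pos r f P ltac:(lra) Hf).
  set (q := z / r).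
  assert (Hq : 0 <= q < 1).
  { unfold q. split; [apply Rmult_le_pos; [lra|left; apply Rinv_0_lt_compat; lra]|].
    apply (Rmult_lt_reg_r r); [lra|]. unfold Rdiv.
    rewrite Rmult_assoc, Rinv_l; lra. }
  assert (Htail : forall k N,
    Rabs (sum_f_R0 (fun n => fps_pow f k n * z ^ n) N - a ^ k)
    <= P ^ k * (q ^ S N / (1 - q))).
  { intros k N. apply geometric_tail; [exact Hq| |].
    - intros n. rewrite Rabs_mult, (Rabs_pos_eq (z ^ n)) by (apply pow_le; lra).
      replace (z ^ n) with (r ^ n * q ^ n).
      2:{ unfold q. rewrite <- Rpow_mult_distr. f_equal. field. lra. }
      rewrite <- Rmult_assoc. apply Rmult_le_compat_r; [apply pow_le; lra|].
      apply l1_coeff; [lra|]. apply l1_pow; [lra|exact Hf].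
    - apply (is_pseries_R (fps_pow f k) z (a ^ k)).
      eapply is_pseries_fps_pow; eauto. }
  (* With both sums cut at N, the difference is the sum over k <= N of [c k] times a tail of f^k.
     The weights |c k| P^k add up to at most K, so the error is geometric in N. *)
  assert (Hsum : forall N,
    Rabs (sum_f_R0 (fun n => fps_comp c f n * z ^ n) N
          - sum_f_R0 (fun k => c k * a ^ k) N) <= K * (q ^ S N / (1 - q))).
  { intros N.
    rewrite (sum_eq _ (fun n => sum_f_R0 (fun k => c k * (fps_pow f k n * z ^ n)) N)).
    2:{ intros n Hn. rewrite (fps_comp_extend c f n N) by assumption.
        rewrite Rmult_comm, scal_sum. apply sum_eq. intros; ring. }
    rewrite sum_f_R0_exchange, <- minus_sum.
    eapply Rle_trans; [apply Rsum_abs|].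
    assert (Hg : 0 <= q ^ S N / (1 - q)).
    { apply Rmult_le_pos; [apply pow_le; lra|].
      left. apply Rinv_0_lt_compat. lra. }
    eapply Rle_trans; [|apply Rmult_le_compat_r; [exact Hg|apply (Hc N)]].
    rewrite (Rmult_comm (sum_f_R0 _ _)), scal_sum. apply sum_Rle. intros k Hk.
    rewrite (sum_eq _ (fun n => fps_pow f k n * z ^ n * c k)) by (intros; ring).
    rewrite <- scal_sum, <- Rmult_minus_distr_l, Rabs_mult, Rmult_assoc.
    apply Rmult_le_compat_l; [apply Rabs_pos|]. apply Htail. }
  apply (is_pseries_R (fps_comp c f) z b). apply (is_pseries_R c a b) in Hb.
  change (is_lim_seq (sum_n (fun n => fps_comp c f n * z ^ n)) (Finite b)).
  change (is_lim_seq (sum_n (fun k => c k * a ^ k)) (Finite b)) in Hb.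
  apply is_lim_seq_ext with (u := fun N =>
    (sum_f_R0 (fun n => fps_comp c f n * z ^ n) N
     - sum_f_R0 (fun k => c k * a ^ k) N) + sum_f_R0 (fun k => c k * a ^ k) N).
  { intros N. rewrite sum_n_Reals. ring. }
  replace (Finite b) with (Finite (0 + b)) by (f_equal; ring).
  apply is_lim_seq_plus'.
  2:{ apply (is_lim_seq_ext (sum_n (fun n => c n * a ^ n))); [|exact Hb].
      intros N. apply sum_n_Reals. }
  apply is_lim_seq_abs_0.
  apply is_lim_seq_le_le with (u := fun _ => 0)
    (w := fun N => K * / (1 - q) * q ^ S N).
  - intros N. split; [apply Rabs_pos|]. eapply Rle_trans; [apply Hsum|].
    unfold Rdiv. right. ring.
  - apply is_lim_seq_const.
  - replace (Finite 0) with (Rbar_mult (K * / (1 - q)) 0) by (simpl; f_equal; ring).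
    apply is_lim_seq_scal_l. apply (is_lim_seq_incr_1 (fun n => q ^ n)).
    apply is_lim_seq_geom. rewrite Rabs_pos_eq; lra.
Qed.

Lemma exp_partial_le x N : 0 <= x ->
  sum_f_R0 (fun n => x ^ n / INR (fact n)) N <= exp x.
Proof.
  intros Hx.
  pose proof (is_exp_Reals x) as H. apply (is_pseries_R _ x (exp x)) in H.
  assert (H' : is_lim_seq (fun N => sum_f_R0 (fun n => x ^ n / INR (fact n)) N)
                 (exp x)).
  { apply (is_lim_seq_ext (sum_n (fun n => / INR (fact n) * x ^ n))); [|exact H].
    intros n. rewrite sum_n_Reals. apply sum_eq. intros; unfold Rdiv; ring. }
  apply (is_lim_seq_incr_compare _ _ H').
  intros n. rewrite tech5.
  assert (0 <= x ^ S n / INR (fact (S n))); [|lra].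
  apply Rmult_le_pos; [apply pow_le, Hx|].
  left. apply Rinv_0_lt_compat, INR_fact_lt_0.
Qed.

(** Such an outer series is entire and can be composed with an inner series of any norm, so no
    smallness of w is required for evaluation. *)
Lemma l1_entire (c : fps) P : 0 <= P ->
  (forall k, Rabs (c k) <= / INR (fact k)) -> fps_l1_le P c (exp P).
Proof.
  intros HP Hc N. eapply Rle_trans; [|apply (exp_partial_le P N HP)].
  apply sum_Rle. intros n _. unfold Rdiv. rewrite (Rmult_comm (P ^ n)).
  apply Rmult_le_compat_r; [apply pow_le, HP|apply Hc].
Qed.

Lemma inv_fact_le n m : (n <= m)%nat -> / INR (fact m) <= / INR (fact n).
Proof.
  intros H. apply Rinv_le_contravar; [apply INR_fact_lt_0|].
  apply le_INR, fact_le, H.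
Qed.

Lemma cos_n_bound k : Rabs (cos_n k) <= / INR (fact k).
Proof.
  unfold cos_n, Rdiv. rewrite Rabs_mult, pow_1_abs, Rmult_1_l.
  rewrite Rabs_pos_eq by (left; apply Rinv_0_lt_compat, INR_fact_lt_0).
  apply inv_fact_le. lia.
Qed.

Lemma is_pseries_cos r : is_pseries cos_n (r ^ 2) (cos r).
Proof.
  apply is_pseries_R, is_series_Reals. unfold cos.
  destruct (exist_cos (Rsqr r)) as [l Hl]. unfold cos_in in Hl.
  replace (r ^ 2) with (Rsqr r) by (unfold Rsqr; ring). exact Hl.
Qed.

Lemma is_pseries_sin r :
  exists m : R, is_pseries sin_n (r ^ 2) m /\ sin r = r * m.
Proof.
  unfold sin. destruct (exist_sin (Rsqr r)) as [l Hl]. exists l. split; [|reflexivity].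
  apply is_pseries_R, is_series_Reals. unfold sin_in in Hl.
  replace (r ^ 2) with (Rsqr r) by (unfold Rsqr; ring). exact Hl.
Qed.

(** Convergence at 1 bounds the coefficients, and a geometric series does the rest. This is the
    source of absolute convergence for the Magnus series. *)
Lemma series_l1 (f : fps) l r : is_series f l -> 0 <= r < 1 ->
  exists P, fps_l1_le r f P.
Proof.
  intros Hf Hr.
  assert (HB : exists B, forall n, Rabs (f n) <= B).
  { pose proof (ex_series_lim_0 f (ex_intro _ l Hf)) as Hl.
    destruct (filterlim_bounded f (ex_intro _ 0 Hl)) as [B HB].
    exists B. exact HB. }
  destruct HB as [B HB]. exists (B * (/ (1 - r))). intros N.
  assert (HB0 : 0 <= B) by (eapply Rle_trans; [apply Rabs_pos|apply (HB 0%nat)]).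
  apply Rle_trans with (B * sum_f_R0 (fun n => r ^ n) N).
  - rewrite scal_sum. apply sum_Rle. intros n _. rewrite (Rmult_comm (r ^ n)).
    apply Rmult_le_compat_r; [apply pow_le; lra|apply HB].
  - apply Rmult_le_compat_l; [exact HB0|]. rewrite tech3 by lra.
    assert (0 <= r ^ S N) by (apply pow_le; lra).
    unfold Rdiv. rewrite <- (Rmult_1_l (/ (1 - r))) at 2.
    apply Rmult_le_compat_r; [left; apply Rinv_0_lt_compat; lra|lra].
Qed.

(** * Abel's theorem, by summation by parts centred at the limit *)

Lemma abel_sum (f : fps) l z N :
  sum_f_R0 (fun n => f n * z ^ n) N
  = (1 - z) * sum_f_R0 (fun n => (sum_f_R0 f n - l) * z ^ n) N
    + (sum_f_R0 f N - l) * z ^ S N + l.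
Proof.
  induction N as [|N IH]; [simpl; ring|].
  rewrite !tech5, IH. simpl. ring.
Qed.

Lemma abel_limit (f : fps) l : is_series f l ->
  forall e, 0 < e -> exists z0, z0 < 1 /\
    forall z v, 0 <= z < 1 -> z0 < z -> is_pseries f z v -> Rabs (v - l) <= e.
Proof.
  intros Hf e He. pose proof Hf as Hf'. apply is_series_Reals in Hf'.
  destruct (Hf' (e / 2) ltac:(lra)) as [N0 HN0].
  set (s := fun n => sum_f_R0 f n - l).
  set (B := sum_f_R0 (fun n => Rabs (s n)) N0).
  assert (HB0 : 0 <= B) by (apply cond_pos_sum; intros; apply Rabs_pos).
  (* Chosen so that the first N0 + 1 terms, of total size B, weigh at most e / 2 after the factor 1
     - z; the + 1 avoids dividing by zero. *)
  exists (1 - e / 2 / (B + 1)). split.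
  { assert (0 < e / 2 / (B + 1)); [|lra].
    apply Rdiv_lt_0_compat; lra. }
  intros z v Hz Hz0 Hv.
  assert (HB : (1 - z) * B <= e / 2).
  { apply Rle_trans with (e / 2 / (B + 1) * B).
    - apply Rmult_le_compat_r; lra.
    - apply Rle_trans with (e / 2 / (B + 1) * (B + 1)).
      + apply Rmult_le_compat_l; [|lra].
        left; apply Rdiv_lt_0_compat; lra.
      + right. field. lra. }
  (* Early terms are counted without their weight, later ones are at most e / 2 times z^k. The
     missing e / 2 * z^(n+1) is exactly what the boundary term of [abel_sum] consumes. *)
  assert (HS : forall n, (1 - z) * sum_f_R0 (fun n => Rabs (s n) * z ^ n) n
     <= (1 - z) * B + e / 2 * (1 - z ^ S n)).
  { intros n. 
    apply Rle_trans with ((1 - z) * sum_f_R0 (fun n =>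
       (if Nat.leb n N0 then Rabs (s n) else 0) + e / 2 * z ^ n) n).
    - apply Rmult_le_compat_l; [lra|]. apply sum_Rle. intros k _.
      assert (Hk : 0 <= z ^ k) by (apply pow_le; lra).
      destruct (Nat.leb_spec k N0).
      + assert (z ^ k <= 1) by (rewrite <- (pow1 k); apply pow_incr; lra).
        pose proof (Rabs_pos (s k)). nra.
      + assert (Rabs (s k) <= e / 2) by (left; apply HN0; lia). nra.
    - rewrite plus_sum, Rmult_plus_distr_l. apply Rplus_le_compat.
      + apply Rmult_le_compat_l; [lra|]. unfold B.
        destruct (Nat.le_gt_cases n N0) as [Hn|Hn].
        * rewrite (sum_eq _ (fun k => Rabs (s k))).
          2:{ intros i Hi. destruct (Nat.leb_spec i N0); [reflexivity|lia]. }
          clear - Hn. induction Hn as [|m Hn IH]; [lra|]. rewrite tech5.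
          pose proof (Rabs_pos (s (S m))). lra.
        * rewrite (sum_f_R0_extend _ N0 n); [|lia|].
          -- right. apply sum_eq. intros i Hi.
             destruct (Nat.leb_spec i N0); [reflexivity|lia].
          -- intros k Hk. destruct (Nat.leb_spec k N0); [lia|reflexivity].
      + rewrite (sum_eq _ (fun k => z ^ k * (e / 2))) by (intros; ring).
        rewrite <- scal_sum, tech3 by lra. right. field. lra. }
  assert (Hlim : forall n, (N0 <= n)%nat ->
    Rabs (sum_f_R0 (fun k => f k * z ^ k) n - l) <= e).
  { intros n Hn. rewrite (abel_sum f l z n).
    assert (Hp : 0 <= z ^ S n) by (apply pow_le; lra).
    assert (Hsn : Rabs (s n) <= e / 2) by (left; apply HN0; lia).
    match goal with |- Rabs (?A + ?C + l - l) <= _ =>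
      replace (A + C + l - l) with (A + C) by ring end.
    eapply Rle_trans; [apply Rabs_triang|]. rewrite !Rabs_mult.
    rewrite (Rabs_pos_eq (1 - z)), (Rabs_pos_eq (z ^ S n)) by lra.
    change (sum_f_R0 f n - l) with (s n).
    apply Rle_trans with ((1 - z) * sum_f_R0 (fun n => Rabs (s n) * z ^ n) n
                          + e / 2 * z ^ S n).
    - apply Rplus_le_compat.
      + apply Rmult_le_compat_l; [lra|].
        eapply Rle_trans; [apply Rsum_abs|]. right. apply sum_eq. intros k _.
        rewrite Rabs_mult, (Rabs_pos_eq (z ^ k)) by (apply pow_le; lra).
        reflexivity.
      + apply Rmult_le_compat_r; assumption.
    - specialize (HS n). nra. }
  apply is_pseries_R, is_series_Reals in Hv.
  apply le_epsilon. intros d Hd. destruct (Hv d Hd) as [n1 Hn1].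
  specialize (Hn1 (max n1 N0) ltac:(lia)). specialize (Hlim (max n1 N0) ltac:(lia)).
  unfold R_dist in Hn1. rewrite Rabs_minus_sym in Hn1.
  replace (v - l) with ((v - sum_f_R0 (fun n => f n * z ^ n) (max n1 N0)) +
    (sum_f_R0 (fun n => f n * z ^ n) (max n1 N0) - l)) by ring.
  eapply Rle_trans; [apply Rabs_triang|]. lra.
Qed.

(** * Pauli generators *)

Ltac mat2_cases i j :=
  intros i j Hi Hj; destruct i as [|[|i]]; [| |lia];
  (destruct j as [|[|j]]; [| |lia]).

Lemma pauli_generator_mat a b c :
  pauli_generator a b c = mat2_of (0, -c) (-b, -a) (b, -a) (0, c).
Proof.
  apply mk_matrix_ext. mat2_cases i j;
  unfold entry, pauliX, pauliY, pauliZ; cbn;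
  apply injective_projections; simpl; ring.
Qed.

Lemma mat2_of_plus a b c d a' b' c' d' :
  plus (mat2_of a b c d) (mat2_of a' b' c' d')
  = mat2_of (Cplus a a') (Cplus b b') (Cplus c c') (Cplus d d').
Proof. reflexivity. Qed.

Lemma mat2_of_opp a b c d :
  opp (mat2_of a b c d) = mat2_of (Copp a) (Copp b) (Copp c) (Copp d).
Proof. reflexivity. Qed.

Lemma mat2_of_mult a b c d a' b' c' d' :
  mult (mat2_of a b c d) (mat2_of a' b' c' d')
  = mat2_of (Cplus (Cmult a a') (Cmult b c')) (Cplus (Cmult a b') (Cmult b d'))
      (Cplus (Cmult c a') (Cmult d c')) (Cplus (Cmult c b') (Cmult d d')).
Proof.
  apply mk_matrix_ext. mat2_cases i j; simpl Init.Nat.pred;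
  rewrite sum_Sn, sum_O; reflexivity.
Qed.

Lemma mat2_of_mscal z a b c d :
  mscal z (mat2_of a b c d)
  = mat2_of (Cmult z a) (Cmult z b) (Cmult z c) (Cmult z d).
Proof. apply mk_matrix_ext. mat2_cases i j; reflexivity. Qed.

Lemma mat2_of_one : (one : mat2) = mat2_of (RtoC 1) (RtoC 0) (RtoC 0) (RtoC 1).
Proof. reflexivity. Qed.

Ltac mat2_eq :=
  let i := fresh "i" in let j := fresh "j" in
  unfold mat2_of; apply mk_matrix_ext; mat2_cases i j;
  apply injective_projections; simpl; ring.

(** The factor -i makes the commutator twice the cross product with real coefficients, so the whole
    recursion stays in a real three-dimensional space. *)
Lemma pauli_commutator a b c a' b' c' :
  commutator (pauli_generator a b c) (pauli_generator a' b' c')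
  = pauli_generator (2 * (b * c' - c * b')) (2 * (c * a' - a * c'))
      (2 * (a * b' - b * a')).
Proof.
  rewrite !pauli_generator_mat. unfold commutator, minus.
  rewrite !mat2_of_mult, mat2_of_opp, mat2_of_plus. mat2_eq.
Qed.

Lemma pauli_plus a b c a' b' c' :
  plus (pauli_generator a b c) (pauli_generator a' b' c')
  = pauli_generator (a + a') (b + b') (c + c').
Proof. rewrite !pauli_generator_mat, mat2_of_plus. mat2_eq. Qed.

Lemma pauli_mscal x a b c :
  mscal (RtoC x) (pauli_generator a b c)
  = pauli_generator (x * a) (x * b) (x * c).
Proof. rewrite !pauli_generator_mat, mat2_of_mscal. mat2_eq. Qed.

Lemma pauli_zero : pauli_generator 0 0 0 = (zero : mat2).
Proof.
  rewrite pauli_generator_mat.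
  change (zero : mat2) with (mat2_of (RtoC 0) (RtoC 0) (RtoC 0) (RtoC 0)).
  mat2_eq.
Qed.

Lemma pauli_sum (a b c : nat -> R) n m :
  sum_n_m (fun k => pauli_generator (a k) (b k) (c k)) n m
  = pauli_generator (sum_n_m a n m) (sum_n_m b n m) (sum_n_m c n m).
Proof.
  induction m as [|m IH].
  - destruct n as [|n]; [rewrite !sum_n_n; reflexivity|].
    rewrite !sum_n_m_zero by lia. symmetry. apply pauli_zero.
  - destruct (Nat.le_gt_cases n (S m)) as [H|H].
    + rewrite !sum_n_Sm by lia. rewrite IH. apply pauli_plus.
    + rewrite !sum_n_m_zero by lia. symmetry. apply pauli_zero.
Qed.

(** The first column of a Pauli generator is (-i c, b - i a), so these projections recover its
    coefficients. *)
Definition pauli_a (M : mat2) : R := - snd (entry M 1 0).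
Definition pauli_b (M : mat2) : R := fst (entry M 1 0).
Definition pauli_c (M : mat2) : R := - snd (entry M 0 0).

Lemma pauli_a_gen a b c : pauli_a (pauli_generator a b c) = a.
Proof. rewrite pauli_generator_mat. unfold pauli_a. simpl. ring. Qed.

Lemma pauli_b_gen a b c : pauli_b (pauli_generator a b c) = b.
Proof. rewrite pauli_generator_mat. unfold pauli_b. reflexivity. Qed.

Lemma pauli_c_gen a b c : pauli_c (pauli_generator a b c) = c.
Proof. rewrite pauli_generator_mat. unfold pauli_c. simpl. ring. Qed.

Lemma RInt_C_pair (f g : R -> R) s t : ex_RInt f s t -> ex_RInt g s t ->
  RInt (V := C_R_CompleteNormedModule) (fun u => (f u, g u)) s t
  = (RInt f s t, RInt g s t).
Proof.
  intros Hf Hg. apply is_RInt_unique.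
  apply (is_RInt_fct_extend_pair (U := R_NormedModule) (V := R_NormedModule)
    (fun u => (f u, g u)));
    apply (RInt_correct (V := R_CompleteNormedModule)); assumption.
Qed.

Lemma pauli_RInt (a b c : R -> R) s t :
  ex_RInt a s t -> ex_RInt b s t -> ex_RInt c s t ->
  mat_RInt (fun u => pauli_generator (a u) (b u) (c u)) s t
  = pauli_generator (RInt a s t) (RInt b s t) (RInt c s t).
Proof.
  intros Ha Hb Hc. rewrite pauli_generator_mat.
  pose proof (ex_RInt_opp _ _ _ Ha) as Ha'. pose proof (ex_RInt_opp _ _ _ Hb) as Hb'.
  pose proof (ex_RInt_opp _ _ _ Hc) as Hc'.
  pose proof (ex_RInt_const (V := R_NormedModule) s t 0) as H0.
  assert (E : forall f : R -> R, ex_RInt f s t ->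
     RInt (fun u => - f u) s t = - RInt f s t).
  { intros f Hf. apply is_RInt_unique.
    apply (is_RInt_opp (V := R_NormedModule)),
      (RInt_correct (V := R_CompleteNormedModule)), Hf. }
  assert (E0 : RInt (fun _ => 0) s t = 0).
  { rewrite RInt_const. unfold scal; simpl. unfold mult; simpl. ring. }
  apply mk_matrix_ext. mat2_cases i j.
  - transitivity (RInt (V := C_R_CompleteNormedModule) (fun u => (0, - c u)) s t).
    { apply (RInt_ext (V := C_R_CompleteNormedModule)). intros u _. rewrite pauli_generator_mat. reflexivity. }
    rewrite RInt_C_pair, E, E0 by assumption. reflexivity.
  - transitivity (RInt (V := C_R_CompleteNormedModule) (fun u => (- b u, - a u)) s t).
    { apply (RInt_ext (V := C_R_CompleteNormedModule)). intros u _. rewrite pauli_generator_mat. reflexivity. }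
    rewrite RInt_C_pair, !E by assumption. reflexivity.
  - transitivity (RInt (V := C_R_CompleteNormedModule) (fun u => (b u, - a u)) s t).
    { apply (RInt_ext (V := C_R_CompleteNormedModule)). intros u _. rewrite pauli_generator_mat. reflexivity. }
    rewrite RInt_C_pair, !E by assumption. reflexivity.
  - transitivity (RInt (V := C_R_CompleteNormedModule) (fun u => (0, c u)) s t).
    { apply (RInt_ext (V := C_R_CompleteNormedModule)). intros u _. rewrite pauli_generator_mat. reflexivity. }
    rewrite RInt_C_pair, E0 by assumption. reflexivity.
Qed.

(** * Iterated commutators *)

Definition fps_triple : Type := fps * fps * fps.

(** The commutator in coordinates, 2 w × x. The factor is written 1 + 1 so that [ring] understands
    it; a constant series 2 would be an atom. *)
Definition fps_ad (w x : fps_triple) : fps_triple :=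
  let '(w1, w2, w3) := w in
  let '(x1, x2, x3) := x in
  let two := (1%:F + 1%:F)%fps in
  (two * (w2 * x3 - w3 * x2), two * (w3 * x1 - w1 * x3),
   two * (w1 * x2 - w2 * x1))%fps.

Fixpoint fps_ad_iter (w x : fps_triple) (j : nat) : fps_triple :=
  match j with O => x | S i => fps_ad w (fps_ad_iter w x i) end.

Definition pauli_coeff (x : fps_triple) (n : nat) : mat2 :=
  let '(x1, x2, x3) := x in pauli_generator (x1 n) (x2 n) (x3 n).

Definition triple_low (x : fps_triple) (n : nat) : Prop :=
  let '(x1, x2, x3) := x in
  forall k, (k < n)%nat -> x1 k = 0 /\ x2 k = 0 /\ x3 k = 0.

Definition triple_agree (n : nat) (x y : fps_triple) : Prop :=
  let '(x1, x2, x3) := x in let '(y1, y2, y3) := y in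
  forall k, (k < n)%nat -> x1 k = y1 k /\ x2 k = y2 k /\ x3 k = y3 k.

Lemma triple_low_le x n m : (m <= n)%nat -> triple_low x n -> triple_low x m.
Proof.
  destruct x as [[x1 x2] x3]. intros H Hx k Hk. apply Hx. lia.
Qed.

Lemma fps_mul_low f g p k : f 0%nat = 0 -> (forall i, (i < p)%nat -> g i = 0) ->
  (k < S p)%nat -> fps_mul f g k = 0.
Proof.
  intros H0 Hg Hk. unfold fps_mul, PS_mult. apply sum_eq_R0.
  intros [|i] Hi; [rewrite H0; ring|]. rewrite (Hg (k - S i)%nat) by lia. ring.
Qed.

Lemma fps_ad_low w x p : triple_low w 1 -> triple_low x p ->
  triple_low (fps_ad w x) (S p).
Proof.
  destruct w as [[w1 w2] w3], x as [[x1 x2] x3]. intros Hw Hx k Hk.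
  destruct (Hw 0%nat ltac:(lia)) as (H1 & H2 & H3). simpl in Hx.
  assert (Hm : forall f g, f 0%nat = 0 -> (g = x1 \/ g = x2 \/ g = x3) ->
     forall i, (i < S p)%nat -> fps_mul f g i = 0).
  { intros f g Hf Hg i Hi. apply (fps_mul_low f g p i Hf); [|exact Hi].
    intros j Hj. destruct (Hx j Hj) as (? & ? & ?).
    destruct Hg as [->|[->| ->]]; assumption. }
  assert (Hs : forall f g, (forall i, (i < S p)%nat -> f i = 0) ->
     (forall i, (i < S p)%nat -> g i = 0) ->
     ((1%:F + 1%:F) * (f - g))%fps k = 0).
  { intros f g Hf Hg. rewrite <- fps_const_add, fps_const_mul.
    unfold fps_sub. rewrite Hf, Hg by exact Hk. ring. }
  split; [|split]; apply Hs; intros i Hi; apply Hm; auto.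
Qed.

(** Each commutator with w raises the order by one, so only j < n contribute in degree n; this
    matches the upper limit n - 1 of the Magnus recursion. *)
Lemma fps_ad_iter_low w x j : triple_low w 1 -> triple_low x 1 ->
  triple_low (fps_ad_iter w x j) (S j).
Proof.
  intros Hw Hx. induction j as [|j IH]; [exact Hx|].
  apply fps_ad_low; assumption.
Qed.

Lemma fps_mul_sum f g n : f 0%nat = 0 -> g 0%nat = 0 ->
  fps_mul f g n = sum_n_m (fun m => f m * g (n - m)%nat) 1 (n - 1).
Proof.
  intros Hf Hg. destruct n as [|[|n]].
  - rewrite sum_n_m_zero by lia. rewrite fps_mul_0, Hf. unfold zero; simpl. ring.
  - rewrite sum_n_m_zero by lia. rewrite fps_mul_S, fps_mul_0, Hf, Hg.
    unfold zero; simpl. ring.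
  - rewrite fps_mul_S, fps_mul_S_r, Hf, Hg.
    replace (S (S n) - 1)%nat with (S n) by lia.
    rewrite <- sum_n_m_S. change (sum_n_m ?a 0 n) with (sum_n a n).
    rewrite sum_n_Reals. unfold fps_mul, PS_mult.
    rewrite Rmult_0_l, Rmult_0_r, Rplus_0_l, Rplus_0_r.
    apply sum_eq. intros i Hi. unfold fps_tl. f_equal. f_equal. lia.
Qed.

Lemma sum_n_m_lin (a b : nat -> R) p q :
  @eq R (sum_n_m (fun m => 2 * (a m - b m)) p q)
    (2 * (sum_n_m a p q - sum_n_m b p q)).
Proof.
  assert (Ep : forall x y : R, plus x y = x + y) by reflexivity.
  induction q as [|q IH].
  - destruct p as [|p]; [rewrite !sum_n_n; reflexivity|].
    rewrite !sum_n_m_zero by lia. unfold zero; simpl. ring.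
  - destruct (Nat.le_gt_cases p (S q)) as [H|H].
    + rewrite !sum_n_Sm by lia. rewrite IH, Ep. unfold plus; simpl. ring.
    + rewrite !sum_n_m_zero by lia. unfold zero; simpl. ring.
Qed.

(** The sum over 1 <= m <= n - 1 is the whole Cauchy product, its two end terms being zero. *)
Lemma pauli_coeff_ad w x n : triple_low w 1 -> triple_low x 1 ->
  sum_n_m (fun m => commutator (pauli_coeff w m) (pauli_coeff x (n - m)))
    1 (n - 1) = pauli_coeff (fps_ad w x) n.
Proof.
  destruct w as [[w1 w2] w3], x as [[x1 x2] x3]. intros Hw Hx.
  destruct (Hw 0%nat ltac:(lia)) as (Hw1 & Hw2 & Hw3).
  destruct (Hx 0%nat ltac:(lia)) as (Hx1 & Hx2 & Hx3).
  simpl pauli_coeff.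
  rewrite (sum_n_m_ext _ (fun m => pauli_generator
     (2 * (w2 m * x3 (n - m)%nat - w3 m * x2 (n - m)%nat))
     (2 * (w3 m * x1 (n - m)%nat - w1 m * x3 (n - m)%nat))
     (2 * (w1 m * x2 (n - m)%nat - w2 m * x1 (n - m)%nat)))).
  2:{ intros m. apply pauli_commutator. }
  rewrite pauli_sum.
  assert (E : forall f g h k : fps, f 0%nat = 0 -> g 0%nat = 0 -> h 0%nat = 0 ->
    k 0%nat = 0 ->
    @eq R (sum_n_m (fun m => 2 * (f m * g (n - m)%nat - h m * k (n - m)%nat))
             1 (n - 1))
      (((1%:F + 1%:F) * (f * g - h * k))%fps n)).
  { intros f g h k Hf Hg Hh Hk.
    rewrite <- fps_const_add, fps_const_mul. unfold fps_sub.
    rewrite !fps_mul_sum by assumption.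
    rewrite (sum_n_m_lin (fun m => f m * g (n - m)%nat)). ring. }
  rewrite !E by assumption. reflexivity.
Qed.

(** [Om] is arbitrary because the recursion uses a table cut off at the current degree, not the full
    sequence of Magnus terms. *)
Lemma magnus_S_pauli (Om : nat -> R -> mat2) (A : R -> mat2) (w x : fps_triple) u :
  triple_low w 1 -> triple_low x 1 ->
  (forall m, Om m u = pauli_coeff w m) ->
  (forall n, (if Nat.eqb n 1 then A u else zero) = pauli_coeff x n) ->
  forall j n, magnus_S Om A j n u = pauli_coeff (fps_ad_iter w x j) n.
Proof.
  intros Hw Hx HOm HA j. induction j as [|j IH]; intros n; [apply HA|].
  simpl magnus_S. simpl fps_ad_iter. rewrite <- pauli_coeff_ad.
  - apply sum_n_m_ext. intros m. rewrite HOm, IH. reflexivity.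
  - exact Hw.
  - apply (triple_low_le _ (S j)); [lia|]. apply fps_ad_iter_low; assumption.
Qed.

Lemma fps_ad_agree w w' x x' n : triple_low w 1 -> triple_low w' 1 ->
  triple_low x 1 -> triple_low x' 1 ->
  triple_agree n w w' -> triple_agree n x x' ->
  triple_agree (S n) (fps_ad w x) (fps_ad w' x').
Proof.
  destruct w as [[w1 w2] w3], x as [[x1 x2] x3], w' as [[w1' w2'] w3'],
    x' as [[x1' x2'] x3'].
  intros Hw Hw' Hx Hx' Aw Ax k Hk.
  destruct (Hw 0%nat ltac:(lia)) as (? & ? & ?).
  destruct (Hx 0%nat ltac:(lia)) as (? & ? & ?).
  destruct (Hw' 0%nat ltac:(lia)) as (? & ? & ?).
  destruct (Hx' 0%nat ltac:(lia)) as (? & ? & ?).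
  assert (Em : forall f f' g g', f 0%nat = 0 -> g' 0%nat = 0 ->
    (forall i, (i < n)%nat -> f i = f' i) -> (forall i, (i < n)%nat -> g i = g' i) ->
    fps_mul f g k = fps_mul f' g' k).
  { intros f f' g g' Hf Hg' Ef Eg.
    rewrite (fps_mul_low_ext k f g g') by (auto; intros; apply Eg; lia).
    rewrite !(fps_mulC _ g'). apply fps_mul_low_ext; [exact Hg'|].
    intros; apply Ef; lia. }
  assert (Es : forall a b a' b', fps_mul a b k = fps_mul a' b' k ->
    forall c d c' d', fps_mul c d k = fps_mul c' d' k ->
    ((1%:F + 1%:F) * (a * b - c * d))%fps k
    = ((1%:F + 1%:F) * (a' * b' - c' * d'))%fps k).
  { intros a b a' b' E1 c d c' d' E2. rewrite <- fps_const_add, !fps_const_mul.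
    unfold fps_sub. rewrite E1, E2. reflexivity. }
  split; [|split]; apply Es; apply Em; try assumption;
    intros i Hi; first [apply Aw; exact Hi|apply Ax; exact Hi].
Qed.

(** As x has order 1, degree n of an iterated commutator sees w only below n. So the cut-off table
    may be exchanged for the full series. *)
Lemma fps_ad_iter_agree w w' x n j : triple_low w 1 -> triple_low w' 1 ->
  triple_low x 1 -> triple_agree n w w' ->
  triple_agree (S n) (fps_ad_iter w x j) (fps_ad_iter w' x j).
Proof.
  intros Hw Hw' Hx Aw. induction j as [|j IH].
  - simpl. destruct x as [[x1 x2] x3]. intros k _. auto.
  - change (triple_agree (S n) (fps_ad w (fps_ad_iter w x j))
      (fps_ad w' (fps_ad_iter w' x j))).
    apply fps_ad_agree; auto;
      try (apply (triple_low_le _ (S j)); [lia|apply fps_ad_iter_low; assumption]).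
    destruct (fps_ad_iter w x j) as [[y1 y2] y3],
      (fps_ad_iter w' x j) as [[z1 z2] z3]. intros k Hk. apply IH. lia.
Qed.

Definition fps_continuous (F : R -> fps) (t : R) : Prop :=
  forall n, continuous (fun u => F u n) t.

Lemma fps_continuous_mul F G t : fps_continuous F t -> fps_continuous G t ->
  fps_continuous (fun u => F u * G u)%fps t.
Proof.
  intros HF HG n. revert F HF. induction n as [|n IH]; intros F HF.
  - apply (continuous_mult (fun u => F u 0%nat) (fun u => G u 0%nat)); auto.
  - apply continuous_ext with
      (f := fun u => F u 0%nat * G u (S n) + fps_mul (fps_tl (F u)) (G u) n).
    { intros u. symmetry. apply fps_mul_S. }
    apply (continuous_plus (fun u => F u 0%nat * G u (S n))).
    + apply (continuous_mult (fun u => F u 0%nat) (fun u => G u (S n))); auto.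
    + apply (IH (fun u => fps_tl (F u))). intros k. apply HF.
Qed.

Lemma fps_continuous_sub F G t : fps_continuous F t -> fps_continuous G t ->
  fps_continuous (fun u => F u - G u)%fps t.
Proof.
  intros HF HG n.
  apply (continuous_minus (fun u => F u n) (fun u => G u n)); auto.
Qed.

Lemma fps_continuous_const f t : fps_continuous (fun _ => f) t.
Proof. intros n. apply continuous_const. Qed.

Definition triple_continuous (x : R -> fps_triple) (t : R) : Prop :=
  fps_continuous (fun u => fst (fst (x u))) t /\
  fps_continuous (fun u => snd (fst (x u))) t /\
  fps_continuous (fun u => snd (x u)) t.

Lemma fps_ad_continuous w x t : triple_continuous w t -> triple_continuous x t ->
  triple_continuous (fun u => fps_ad (w u) (x u)) t.
Proof.
  intros (Hw1 & Hw2 & Hw3) (Hx1 & Hx2 & Hx3).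
  assert (E : forall u, fps_ad (w u) (x u) =
    let two := (1%:F + 1%:F)%fps in
    let w1 := fst (fst (w u)) in let w2 := snd (fst (w u)) in let w3 := snd (w u) in
    let x1 := fst (fst (x u)) in let x2 := snd (fst (x u)) in let x3 := snd (x u) in
  (two * (w2 * x3 - w3 * x2), two * (w3 * x1 - w1 * x3),
   two * (w1 * x2 - w2 * x1))%fps).
  { intros u. destruct (w u) as [[? ?] ?], (x u) as [[? ?] ?]. reflexivity. }
  rewrite (functional_extensionality _ _ E). cbv zeta.
  split; [|split]; simpl;
    (apply (fps_continuous_mul (fun _ => (1%:F + 1%:F)%fps));
      [apply fps_continuous_const|];
     match goal with |- fps_continuous (fun u => @?a u * @?b u - @?c u * @?d u)%fps _ =>
       apply (fps_continuous_sub (fun u => a u * b u)%fps (fun u => c u * d u)%fps) end;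
     [apply fps_continuous_mul|apply fps_continuous_mul]; assumption).
Qed.

Lemma fps_ad_iter_continuous w x t j : triple_continuous w t ->
  triple_continuous x t -> triple_continuous (fun u => fps_ad_iter (w u) (x u) j) t.
Proof.
  intros Hw Hx. induction j as [|j IH]; [exact Hx|].
  apply fps_ad_continuous; assumption.
Qed.

(** * Magnus terms *)

Definition pr1 (x : fps_triple) : fps := fst (fst x).
Definition pr2 (x : fps_triple) : fps := snd (fst x).
Definition pr3 (x : fps_triple) : fps := snd x.

Definition triple_scale (f : fps) (x : fps_triple) : fps_triple :=
  (f * pr1 x, f * pr2 x, f * pr3 x)%fps.

Definition triple_norm2 (w : fps_triple) : fps := fps_norm2 (pr1 w) (pr2 w) (pr3 w).

Lemma fps_ad_scale f w x :
  fps_ad w (triple_scale f x) = triple_scale f (fps_ad w x).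
Proof.
  destruct w as [[w1 w2] w3], x as [[x1 x2] x3].
  unfold triple_scale, fps_ad, pr1, pr2, pr3. simpl. f_equal; [f_equal|]; ring.
Qed.

Lemma triple_scale_scale f g x :
  triple_scale f (triple_scale g x) = triple_scale (f * g)%fps x.
Proof. unfold triple_scale, pr1, pr2, pr3. simpl. f_equal; [f_equal|]; ring. Qed.

(** The identity (w ×)^3 = - |w|^2 (w ×), with the factor 2 of [fps_ad] squared. *)
Lemma fps_ad_cube w x :
  fps_ad w (fps_ad w (fps_ad w x))
  = triple_scale ((-4)%:F * triple_norm2 w)%fps (fps_ad w x).
Proof.
  replace (-4) with (- ((1 + 1) * (1 + 1))) by ring.
  rewrite fps_const_opp, fps_const_mulr, fps_const_add.
  destruct w as [[w1 w2] w3], x as [[x1 x2] x3].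
  unfold triple_scale, triple_norm2, fps_norm2, fps_ad, pr1, pr2, pr3. simpl.
  f_equal; [f_equal|]; ring.
Qed.

Lemma fps_ad_iter_even w x m :
  fps_ad_iter w x (2 * m + 2)
  = triple_scale (((-4) ^ m)%:F * fps_pow (triple_norm2 w) m)%fps
      (fps_ad_iter w x 2).
Proof.
  induction m as [|m IH].
  - simpl. destruct (fps_ad w (fps_ad w x)) as [[y1 y2] y3].
    unfold triple_scale, pr1, pr2, pr3. simpl. f_equal; [f_equal|]; ring.
  - replace (2 * S m + 2)%nat with (S (S (2 * m + 2))) by lia.
    change (fps_ad_iter w x (S (S (2 * m + 2))))
      with (fps_ad w (fps_ad w (fps_ad_iter w x (2 * m + 2)))).
    rewrite IH, !fps_ad_scale.
    change (fps_ad_iter w x 2) with (fps_ad w (fps_ad w x)).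
    rewrite fps_ad_cube, triple_scale_scale. f_equal.
    simpl. rewrite fps_const_mulr. ring.
Qed.

(** One coordinate of the integrand of the n-th Magnus term; the quotient B_j / j! is contained in
    [bern]. *)
Definition bern_sum (pr : fps_triple -> fps) (w x : fps_triple) (n : nat) : R :=
  sum_n_m (fun j => bern j * pr (fps_ad_iter w x j) n) 0 (n - 1).

Definition is_proj (pr : fps_triple -> fps) : Prop :=
  pr = pr1 \/ pr = pr2 \/ pr = pr3.

Lemma triple_low_pr pr x p k : is_proj pr -> triple_low x p -> (k < p)%nat ->
  pr x k = 0.
Proof.
  destruct x as [[x1 x2] x3]. intros Hp Hx Hk.
  destruct (Hx k Hk) as (? & ? & ?).
  destruct Hp as [->|[->| ->]]; assumption.
Qed.

Lemma triple_agree_pr pr x y p k : is_proj pr -> triple_agree p x y ->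
  (k < p)%nat -> pr x k = pr y k.
Proof.
  destruct x as [[x1 x2] x3], y as [[y1 y2] y3]. intros Hp Hx Hk.
  destruct (Hx k Hk) as (? & ? & ?).
  destruct Hp as [->|[->| ->]]; assumption.
Qed.

Lemma triple_scale_pr pr f x : is_proj pr -> pr (triple_scale f x) = (f * pr x)%fps.
Proof. intros [->|[->| ->]]; reflexivity. Qed.

Lemma triple_norm2_0 w : triple_low w 1 -> triple_norm2 w 0%nat = 0.
Proof.
  destruct w as [[w1 w2] w3]. intros H.
  destruct (H 0%nat ltac:(lia)) as (H1 & H2 & H3).
  unfold triple_norm2, fps_norm2, fps_add, pr1, pr2, pr3; simpl.
  rewrite !fps_mul_0, H1, H2, H3. ring.
Qed.

(** Besides j = 0 and j = 1 only even j survive, and even iterates collapse to powers of -4 |w|^2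
    times the second one; their sum is a power series in |w|^2. *)
Lemma bern_sum_closed pr w x : is_proj pr -> triple_low w 1 -> triple_low x 1 ->
  bern_sum pr w x
  = (pr x + (- / 2)%:F * pr (fps_ad_iter w x 1)
     + fps_comp bern_even (triple_norm2 w) * pr (fps_ad_iter w x 2))%fps.
Proof.
  intros Hp Hw Hx. apply functional_extensionality. intros n.
  set (u := fun j => bern j * pr (fps_ad_iter w x j) n).
  assert (Hu : forall j, (n <= j)%nat -> u j = 0).
  { intros j Hj. unfold u.
    rewrite (triple_low_pr pr _ (S j)); [ring|exact Hp| |lia].
    apply fps_ad_iter_low; assumption. }
  (* Vanishing terms are appended so that the sum splits into pairs of an even and an odd index. *)
  transitivity (sum_f_R0 u (2 * (S n) + 1)).
  { unfold bern_sum. change (sum_n_m ?a 0 ?m) with (sum_n a m).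
    rewrite sum_n_Reals. symmetry. apply sum_f_R0_extend; [lia|].
    intros k Hk. apply Hu. lia. }
  rewrite sum_f_R0_even_odd. rewrite decomp_sum by lia. simpl pred.
  unfold fps_add. f_equal.
  { unfold u. change (2 * 0 + 1)%nat with 1%nat. change (2 * 0)%nat with 0%nat.
    rewrite bern_0, bern_1.
    rewrite fps_const_mul. change (fps_ad_iter w x 0) with x. ring. }
  set (sig := pr (fps_ad_iter w x 2)).
  transitivity (sum_f_R0 (fun m => bern_even m *
      (sig * fps_pow (triple_norm2 w) m)%fps n) n).
  - apply sum_eq. intros m _. unfold u.
    replace (2 * S m + 1)%nat with (2 * m + 3)%nat by lia. rewrite bern_odd.
    replace (2 * S m)%nat with (2 * m + 2)%nat by lia.
    rewrite fps_ad_iter_even, triple_scale_pr by exact Hp.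
    rewrite <- fps_mulA, fps_const_mul, (fps_mulC _ sig). unfold bern_even. ring.
  - rewrite (fps_mulC _ sig).
    transitivity (fps_mul sig (fun k => sum_f_R0 (fun m => bern_even m *
      fps_pow (triple_norm2 w) m k) n) n).
    + rewrite (fps_sum_mul sig (fun m k => bern_even m * fps_pow (triple_norm2 w) m k)).
      apply sum_eq. intros m _.
      rewrite (fps_mulC sig (fun k => bern_even m * fps_pow (triple_norm2 w) m k)).
      rewrite fps_mul_scal_l, fps_mulC. reflexivity.
    + apply fps_mul_ext; [reflexivity|]. intros k Hk. symmetry.
      apply fps_comp_extend; [apply triple_norm2_0, Hw|exact Hk].
Qed.

Lemma bern_sum_agree pr w w' x n : is_proj pr ->
  triple_low w 1 -> triple_low w' 1 -> triple_low x 1 -> triple_agree n w w' ->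
  bern_sum pr w x n = bern_sum pr w' x n.
Proof.
  intros Hp Hw Hw' Hx Ha. apply sum_n_m_ext. intros j. f_equal.
  apply (triple_agree_pr pr _ _ (S n)); [exact Hp| |lia].
  apply fps_ad_iter_agree; assumption.
Qed.

Lemma bern_sum_continuous pr w x t n : is_proj pr ->
  triple_continuous w t -> triple_continuous x t ->
  continuous (fun u => bern_sum pr (w u) (x u) n) t.
Proof.
  intros Hp Hw Hx. unfold bern_sum.
  generalize (n - 1)%nat as N. induction N as [|N IH].
  - apply continuous_ext with
      (f := fun u => scal (bern 0%nat) (pr (fps_ad_iter (w u) (x u) 0) n)).
    { intros u. rewrite sum_n_n. reflexivity. }
    apply (continuous_scal_r (V := R_NormedModule)).
    destruct (fps_ad_iter_continuous w x t 0 Hw Hx) as (H1 & H2 & H3).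
    destruct Hp as [E|[E|E]]; rewrite E; [exact (H1 n)|exact (H2 n)|exact (H3 n)].
  - apply continuous_ext with
      (f := fun u => plus (sum_n_m (fun j => bern j * pr (fps_ad_iter (w u) (x u) j) n) 0 N)
        (scal (bern (S N)) (pr (fps_ad_iter (w u) (x u) (S N)) n))).
    { intros u. rewrite sum_n_Sm by lia. reflexivity. }
    apply @continuous_plus; [exact IH|].
    apply (continuous_scal_r (V := R_NormedModule)).
    destruct (fps_ad_iter_continuous w x t (S N) Hw Hx) as (H1 & H2 & H3).
    destruct Hp as [E|[E|E]]; rewrite E; [exact (H1 n)|exact (H2 n)|exact (H3 n)].
Qed.

Section Magnus.

Variables (omega s : R) (phi : R -> R).
(** Continuity on the whole line; a pulse given on a segment will be clamped to it first. *)
Hypothesis phi_continuous : forall t, continuous phi t.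

Let A := pulse_rhs omega phi.

Definition magnus_coeffs (t : R) : fps_triple :=
  (fun n => pauli_a (magnus_term A s n t), fun n => pauli_b (magnus_term A s n t),
   fun n => pauli_c (magnus_term A s n t)).

(** The generator carries exactly one factor z, so the degree in z counts the order of a Magnus
    term. *)
Definition pulse_triple (t : R) : fps_triple :=
  ('zF * (omega * cos (phi t))%:F, 'zF * (omega * sin (phi t))%:F, 0%:F)%fps.

(** Mirrors [strong_rec], whose table holds the default value zero from n on. *)
Definition truncate (n : nat) (x : fps_triple) : fps_triple :=
  (fun k => if Nat.ltb k n then pr1 x k else 0,
   fun k => if Nat.ltb k n then pr2 x k else 0,
   fun k => if Nat.ltb k n then pr3 x k else 0).

Lemma pulse_triple_low t : triple_low (pulse_triple t) 1.
Proof.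
  intros k Hk. replace k with 0%nat by lia. rewrite !fps_X_mul.
  repeat split; reflexivity.
Qed.

Lemma pulse_triple_coeff t n :
  (if Nat.eqb n 1 then A t else zero) = pauli_coeff (pulse_triple t) n.
Proof.
  unfold pulse_triple, pauli_coeff. rewrite !fps_X_mul.
  destruct n as [|[|n]]; [symmetry; apply pauli_zero|reflexivity|].
  symmetry; apply pauli_zero.
Qed.

Lemma pulse_triple_continuous t : triple_continuous pulse_triple t.
Proof.
  unfold pulse_triple. split; [|split]; simpl; intros n.
  - apply continuous_ext with (f := fun u =>
      fps_shift (fps_const (omega * cos (phi u))) n).
    { intros u. rewrite fps_X_mul. reflexivity. }
    destruct n as [|[|n]]; simpl; try apply continuous_const.
    apply (continuous_scal_r (V := R_NormedModule) omega (fun u => cos (phi u))).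
    apply continuous_comp; [apply phi_continuous|apply continuous_cos].
  - apply continuous_ext with (f := fun u =>
      fps_shift (fps_const (omega * sin (phi u))) n).
    { intros u. rewrite fps_X_mul. reflexivity. }
    destruct n as [|[|n]]; simpl; try apply continuous_const.
    apply (continuous_scal_r (V := R_NormedModule) omega (fun u => sin (phi u))).
    apply continuous_comp; [apply phi_continuous|apply continuous_sin].
  - apply continuous_const.
Qed.

Lemma magnus_term_eq n t :
  magnus_term A s n t = mat_RInt (fun u =>
    sum_n_m (fun j => mscal (RtoC (bern j))
      (magnus_S (fun k => if Nat.ltb k n then magnus_term A s k else fun _ => zero)
         A j n u)) 0 (n - 1)) s t.
Proof. unfold magnus_term at 1. rewrite strong_rec_eq. reflexivity. Qed.

Lemma magnus_term_0 t : magnus_term A s 0 t = zero.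
Proof.
  rewrite magnus_term_eq.
  transitivity (mat_RInt (fun _ => pauli_generator 0 0 0) s t).
  - f_equal. apply functional_extensionality. intros u.
    simpl (0 - 1)%nat. rewrite sum_n_n. simpl magnus_S.
    rewrite <- pauli_zero, pauli_mscal. f_equal; ring.
  - rewrite pauli_RInt by apply (ex_RInt_const (V := R_NormedModule)).
    rewrite RInt_const. unfold scal; simpl. unfold mult; simpl.
    rewrite Rmult_0_r. apply pauli_zero.
Qed.

Lemma magnus_coeffs_low t : triple_low (magnus_coeffs t) 1.
Proof.
  intros k Hk. replace k with 0%nat by lia. rewrite magnus_term_0, <- pauli_zero.
  rewrite pauli_a_gen, pauli_b_gen, pauli_c_gen. auto.
Qed.

Lemma truncate_low n x p : triple_low x p -> triple_low (truncate n x) p.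
Proof.
  destruct x as [[x1 x2] x3]. intros H k Hk. destruct (H k Hk) as (? & ? & ?).
  destruct (Nat.ltb k n); auto.
Qed.

Lemma truncate_agree n x : triple_agree n (truncate n x) x.
Proof.
  destruct x as [[x1 x2] x3]. intros k Hk. unfold pr1, pr2, pr3; simpl.
  replace (Nat.ltb k n) with true by (symmetry; apply Nat.ltb_lt; exact Hk). auto.
Qed.

(** Both claims need one joint induction: differentiability of the lower terms makes the integrand
    continuous, hence integrable, and its integral is then a Pauli generator and differentiable in
    turn. *)
Lemma magnus_term_spec n :
  (forall t, magnus_term A s n t = pauli_coeff (magnus_coeffs t) n) /\
  (forall pr, is_proj pr -> forall t,
     is_derive (fun u => pr (magnus_coeffs u) n) t
       (bern_sum pr (magnus_coeffs t) (pulse_triple t) n)).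
Proof.
  induction n as [n IH] using lt_wf_ind.
  set (wn := fun u => truncate n (magnus_coeffs u)).
  assert (Hwn : forall u, triple_low (wn u) 1)
    by (intros u; apply truncate_low, magnus_coeffs_low).
  assert (Hcn : forall u, triple_continuous wn u).
  { intros u. unfold wn, truncate. 
    assert (Hc : forall pr, is_proj pr ->
       fps_continuous (fun v k => if Nat.ltb k n then pr (magnus_coeffs v) k else 0) u).
    { intros pr Hp k. destruct (Nat.ltb_spec k n) as [Hk|Hk].
      - apply (ex_derive_continuous (V := R_NormedModule)).
        eexists. apply (proj2 (IH k Hk)). exact Hp.
      - apply continuous_const. }
    split; [|split]; apply Hc; unfold is_proj; auto. }
  set (F := fun pr u => bern_sum pr (wn u) (pulse_triple u) n).
  assert (HF : forall pr, is_proj pr -> forall u, continuous (F pr) u).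
  { intros pr Hp u. apply bern_sum_continuous; auto. apply pulse_triple_continuous. }
  assert (HI : forall pr, is_proj pr -> forall t, ex_RInt (F pr) s t).
  { intros pr Hp t. apply (ex_RInt_continuous (V := R_CompleteNormedModule)).
    intros; apply HF, Hp. }
  assert (P1 : is_proj pr1) by (unfold is_proj; auto).
  assert (P2 : is_proj pr2) by (unfold is_proj; auto).
  assert (P3 : is_proj pr3) by (unfold is_proj; auto).
  assert (HM : forall t, magnus_term A s n t
    = pauli_generator (RInt (F pr1) s t) (RInt (F pr2) s t) (RInt (F pr3) s t)).
  { intros t. rewrite magnus_term_eq, <- pauli_RInt by auto.
    f_equal. apply functional_extensionality. intros u.
    rewrite (sum_n_m_ext _ (fun j => pauli_generator
       (bern j * pr1 (fps_ad_iter (wn u) (pulse_triple u) j) n)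
       (bern j * pr2 (fps_ad_iter (wn u) (pulse_triple u) j) n)
       (bern j * pr3 (fps_ad_iter (wn u) (pulse_triple u) j) n))).
    - apply pauli_sum.
    - intros j. rewrite (magnus_S_pauli _ A (wn u) (pulse_triple u)).
      + destruct (fps_ad_iter (wn u) (pulse_triple u) j) as [[y1 y2] y3].
        apply pauli_mscal.
      + apply Hwn.
      + apply pulse_triple_low.
      + intros m. unfold wn, truncate. simpl.
        destruct (Nat.ltb_spec m n) as [Hm|Hm]; [apply (IH m Hm)|].
        symmetry; apply pauli_zero.
      + intros k. apply pulse_triple_coeff. }
  assert (HC : forall pr, is_proj pr -> forall t,
    pr (magnus_coeffs t) n = RInt (F pr) s t).
  { intros pr [E|[E|E]] t; rewrite E.
    - change (pauli_a (magnus_term A s n t) = RInt (F pr1) s t).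
      rewrite HM. apply pauli_a_gen.
    - change (pauli_b (magnus_term A s n t) = RInt (F pr2) s t).
      rewrite HM. apply pauli_b_gen.
    - change (pauli_c (magnus_term A s n t) = RInt (F pr3) s t).
      rewrite HM. apply pauli_c_gen. }
  split.
  - intros t. rewrite HM, <- !HC by assumption. reflexivity.
  - intros pr Hp t.
    apply is_derive_ext with (f := fun u => RInt (F pr) s u).
    { intros u. symmetry. apply HC, Hp. }
    (* [F] is built from the cut-off table; degree n does not see the difference. *)
    replace (bern_sum pr (magnus_coeffs t) (pulse_triple t) n) with (F pr t).
    + apply (is_derive_RInt (V := R_NormedModule) (F pr) (RInt (F pr) s) s t).
      * exists (mkposreal 1 Rlt_0_1). intros v _.
        apply (RInt_correct (V := R_CompleteNormedModule)), HI, Hp.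
      * apply HF, Hp.
    + apply bern_sum_agree; auto.
      * apply magnus_coeffs_low.
      * apply pulse_triple_low.
      * apply truncate_agree.
Qed.

Lemma magnus_derive pr : is_proj pr -> forall t,
  fps_is_derive (fun u => pr (magnus_coeffs u)) t
    (pr (pulse_triple t)
     + (- / 2)%:F * pr (fps_ad (magnus_coeffs t) (pulse_triple t))
     + fps_comp bern_even (triple_norm2 (magnus_coeffs t))
       * pr (fps_ad (magnus_coeffs t)
               (fps_ad (magnus_coeffs t) (pulse_triple t))))%fps.
Proof.
  intros Hp t n.
  pose proof (bern_sum_closed pr (magnus_coeffs t) (pulse_triple t) Hp
    (magnus_coeffs_low t) (pulse_triple_low t)) as H.
  exact (eq_ind _ (is_derive (fun u => pr (magnus_coeffs u) n) t)
    (proj2 (magnus_term_spec n) pr Hp t) _ (f_equal (fun f : fps => f n) H)).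
Qed.

End Magnus.

(** * Coefficients of the exponential *)

(** Coefficients in z of the unit quaternion solving E' = z (x, y, 0) E. *)
Definition dyson (x y : R -> R) (s : R) (E0 E1 E2 E3 : R -> fps) : Prop :=
  (E0 s = 1%:F /\ E1 s = 0%:F /\ E2 s = 0%:F /\ E3 s = 0%:F) /\
  (forall t, E0 t 0%nat = 1 /\ E1 t 0%nat = 0 /\ E2 t 0%nat = 0 /\ E3 t 0%nat = 0) /\
  forall n t,
    is_derive (fun u => E0 u (S n)) t (- (x t * E1 t n + y t * E2 t n)) /\
    is_derive (fun u => E1 u (S n)) t (x t * E0 t n + y t * E3 t n) /\
    is_derive (fun u => E2 u (S n)) t (y t * E0 t n - x t * E3 t n) /\
    is_derive (fun u => E3 u (S n)) t (x t * E2 t n - y t * E1 t n).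

Definition exp_scalar (w : fps_triple) : fps := fps_comp cos_n (triple_norm2 w).
Definition exp_vector (pr : fps_triple -> fps) (w : fps_triple) : fps :=
  (fps_comp sin_n (triple_norm2 w) * pr w)%fps.

Lemma fps_comp_0 c : fps_comp c 0%:F = (c 0%nat)%:F.
Proof. rewrite fps_comp_rec by reflexivity. ring. Qed.

(** Stated for any solution w of the closed equation, as it serves both the Magnus coefficients and
    the exponent of a constant pulse. *)
Lemma dyson_exp (w : R -> fps_triple) (x y : R -> R) s :
  (forall t, triple_low (w t) 1) ->
  w s = (0%:F, 0%:F, 0%:F) ->
  (forall t,
    let g := (4%:F * fps_comp bern_even (triple_norm2 (w t)))%fps in
    let p := (pr1 (w t) * (x t)%:F + pr2 (w t) * (y t)%:F)%fps in
    fps_is_derive (fun u => pr1 (w u)) t ('zF * ((x t)%:F + pr3 (w t) * (y t)%:F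
      + g * (pr1 (w t) * p - triple_norm2 (w t) * (x t)%:F)))%fps /\
    fps_is_derive (fun u => pr2 (w u)) t ('zF * ((y t)%:F - pr3 (w t) * (x t)%:F
      + g * (pr2 (w t) * p - triple_norm2 (w t) * (y t)%:F)))%fps /\
    fps_is_derive (fun u => pr3 (w u)) t ('zF * (pr2 (w t) * (x t)%:F
      - pr1 (w t) * (y t)%:F + g * (pr3 (w t) * p)))%fps) ->
  dyson x y s (fun t => exp_scalar (w t)) (fun t => exp_vector pr1 (w t))
    (fun t => exp_vector pr2 (w t)) (fun t => exp_vector pr3 (w t)).
Proof.
  intros Hlow Hs Hd.
  assert (L : forall pr, is_proj pr -> forall t, pr (w t) 0%nat = 0).
  { intros pr Hp t. apply (triple_low_pr pr _ 1); auto. }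
  assert (P1 : is_proj pr1) by (unfold is_proj; auto).
  assert (P2 : is_proj pr2) by (unfold is_proj; auto).
  assert (P3 : is_proj pr3) by (unfold is_proj; auto).
  split; [|split].
  - unfold exp_scalar, exp_vector. rewrite Hs.
    replace (triple_norm2 (0%:F, 0%:F, 0%:F)) with (0%:F)
      by (unfold triple_norm2, fps_norm2, pr1, pr2, pr3; simpl; ring).
    rewrite !fps_comp_0. unfold pr1, pr2, pr3; simpl.
    replace (cos_n 0) with 1 by (unfold cos_n; simpl; field).
    repeat split; ring.
  - intros t. unfold exp_scalar, exp_vector.
    rewrite !fps_mul_0, !L by assumption.
    unfold fps_comp; simpl. replace (cos_n 0) with 1 by (unfold cos_n; simpl; field).
    repeat split; ring.
  - intros n t. destruct (Hd t) as (H1 & H2 & H3).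
    destruct (formal_exp_derive (fun u => pr1 (w u)) (fun u => pr2 (w u))
      (fun u => pr3 (w u)) (x t) (y t) t (L pr1 P1) (L pr2 P2) (L pr3 P3)
      H1 H2 H3) as (D0 & D1 & D2 & D3).
    specialize (D0 (S n)). specialize (D1 (S n)).
    specialize (D2 (S n)). specialize (D3 (S n)).
    unfold fps_opp in D0. rewrite fps_X_mul in D0, D1, D2, D3.
    simpl fps_shift in D0, D1, D2, D3.
    unfold fps_add, fps_sub in D0, D1, D2, D3.
    rewrite !fps_const_mul in D0, D1, D2, D3.
    split; [exact D0|split; [exact D1|split; [exact D2|exact D3]]].
Qed.

(** The second part is w × (w × x) = w (w . x) - |w|^2 x, times 4. It brings [magnus_derive] into
    the form required by [dyson_exp]. *)
Lemma pr_ad w x1 x2 :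
  let x := ('zF * x1%:F, 'zF * x2%:F, 0%:F)%fps in
  let w1 := pr1 w in let w2 := pr2 w in let w3 := pr3 w in
  let p := (w1 * x1%:F + w2 * x2%:F)%fps in
  let four := ((1%:F + 1%:F) * (1%:F + 1%:F))%fps in
  fps_ad w x = ((1%:F + 1%:F) * (- ('zF * (w3 * x2%:F))),
     (1%:F + 1%:F) * ('zF * (w3 * x1%:F)),
     (1%:F + 1%:F) * ('zF * (w1 * x2%:F - w2 * x1%:F)))%fps /\
  fps_ad w (fps_ad w x) =
    (four * ('zF * (w1 * p - triple_norm2 w * x1%:F)),
     four * ('zF * (w2 * p - triple_norm2 w * x2%:F)), four * ('zF * (w3 * p)))%fps.
Proof.
  destruct w as [[w1 w2] w3]. unfold fps_ad, triple_norm2, fps_norm2, pr1, pr2, pr3.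
  simpl. split; (f_equal; [f_equal|]; ring).
Qed.

Lemma fps_half_two f : ((- / 2)%:F * ((1%:F + 1%:F) * f) = - f)%fps.
Proof.
  transitivity ((- / 2)%:F * (1%:F + 1%:F) * f)%fps; [ring|].
  rewrite <- fps_const_add, <- fps_const_mulr.
  replace (- / 2 * (1 + 1)) with (- (1)) by field.
  rewrite fps_const_opp. ring.
Qed.

Lemma fps_four : 4%:F = ((1%:F + 1%:F) * (1%:F + 1%:F))%fps.
Proof.
  rewrite <- !fps_const_add, <- fps_const_mulr. apply f_equal. ring.
Qed.

Lemma magnus_term_start omega s phi n :
  magnus_term (pulse_rhs omega phi) s n s = zero.
Proof.
  rewrite magnus_term_eq. apply mk_matrix_ext. intros i j _ _.
  apply (RInt_point (V := C_R_CompleteNormedModule)).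
Qed.

Lemma magnus_dyson omega s phi : (forall t, continuous phi t) ->
  let w := magnus_coeffs omega s phi in
  dyson (fun t => omega * cos (phi t)) (fun t => omega * sin (phi t)) s
    (fun t => exp_scalar (w t)) (fun t => exp_vector pr1 (w t))
    (fun t => exp_vector pr2 (w t)) (fun t => exp_vector pr3 (w t)).
Proof.
  intros Hphi w. apply dyson_exp.
  - apply magnus_coeffs_low.
  - unfold w, magnus_coeffs.
    assert (Z : forall f : mat2 -> R, (forall a b c, f (pauli_generator a b c) = a)
      \/ (forall a b c, f (pauli_generator a b c) = b)
      \/ (forall a b c, f (pauli_generator a b c) = c) ->
      (fun n => f (magnus_term (pulse_rhs omega phi) s n s)) = 0%:F).
    { intros f Hf. apply functional_extensionality. intros n.
      rewrite magnus_term_start, <- pauli_zero.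
      destruct Hf as [H|[H|H]]; rewrite H; destruct n; reflexivity. }
    rewrite !Z; [reflexivity| | |].
    + right; right. apply pauli_c_gen.
    + right; left. apply pauli_b_gen.
    + left. apply pauli_a_gen.
  - intros t.
    destruct (pr_ad (w t) (omega * cos (phi t)) (omega * sin (phi t))) as [A1 A2].
    assert (D : forall pr, is_proj pr -> fps_is_derive (fun u => pr (w u)) t
      (pr (pulse_triple omega phi t)
       + (- / 2)%:F * pr (fps_ad (w t) (pulse_triple omega phi t))
       + fps_comp bern_even (triple_norm2 (w t))
         * pr (fps_ad (w t) (fps_ad (w t) (pulse_triple omega phi t))))%fps).
    { intros pr Hp. apply magnus_derive; assumption. }
    unfold pulse_triple in D. rewrite A2, A1 in D. rewrite fps_four.
    clear A1 A2. clearbody w. set (wt := w t) in *. clearbody wt.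
    destruct wt as [[w1 w2] w3].
    split; [|split].
    + eapply fps_is_derive_ext; [reflexivity| |apply D; unfold is_proj; auto].
      unfold pr1, pr2, pr3; simpl. rewrite fps_half_two. ring.
    + eapply fps_is_derive_ext; [reflexivity| |apply D; unfold is_proj; auto].
      unfold pr1, pr2, pr3; simpl. rewrite fps_half_two. ring.
    + eapply fps_is_derive_ext; [reflexivity| |apply D; unfold is_proj; auto].
      unfold pr1, pr2, pr3; simpl. rewrite fps_half_two. ring.
Qed.

(** * The constant pulse as reference solution: its generators commute, so the exponent is linear in
    z and in t *)

Definition line_triple (x y s t : R) : fps_triple :=
  ('zF * ((t - s) * x)%:F, 'zF * ((t - s) * y)%:F, 0%:F)%fps.

Lemma line_derive x s t :
  fps_is_derive (fun u => 'zF * ((u - s) * x)%:F)%fps t ('zF * x%:F)%fps.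
Proof.
  intros n. rewrite fps_X_mul.
  apply is_derive_ext with (f := fun u => fps_shift (fps_const ((u - s) * x)) n).
  { intros u. rewrite fps_X_mul. reflexivity. }
  destruct n as [|[|n]]; simpl; [apply (is_derive_const 0 t)| |apply (is_derive_const 0 t)].
  auto_derive; [exact I|ring].
Qed.

Lemma line_dyson x y s :
  let w := line_triple x y s in
  dyson (fun _ => x) (fun _ => y) s
    (fun t => exp_scalar (w t)) (fun t => exp_vector pr1 (w t))
    (fun t => exp_vector pr2 (w t)) (fun t => exp_vector pr3 (w t)).
Proof.
  intros w. apply dyson_exp.
  - intros t k Hk. replace k with 0%nat by lia.
    rewrite !fps_X_mul. repeat split; reflexivity.
  - unfold w, line_triple. replace ((s - s) * x) with 0 by ring.
    replace ((s - s) * y) with 0 by ring.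
    f_equal; f_equal; ring.
  - intros t. unfold w, line_triple, triple_norm2, fps_norm2, pr1, pr2, pr3. simpl fst. simpl snd.
    rewrite !fps_const_mulr.
    split; [|split].
    + eapply fps_is_derive_ext; [reflexivity| |apply line_derive]. ring.
    + eapply fps_is_derive_ext; [reflexivity| |apply line_derive]. ring.
    + eapply fps_is_derive_ext; [reflexivity| |apply fps_is_derive_const]. ring.
Qed.

Lemma is_pseries_const a z : is_pseries a%:F z a.
Proof.
  apply is_pseries_R, is_series_Reals. intros e He. exists 0%nat. intros n _.
  rewrite (sum_f_R0_extend _ 0 n); [|lia|].
  - unfold R_dist. simpl. replace (a * 1 - a) with 0 by ring. rewrite Rabs_R0. exact He.
  - intros [|k] Hk; [lia|]. simpl. ring.
Qed.

Lemma l1_const r a : fps_l1_le r a%:F (Rabs a).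
Proof.
  intros N. rewrite (sum_f_R0_extend _ 0 N); [|lia|].
  - simpl. lra.
  - intros [|k] Hk; [lia|]. simpl. rewrite Rabs_R0. ring.
Qed.

Lemma is_pseries_shift f z l : is_pseries f z l -> is_pseries (fps_shift f) z (z * l).
Proof.
  intros H. apply is_pseries_ext with (a := PS_incr_1 f).
  - intros [|n]; reflexivity.
  - apply (is_pseries_incr_1 f z l H).
Qed.

Lemma l1_shift r f P : 0 <= r -> fps_l1_le r f P -> fps_l1_le r (fps_shift f) (r * P).
Proof.
  intros Hr Hf [|N].
  - simpl. rewrite Rabs_R0. pose proof (l1_pos r f P Hr Hf). nra.
  - rewrite decomp_sum by lia. simpl pred. change (fps_shift f 0%nat) with 0.
    rewrite Rabs_R0, Rmult_0_l, Rplus_0_l.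
    eapply Rle_trans; [|apply Rmult_le_compat_l; [exact Hr|apply (Hf N)]].
    rewrite scal_sum. apply sum_Rle. intros k _. simpl. right. ring.
Qed.

(** Only the scalar part is evaluated: cos |w| alone detects that the norm reaches PI. *)
Lemma exp_scalar_eval r z w P (a b c : R) : 0 <= z < r ->
  triple_low w 1 ->
  (forall pr, is_proj pr -> fps_l1_le r (pr w) P) ->
  is_pseries (pr1 w) z a -> is_pseries (pr2 w) z b -> is_pseries (pr3 w) z c ->
  is_pseries (triple_norm2 w) z (a ^ 2 + b ^ 2 + c ^ 2) /\
  (exists Q, fps_l1_le r (triple_norm2 w) Q) /\
  is_pseries (exp_scalar w) z (cos (sqrt (a ^ 2 + b ^ 2 + c ^ 2))).
Proof.
  intros Hz Hw HP Ha Hb Hc.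
  assert (P1 : is_proj pr1) by (unfold is_proj; auto).
  assert (P2 : is_proj pr2) by (unfold is_proj; auto).
  assert (P3 : is_proj pr3) by (unfold is_proj; auto).
  assert (Hn : is_pseries (triple_norm2 w) z (a ^ 2 + b ^ 2 + c ^ 2)).
  { replace (a ^ 2 + b ^ 2 + c ^ 2) with (plus (plus (a * a) (b * b)) (c * c))
      by (unfold plus; simpl; ring).
    unfold triple_norm2, fps_norm2.
    apply (is_pseries_plus (fun n => (pr1 w * pr1 w + pr2 w * pr2 w)%fps n)
      (fun n => (pr3 w * pr3 w)%fps n)).
    - apply (is_pseries_plus (fun n => (pr1 w * pr1 w)%fps n)
        (fun n => (pr2 w * pr2 w)%fps n));
        eapply is_pseries_fps_mul; eauto.
    - eapply is_pseries_fps_mul; eauto. }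
  assert (HQ : fps_l1_le r (triple_norm2 w) (P * P + P * P + P * P)).
  { assert (Hr : 0 <= r) by lra. unfold triple_norm2, fps_norm2.
    repeat apply l1_add; try exact Hr; apply l1_mul; auto. }
  split; [exact Hn|split; [eexists; exact HQ|]].
  eapply is_pseries_fps_comp.
  - exact Hz.
  - apply triple_norm2_0, Hw.
  - exact HQ.
  - apply l1_entire; [|exact cos_n_bound].
    eapply l1_pos; [|exact HQ]. lra.
  - exact Hn.
  - rewrite <- (pow2_sqrt (a ^ 2 + b ^ 2 + c ^ 2)) at 1.
    + apply is_pseries_cos.
    + nra.
Qed.

Lemma line_eval x y s t omega z : 0 <= z -> 0 <= omega -> s <= t ->
  x ^ 2 + y ^ 2 = omega ^ 2 ->
  is_pseries (exp_scalar (line_triple x y s t)) z (cos (z * (omega * (t - s)))).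
Proof.
  intros Hz Ho Ht Hxy.
  replace (z * (omega * (t - s))) with
    (sqrt ((z * ((t - s) * x)) ^ 2 + (z * ((t - s) * y)) ^ 2 + 0 ^ 2)).
  2:{ replace ((z * ((t - s) * x)) ^ 2 + (z * ((t - s) * y)) ^ 2 + 0 ^ 2)
        with ((z * (t - s)) ^ 2 * (x ^ 2 + y ^ 2)) by ring.
      rewrite Hxy, <- Rpow_mult_distr, sqrt_pow2; [ring|].
      apply Rmult_le_pos; [apply Rmult_le_pos; lra|exact Ho]. }
  set (P := (z + 1) * Rabs ((t - s) * x) + (z + 1) * Rabs ((t - s) * y)).
  apply (exp_scalar_eval (z + 1) z (line_triple x y s t) P).
  - lra.
  - intros k Hk. replace k with 0%nat by lia.
    rewrite !fps_X_mul. repeat split; reflexivity.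
  - pose proof (Rabs_pos ((t - s) * x)). pose proof (Rabs_pos ((t - s) * y)).
    assert (L : forall a b, b <= P -> (z + 1) * Rabs a <= b ->
       fps_l1_le (z + 1) ('zF * a%:F)%fps P).
    { intros a b Hb Ha N. rewrite fps_X_mul.
      apply Rle_trans with ((z + 1) * Rabs a); [|lra].
      apply l1_shift; [lra|]. apply l1_const. }
    intros pr [->|[->| ->]]; unfold line_triple, pr1, pr2, pr3; simpl.
    + apply (L _ ((z + 1) * Rabs ((t - s) * x))); [unfold P; nra|lra].
    + apply (L _ ((z + 1) * Rabs ((t - s) * y))); [unfold P; nra|lra].
    + intros N. eapply Rle_trans; [apply l1_const|]. rewrite Rabs_R0. unfold P. nra.
  - unfold line_triple, pr1; simpl. rewrite fps_X_mul.
    apply is_pseries_shift, is_pseries_const.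
  - unfold line_triple, pr2; simpl. rewrite fps_X_mul.
    apply is_pseries_shift, is_pseries_const.
  - apply is_pseries_const.
Qed.

(** * Comparison of the expansions of two pulses *)

Lemma increment_le (f g : R -> R) (f' g' : R -> R) s e :
  (forall t, s < t < e -> is_derive f t (f' t)) ->
  (forall t, s < t < e -> is_derive g t (g' t)) ->
  (forall t, s <= t <= e -> continuous f t) ->
  (forall t, s <= t <= e -> continuous g t) ->
  (forall t, s < t < e -> Rabs (f' t) <= g' t) ->
  s <= e -> Rabs (f e - f s) <= g e - g s.
Proof.
  intros Hf Hg Cf Cg Hle [Hse| ->].
  2:{ rewrite Rminus_eq_0, Rabs_R0. lra. }
  assert (M : forall (h h' : R -> R),
    (forall t, s < t < e -> is_derive h t (h' t)) ->
    (forall t, s <= t <= e -> continuous h t) ->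
    (forall t, s < t < e -> 0 <= h' t) -> h s <= h e).
  { intros h h' Dh Ch Hh.
    (* The intermediate point may be an end point, where [h'] is not controlled; the derivative is
       redefined as 0 there, which keeps it nonnegative. *)
    destruct (MVT_gen h s e (fun t => if Rlt_dec s t then
       (if Rlt_dec t e then h' t else 0) else 0)) as (c & Hc & E).
    - rewrite Rmin_left, Rmax_right by lra. intros t Ht.
      destruct (Rlt_dec s t); [|lra]. destruct (Rlt_dec t e); [|lra].
      apply Dh, Ht.
    - rewrite Rmin_left, Rmax_right by lra. intros t Ht.
      apply continuity_pt_filterlim. apply Ch, Ht.
    - cbv beta in E. destruct (Rlt_dec s c); [|nra].
      destruct (Rlt_dec c e); [|nra]. specialize (Hh c ltac:(lra)). nra. }
  assert (M1 := M (fun t => g t - f t) (fun t => g' t - f' t)).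
  assert (M2 := M (fun t => g t + f t) (fun t => g' t + f' t)).
  apply Rabs_le. split.
  - assert (g s + f s <= g e + f e); [|lra]. apply M2.
    + intros t Ht. apply (is_derive_plus g f); auto.
    + intros t Ht. apply (continuous_plus g f); auto.
    + intros t Ht. specialize (Hle t Ht). apply Rabs_le_between in Hle. lra.
  - assert (g s - f s <= g e - f e); [|lra]. apply M1.
    + intros t Ht. apply (is_derive_minus g f); auto.
    + intros t Ht. apply (continuous_minus g f); auto.
    + intros t Ht. specialize (Hle t Ht). apply Rabs_le_between in Hle. lra.
Qed.

(** Majorant in degree n: the term of exp (2 omega (t - s)). The 2 comes from the two products in
    each component of the equation. *)
Definition exp_term (omega s : R) (n : nat) (t : R) : R :=
  (2 * omega * (t - s)) ^ n / INR (fact n).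

Lemma exp_term_derive omega s n t :
  is_derive (exp_term omega s (S n)) t (2 * omega * exp_term omega s n t).
Proof.
  unfold exp_term.
  assert (HK : INR (fact (S n)) = INR (S n) * INR (fact n)) by apply mult_INR.
  set (K := INR (fact (S n))) in *. clearbody K.
  assert (Hn : INR (S n) <> 0) by (apply not_0_INR; lia).
  auto_derive; [exact I|]. rewrite HK.
  change (match n with 0%nat => 1 | S _ => INR n + 1 end) with (INR (S n)).
  simpl pred. replace (t + - s) with (t - s) by ring. field. split; [apply INR_fact_neq_0|exact Hn].
Qed.

Lemma exp_term_start omega s n : exp_term omega s (S n) s = 0.
Proof. unfold exp_term. rewrite Rminus_eq_0. simpl. unfold Rdiv. ring. Qed.

Lemma exp_term_pos omega s n t : 0 <= omega -> s <= t -> 0 <= exp_term omega s n t.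
Proof.
  intros Ho Ht. unfold exp_term. apply Rmult_le_pos.
  - apply pow_le. apply Rmult_le_pos; lra.
  - left. apply Rinv_0_lt_compat, INR_fact_lt_0.
Qed.

Lemma exp_term_step (f f' : R -> R) omega s e K n : s <= e ->
  (forall t, is_derive f t (f' t)) -> f s = 0 ->
  (forall t, s <= t <= e -> Rabs (f' t) <= K * (2 * omega * exp_term omega s n t)) ->
  forall t, s <= t <= e -> Rabs (f t) <= K * exp_term omega s (S n) t.
Proof.
  intros Hse Df Hf Hb t Ht.
  pose proof (increment_le f (fun u => K * exp_term omega s (S n) u) f'
    (fun u => K * (2 * omega * exp_term omega s n u)) s t) as H.
  rewrite Hf, exp_term_start, Rmult_0_r, !Rminus_0_r in H. apply H.
  - intros u _. apply Df.
  - intros u _. apply (is_derive_scal (exp_term omega s (S n))), exp_term_derive.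
  - intros u _. apply (ex_derive_continuous (V := R_NormedModule)).
    eexists; apply Df.
  - intros u _. apply (ex_derive_continuous (V := R_NormedModule)).
    eexists. apply (is_derive_scal (exp_term omega s (S n))), exp_term_derive.
  - intros u Hu. apply Hb. lra.
  - lra.
Qed.

Lemma Rabs_lin_le a b c d A h : Rabs a <= A -> Rabs b <= A ->
  Rabs c <= h -> Rabs d <= h -> Rabs (a * c + b * d) <= 2 * A * h.
Proof.
  intros Ha Hb Hc Hd. eapply Rle_trans; [apply Rabs_triang|].
  rewrite !Rabs_mult.
  pose proof (Rmult_le_compat _ _ _ _ (Rabs_pos a) (Rabs_pos c) Ha Hc).
  pose proof (Rmult_le_compat _ _ _ _ (Rabs_pos b) (Rabs_pos d) Hb Hd). lra.
Qed.

Section Compare.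

Variables (x y x' y' : R -> R) (s e omega eps : R).
Variables E0 E1 E2 E3 F0 F1 F2 F3 : R -> fps.
Hypothesis s_le_e : s <= e.
Hypothesis omega_pos : 0 <= omega.
Hypothesis eps_pos : 0 <= eps.
Hypothesis dyson_E : dyson x y s E0 E1 E2 E3.
Hypothesis dyson_F : dyson x' y' s F0 F1 F2 F3.
Hypothesis x_bound : forall t, s <= t <= e -> Rabs (x t) <= omega.
Hypothesis y_bound : forall t, s <= t <= e -> Rabs (y t) <= omega.
Hypothesis x'_bound : forall t, s <= t <= e -> Rabs (x' t) <= omega.
Hypothesis y'_bound : forall t, s <= t <= e -> Rabs (y' t) <= omega.
Hypothesis x_close : forall t, s <= t <= e -> Rabs (x t - x' t) <= omega * eps.
Hypothesis y_close : forall t, s <= t <= e -> Rabs (y t - y' t) <= omega * eps.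

Lemma dyson_bound n t : s <= t <= e ->
  Rabs (F0 t n) <= exp_term omega s n t /\ Rabs (F1 t n) <= exp_term omega s n t /\
  Rabs (F2 t n) <= exp_term omega s n t /\ Rabs (F3 t n) <= exp_term omega s n t.
Proof.
  destruct dyson_F as ((S0 & S1 & S2 & S3) & Z & D).
  revert t. induction n as [|n IH]; intros t Ht.
  - destruct (Z t) as (-> & -> & -> & ->).
    replace (exp_term omega s 0 t) with 1 by (unfold exp_term; simpl; field).
    rewrite Rabs_R1, Rabs_R0. lra.
  - assert (H : forall (f : R -> fps) f', f s (S n) = 0 ->
      (forall t, is_derive (fun u => f u (S n)) t (f' t)) ->
      (forall t, s <= t <= e -> Rabs (f' t) <= 2 * omega * exp_term omega s n t) ->
      Rabs (f t (S n)) <= exp_term omega s (S n) t).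
    { intros f f' Hs Df Hb. rewrite <- (Rmult_1_l (exp_term omega s (S n) t)).
      apply (exp_term_step (fun u => f u (S n)) f' omega s e 1 n); auto.
      intros u Hu. rewrite Rmult_1_l. auto. }
    split; [|split; [|split]].
    + apply (H F0 (fun t => - (x' t * F1 t n + y' t * F2 t n))).
      * rewrite S0. reflexivity.
      * intros u. apply D.
      * intros u Hu. destruct (IH u Hu) as (? & ? & ? & ?).
        rewrite Rabs_Ropp. apply Rabs_lin_le; auto.
    + apply (H F1 (fun t => x' t * F0 t n + y' t * F3 t n)).
      * rewrite S1. reflexivity.
      * intros u. apply D.
      * intros u Hu. destruct (IH u Hu) as (? & ? & ? & ?).
        apply Rabs_lin_le; auto.
    + apply (H F2 (fun t => y' t * F0 t n - x' t * F3 t n)).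
      * rewrite S2. reflexivity.
      * intros u. apply D.
      * intros u Hu. destruct (IH u Hu) as (? & ? & ? & ?).
        replace (y' u * F0 u n - x' u * F3 u n)
          with (y' u * F0 u n + - x' u * F3 u n) by ring.
        apply Rabs_lin_le; rewrite ?Rabs_Ropp; auto.
    + apply (H F3 (fun t => x' t * F2 t n - y' t * F1 t n)).
      * rewrite S3. reflexivity.
      * intros u. apply D.
      * intros u Hu. destruct (IH u Hu) as (? & ? & ? & ?).
        replace (x' u * F2 u n - y' u * F1 u n)
          with (x' u * F2 u n + - y' u * F1 u n) by ring.
        apply Rabs_lin_le; rewrite ?Rabs_Ropp; auto.
Qed.

(** Degree n contains n factors of the pulse; exchanging them one by one costs eps each, whence the
    factor n. *)
Lemma dyson_compare n t : s <= t <= e ->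
  let B := eps * INR n * exp_term omega s n t in
  Rabs (E0 t n - F0 t n) <= B /\ Rabs (E1 t n - F1 t n) <= B /\
  Rabs (E2 t n - F2 t n) <= B /\ Rabs (E3 t n - F3 t n) <= B.
Proof.
  destruct dyson_E as ((S0 & S1 & S2 & S3) & Z & D).
  destruct dyson_F as ((S0' & S1' & S2' & S3') & Z' & D').
  revert t. induction n as [|n IH]; intros t Ht B.
  - destruct (Z t) as (-> & -> & -> & ->). destruct (Z' t) as (-> & -> & -> & ->).
    unfold B. simpl. rewrite !Rminus_eq_0, Rabs_R0. lra.
  - assert (H : forall (f g : R -> fps) f' g', f s (S n) = 0 -> g s (S n) = 0 ->
      (forall t, is_derive (fun u => f u (S n)) t (f' t)) ->
      (forall t, is_derive (fun u => g u (S n)) t (g' t)) ->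
      (forall t, s <= t <= e -> Rabs (f' t - g' t) <=
         2 * omega * (eps * INR n * exp_term omega s n t)
         + 2 * (omega * eps) * exp_term omega s n t) ->
      Rabs (f t (S n) - g t (S n)) <= B).
    { intros f g f' g' Hf Hg Df Dg Hb. unfold B.
      apply (exp_term_step (fun u => f u (S n) - g u (S n)) (fun u => f' u - g' u)
        omega s e (eps * INR (S n)) n); auto.
      - intros u. apply (is_derive_minus (fun u => f u (S n)) (fun u => g u (S n))); auto.
      - rewrite Hf, Hg. ring.
      - intros u Hu. eapply Rle_trans; [apply Hb, Hu|]. rewrite S_INR. right. ring. }
    assert (X : forall u a b c d a' b' c' d' p q, s <= u <= e ->
      p = a * c + b * d -> q = a' * c' + b' * d' ->
      Rabs a <= omega -> Rabs b <= omega ->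
      Rabs (a - a') <= omega * eps -> Rabs (b - b') <= omega * eps ->
      Rabs c' <= exp_term omega s n u -> Rabs d' <= exp_term omega s n u ->
      Rabs (c - c') <= eps * INR n * exp_term omega s n u ->
      Rabs (d - d') <= eps * INR n * exp_term omega s n u ->
      Rabs (p - q) <=
         2 * omega * (eps * INR n * exp_term omega s n u)
         + 2 * (omega * eps) * exp_term omega s n u).
    { intros u a b c d a' b' c' d' p q Hu -> -> Ha Hb Haa Hbb Hc Hd Hcc Hdd.
      replace (a * c + b * d - (a' * c' + b' * d')) with
        ((a * (c - c') + b * (d - d')) + ((a - a') * c' + (b - b') * d')) by ring.
      eapply Rle_trans; [apply Rabs_triang|].
      apply Rplus_le_compat; apply Rabs_lin_le; assumption. }
    assert (N : forall a b, Rabs (- a - - b) = Rabs (a - b)).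
    { intros a b. rewrite <- Rabs_Ropp. f_equal. ring. }
    split; [|split; [|split]].
    + apply (H E0 F0 (fun t => - (x t * E1 t n + y t * E2 t n))
        (fun t => - (x' t * F1 t n + y' t * F2 t n))).
      * rewrite S0. reflexivity.
      * rewrite S0'. reflexivity.
      * intros u. apply D.
      * intros u. apply D'.
      * intros u Hu. destruct (IH u Hu) as (? & ? & ? & ?).
        destruct (dyson_bound n u Hu) as (? & ? & ? & ?).
        rewrite N. eapply X; [exact Hu|reflexivity|reflexivity| | | | | | | |]; auto.
    + apply (H E1 F1 (fun t => x t * E0 t n + y t * E3 t n)
        (fun t => x' t * F0 t n + y' t * F3 t n)).
      * rewrite S1. reflexivity.
      * rewrite S1'. reflexivity.
      * intros u. apply D.
      * intros u. apply D'.
      * intros u Hu. destruct (IH u Hu) as (? & ? & ? & ?).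
        destruct (dyson_bound n u Hu) as (? & ? & ? & ?).
        eapply X; [exact Hu|reflexivity|reflexivity| | | | | | | |]; auto.
    + apply (H E2 F2 (fun t => y t * E0 t n - x t * E3 t n)
        (fun t => y' t * F0 t n - x' t * F3 t n)).
      * rewrite S2. reflexivity.
      * rewrite S2'. reflexivity.
      * intros u. apply D.
      * intros u. apply D'.
      * intros u Hu. destruct (IH u Hu) as (? & ? & ? & ?).
        destruct (dyson_bound n u Hu) as (? & ? & ? & ?).
        apply (X u (y u) (- x u) (E0 u n) (E3 u n) (y' u) (- x' u) (F0 u n) (F3 u n));
          rewrite ?N, ?Rabs_Ropp; auto; ring.
    + apply (H E3 F3 (fun t => x t * E2 t n - y t * E1 t n)
        (fun t => x' t * F2 t n - y' t * F1 t n)).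
      * rewrite S3. reflexivity.
      * rewrite S3'. reflexivity.
      * intros u. apply D.
      * intros u. apply D'.
      * intros u Hu. destruct (IH u Hu) as (? & ? & ? & ?).
        destruct (dyson_bound n u Hu) as (? & ? & ? & ?).
        apply (X u (x u) (- y u) (E2 u n) (E1 u n) (x' u) (- y' u) (F2 u n) (F1 u n));
          rewrite ?N, ?Rabs_Ropp; auto; ring.
Qed.

(** The factor n of [dyson_compare] is absorbed by n <= 2^n, which doubles the exponent from 2 to
    4. *)
Lemma dyson_eval_compare z a b : 0 <= z <= 1 ->
  is_pseries (E0 e) z a -> is_pseries (F0 e) z b ->
  Rabs (a - b) <= eps * exp (4 * omega * (e - s)).
Proof.
  intros Hz Ha Hb. apply (is_pseries_R (E0 e) z a) in Ha. apply (is_pseries_R (F0 e) z b) in Hb.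
  assert (Hd : is_lim_seq (fun N => sum_f_R0 (fun n => E0 e n * z ^ n) N
      - sum_f_R0 (fun n => F0 e n * z ^ n) N) (a - b)).
  { apply is_lim_seq_minus'.
    - apply (is_lim_seq_ext (sum_n (fun n => E0 e n * z ^ n))); [|exact Ha].
      intros N. apply sum_n_Reals.
    - apply (is_lim_seq_ext (sum_n (fun n => F0 e n * z ^ n))); [|exact Hb].
      intros N. apply sum_n_Reals. }
  refine (is_lim_seq_le _ (fun _ => eps * exp (4 * omega * (e - s)))
    (Finite (Rabs (a - b))) (Finite (eps * exp (4 * omega * (e - s)))) _
    (is_lim_seq_abs _ _ Hd) (is_lim_seq_const _)).
  intros N. simpl. rewrite <- minus_sum.
  eapply Rle_trans; [apply Rsum_abs|].
  assert (Hx : 0 <= 4 * omega * (e - s)) by (apply Rmult_le_pos; lra).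
  eapply Rle_trans;
    [|apply Rmult_le_compat_l; [exact eps_pos|apply (exp_partial_le _ N Hx)]].
  rewrite scal_sum. apply sum_Rle. intros n _.
  rewrite <- Rmult_minus_distr_r, Rabs_mult.
  destruct (dyson_compare n e ltac:(lra)) as (H & _).
  assert (Hz1 : Rabs (z ^ n) <= 1).
  { rewrite Rabs_pos_eq by (apply pow_le; lra).
    rewrite <- (pow1 n). apply pow_incr. lra. }
  assert (Hn : INR n <= 2 ^ n).
  { clear. induction n as [|n IH]; [simpl; lra|]. rewrite S_INR. simpl.
    assert (1 <= 2 ^ n) by (apply pow_R1_Rle; lra). lra. }
  assert (Hp := exp_term_pos omega s n e omega_pos s_le_e).
  apply Rle_trans with (eps * INR n * exp_term omega s n e * 1).
  { apply Rmult_le_compat; try apply Rabs_pos; assumption. }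
  rewrite Rmult_1_r.
  replace ((4 * omega * (e - s)) ^ n / INR (fact n) * eps)
    with (eps * 2 ^ n * exp_term omega s n e).
  - apply Rmult_le_compat_r; [exact Hp|]. apply Rmult_le_compat_l; assumption.
  - unfold exp_term. replace (4 * omega * (e - s)) with (2 * (2 * omega * (e - s))) by ring.
    rewrite (Rpow_mult_distr 2). unfold Rdiv. ring.
Qed.

End Compare.

(** * Norm of the Magnus generator *)

Lemma lipschitz_1 (f f' : R -> R) u v : (forall t, is_derive f t (f' t)) ->
  (forall t, Rabs (f' t) <= 1) -> Rabs (f u - f v) <= Rabs (u - v).
Proof.
  intros Df Hf. destruct (MVT_gen f v u f') as (c & _ & ->).
  - intros; apply Df.
  - intros t _. apply continuity_pt_filterlim.
    apply (ex_derive_continuous (V := R_NormedModule)). eexists; apply Df.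
  - rewrite Rabs_mult. specialize (Hf c). pose proof (Rabs_pos (u - v)). nra.
Qed.

Lemma cos_lipschitz u v : Rabs (cos u - cos v) <= Rabs (u - v).
Proof.
  apply (lipschitz_1 cos (fun t => - sin t)).
  - apply is_derive_cos.
  - intros t. rewrite Rabs_Ropp. apply Rabs_le, SIN_bound.
Qed.

Lemma sin_lipschitz u v : Rabs (sin u - sin v) <= Rabs (u - v).
Proof.
  apply (lipschitz_1 sin cos).
  - apply is_derive_sin.
  - intros t. apply Rabs_le, COS_bound.
Qed.

Lemma is_series_C_fst (f : nat -> C) l :
  is_series (V := C_R_NormedModule) f l -> is_series (fun n => fst (f n)) (fst l).
Proof.
  intros H. unfold is_series.
  apply filterlim_ext with (f := fun N => fst (sum_n (G := C_R_NormedModule) f N)).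
  { induction x as [|N IH]; [rewrite !sum_O; reflexivity|].
    rewrite !sum_Sn, <- IH. reflexivity. }
  eapply filterlim_comp; [exact H|].
  apply (continuous_fst (U := R_UniformSpace) (V := R_UniformSpace)).
Qed.

Lemma is_series_C_snd (f : nat -> C) l :
  is_series (V := C_R_NormedModule) f l -> is_series (fun n => snd (f n)) (snd l).
Proof.
  intros H. unfold is_series.
  apply filterlim_ext with (f := fun N => snd (sum_n (G := C_R_NormedModule) f N)).
  { induction x as [|N IH]; [rewrite !sum_O; reflexivity|].
    rewrite !sum_Sn, <- IH. reflexivity. }
  eapply filterlim_comp; [exact H|].
  apply (continuous_snd (U := R_UniformSpace) (V := R_UniformSpace)).
Qed.

Lemma magnus_coeffs_series omega s phi e a b c :
  is_magnus_generator (pulse_rhs omega phi) s e (pauli_generator a b c) ->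
  let w := magnus_coeffs omega s phi e in
  is_series (pr1 w) a /\ is_series (pr2 w) b /\ is_series (pr3 w) c.
Proof.
  intros H w.
  pose proof (H 1%nat 0%nat ltac:(lia) ltac:(lia)) as H10.
  pose proof (H 0%nat 0%nat ltac:(lia) ltac:(lia)) as H00. clear H.
  assert (L := magnus_coeffs_low omega s phi e). fold w in L.
  assert (Z : forall pr, is_proj pr -> pr w 0%nat = 0)
    by (intros pr Hp; apply (triple_low_pr pr _ 1); auto).
  (* The Magnus series is summed from degree 1 on, whereas a series in z starts with a zero
     coefficient in degree 0. *)
  assert (Sh : forall (f : nat -> R) l, f 0%nat = 0 ->
    is_series (fun n => f (S n)) l -> is_series f l).
  { intros f l Hf Hs. apply is_series_decr_1.
    match goal with |- is_series _ ?x => replace x with l; [exact Hs|] end.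
    rewrite Hf. change (@eq R l (l + - 0)). symmetry.
    rewrite Ropp_0. apply Rplus_0_r. }
  rewrite pauli_generator_mat in H10, H00.
  split; [|split].
  - apply Sh; [apply Z; unfold is_proj; auto|].
    pose proof (is_series_opp _ _ (is_series_C_snd _ _ H10)) as E.
    match type of E with is_series _ ?l => replace l with a in E end.
    { exact E. }
    exact (eq_sym (Ropp_involutive a)).
  - apply Sh; [apply Z; unfold is_proj; auto|]. exact (is_series_C_fst _ _ H10).
  - apply Sh; [apply Z; unfold is_proj; auto|].
    pose proof (is_series_opp _ _ (is_series_C_snd _ _ H00)) as E.
    match type of E with is_series _ ?l => replace l with c in E end.
    { exact E. }
    exact (eq_sym (Ropp_involutive c)).
Qed.

Lemma cos_scaled_ge kappa z x : 0 < kappa < PI -> 0 <= z <= 1 ->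
  0 <= x <= kappa -> cos kappa <= cos (z * x).
Proof. intros Hk Hz Hx. apply cos_decr_1; nra. Qed.

(** Along the real ray z in [0,1) the unit quaternion exp (w z) solves the
    equation with amplitude z omega, hence never reaches -1, so |w z| cannot
    cross PI; Abel's theorem gives the bound at z = 1. *)
Lemma magnus_norm_le_PI omega s e phi theta eps kappa a b c :
  (forall t, continuous phi t) -> 0 <= omega -> s <= e -> 0 < kappa < PI ->
  omega * (e - s) <= kappa -> 0 <= eps -> eps * exp (4 * kappa) < 1 + cos kappa ->
  (forall t, s <= t <= e -> Rabs (phi t - theta) <= eps) ->
  is_magnus_generator (pulse_rhs omega phi) s e (pauli_generator a b c) ->
  a ^ 2 + b ^ 2 + c ^ 2 <= PI ^ 2.
Proof.
  intros Hphi Ho Hse Hk Hok Heps Hsmall Hclose HM.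
  set (w := magnus_coeffs omega s phi e).
  destruct (magnus_coeffs_series omega s phi e a b c HM) as (Sa & Sb & Sc).
  fold w in Sa, Sb, Sc. assert (HPI := PI_RGT_0).
  assert (Hl1 : forall r, 0 <= r < 1 -> exists P, forall pr, is_proj pr ->
    fps_l1_le r (pr w) P).
  { intros r Hr.
    destruct (series_l1 _ _ r Sa Hr) as (P1 & H1).
    destruct (series_l1 _ _ r Sb Hr) as (P2 & H2).
    destruct (series_l1 _ _ r Sc Hr) as (P3 & H3).
    exists (Rmax P1 (Rmax P2 P3)). intros pr [E|[E|E]] N; rewrite E.
    - eapply Rle_trans; [apply H1|apply Rmax_l].
    - eapply Rle_trans; [apply H2|]. eapply Rle_trans; [|apply Rmax_r]. apply Rmax_l.
    - eapply Rle_trans; [apply H3|]. eapply Rle_trans; [|apply Rmax_r]. apply Rmax_r. }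
  assert (Hlow := magnus_coeffs_low omega s phi e). fold w in Hlow.
  set (v := fun (pr : fps_triple -> fps) z => PSeries (pr w) z).
  set (rho := fun z => v pr1 z ^ 2 + v pr2 z ^ 2 + v pr3 z ^ 2).
  assert (Hv : forall z pr, is_proj pr -> 0 <= z < 1 -> is_pseries (pr w) z (v pr z)).
  { intros z pr Hp Hz. destruct (Hl1 ((z + 1) / 2) ltac:(lra)) as (P & HP).
    apply (l1_is_pseries ((z + 1) / 2) z _ P); [lra|auto]. }
  assert (P1 : is_proj pr1) by (unfold is_proj; auto).
  assert (P2 : is_proj pr2) by (unfold is_proj; auto).
  assert (P3 : is_proj pr3) by (unfold is_proj; auto).
  assert (Heval : forall z, 0 <= z < 1 ->
    is_pseries (triple_norm2 w) z (rho z) /\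
    (exists Q, fps_l1_le ((z + 1) / 2) (triple_norm2 w) Q) /\
    is_pseries (exp_scalar w) z (cos (sqrt (rho z)))).
  { intros z Hz. destruct (Hl1 ((z + 1) / 2) ltac:(lra)) as (P & HP).
    apply (exp_scalar_eval ((z + 1) / 2) z w P); auto; lra. }
  (* Comparison with the constant pulse [theta], whose scalar part cos (z omega (e - s)) is at least
     cos kappa; the deviation, at most eps exp (4 kappa), is smaller than 1 + cos kappa. *)
  assert (Hcos : forall z, 0 <= z < 1 -> -1 < cos (sqrt (rho z))).
  { intros z Hz. destruct (Heval z Hz) as (_ & _ & He).
    assert (Hl := line_eval (omega * cos theta) (omega * sin theta) s e omega z
      ltac:(lra) Ho Hse).
    assert (Hcs := sin2_cos2 theta). unfold Rsqr in Hcs.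
    specialize (Hl ltac:(nra)).
    pose proof (dyson_eval_compare _ _ _ _ s e omega eps _ _ _ _ _ _ _ _ Hse Ho Heps
      (magnus_dyson omega s phi Hphi)
      (line_dyson (omega * cos theta) (omega * sin theta) s)) as Hc.
    assert (B : forall u, Rabs u <= 1 -> Rabs (omega * u) <= omega).
    { intros u Hu. rewrite Rabs_mult, (Rabs_pos_eq omega) by exact Ho. nra. }
    specialize (Hc (fun t _ => B _ (Rabs_le _ _ (COS_bound _)))
      (fun t _ => B _ (Rabs_le _ _ (SIN_bound _)))
      (fun t _ => B _ (Rabs_le _ _ (COS_bound _)))
      (fun t _ => B _ (Rabs_le _ _ (SIN_bound _)))).
    assert (B' : forall u, Rabs u <= eps -> Rabs (omega * u) <= omega * eps).
    { intros u Hu. rewrite Rabs_mult, (Rabs_pos_eq omega) by exact Ho.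
      apply Rmult_le_compat_l; assumption. }
    assert (Hx : forall t, s <= t <= e ->
      Rabs (omega * cos (phi t) - omega * cos theta) <= omega * eps).
    { intros t Ht. rewrite <- Rmult_minus_distr_l. apply B'.
      eapply Rle_trans; [apply cos_lipschitz|apply Hclose, Ht]. }
    assert (Hy : forall t, s <= t <= e ->
      Rabs (omega * sin (phi t) - omega * sin theta) <= omega * eps).
    { intros t Ht. rewrite <- Rmult_minus_distr_l. apply B'.
      eapply Rle_trans; [apply sin_lipschitz|apply Hclose, Ht]. }
    specialize (Hc Hx Hy z (cos (sqrt (rho z))) (cos (z * (omega * (e - s))))
      ltac:(lra) He Hl).
    assert (H0 : 0 <= omega * (e - s)) by (apply Rmult_le_pos; lra).
    assert (Hg := cos_scaled_ge kappa z (omega * (e - s)) Hk ltac:(lra) ltac:(lra)).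
    assert (Hexp : exp (4 * omega * (e - s)) <= exp (4 * kappa)).
    { assert (4 * omega * (e - s) <= 4 * kappa) as [H|H] by lra.
      - left. apply exp_increasing, H.
      - rewrite H. lra. }
    apply (Rmult_le_compat_l eps _ _ Heps) in Hexp.
    apply Rabs_le_between in Hc. lra. }
  assert (Hlt : forall z, 0 <= z < 1 -> rho z < PI ^ 2).
  { intros z1 Hz1.
    assert (Hno : forall z, 0 <= z < 1 -> rho z <> PI ^ 2).
    { intros z Hz E. specialize (Hcos z Hz). rewrite E, sqrt_pow2, cos_PI in Hcos by lra.
      lra. }
    destruct (Rlt_le_dec (rho z1) (PI ^ 2)) as [H|H]; [exact H|exfalso].
    assert (H' : PI ^ 2 < rho z1).
    { destruct H as [H|H]; [exact H|]. symmetry in H. exfalso. exact (Hno z1 Hz1 H). }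
    assert (E : forall z, 0 <= z < 1 -> PSeries (triple_norm2 w) z = rho z).
    { intros z Hz. apply is_pseries_unique, (Heval z Hz). }
    assert (E0 : rho 0 = 0).
    { rewrite <- E by lra. rewrite PSeries_0. apply triple_norm2_0, Hlow. }
    assert (Hz0 : 0 < z1).
    { destruct (Rle_lt_or_eq_dec 0 z1 ltac:(lra)) as [Hz|Hz]; [exact Hz|].
      rewrite <- Hz, E0 in H'. nra. }
    assert (Cont : forall z, 0 <= z < 1 -> continuity_pt (PSeries (triple_norm2 w)) z).
    { intros z Hz. destruct (Heval z Hz) as (_ & (Q & HQ) & _).
      apply PSeries_continuity, (l1_radius ((z + 1) / 2) z _ Q); [lra|exact HQ]. }
    (* The intermediate value theorem is applied to the power series of |w|^2, which equals [rho] on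
       [0,1) and is continuous inside its disc; it starts at 0 for z = 0. *)
    destruct (IVT_Rbar_incr (PSeries (triple_norm2 w)) 0 z1 0 (rho z1) (PI ^ 2))
      as (z & Hza & Hzb & Hz).
    - rewrite <- E0 at 2. rewrite <- E by lra. apply is_lim_continuity, Cont. lra.
    - rewrite <- E by lra. apply is_lim_continuity, Cont. lra.
    - intros z Hza Hzb. simpl in Hza, Hzb. apply Cont. lra.
    - exact Hz0.
    - simpl. split; [nra|exact H'].
    - simpl in Hza, Hzb. rewrite E in Hz by lra. apply (Hno z); [lra|exact Hz]. }
  (* Each of the three squares moves by at most 2 PI d + d^2 <= (2 PI + 1) d when its coordinate
     moves by d, hence 6 PI + 3. *)
  assert (Hfin : forall d, 0 < d <= 1 ->
    a ^ 2 + b ^ 2 + c ^ 2 <= PI ^ 2 + (6 * PI + 3) * d).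
  { intros d Hd.
    destruct (abel_limit _ _ Sa d ltac:(lra)) as (z1 & Hz1 & A1).
    destruct (abel_limit _ _ Sb d ltac:(lra)) as (z2 & Hz2 & A2).
    destruct (abel_limit _ _ Sc d ltac:(lra)) as (z3 & Hz3 & A3).
    set (m := Rmax 0 (Rmax z1 (Rmax z2 z3))).
    assert (Hm : m < 1) by (unfold m; repeat apply Rmax_lub_lt; lra).
    assert (M0 : 0 <= m) by apply Rmax_l.
    assert (M1 : z1 <= m) by (unfold m; eapply Rle_trans; [apply Rmax_l|apply Rmax_r]).
    assert (M2 : z2 <= m).
    { unfold m. eapply Rle_trans; [|apply Rmax_r]. eapply Rle_trans; [|apply Rmax_r].
      apply Rmax_l. }
    assert (M3 : z3 <= m).
    { unfold m. eapply Rle_trans; [|apply Rmax_r]. eapply Rle_trans; [|apply Rmax_r].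
      apply Rmax_r. }
    set (z := (m + 1) / 2). assert (Hz : 0 <= z < 1) by (unfold z; lra).
    assert (Hzm : m < z) by (unfold z; lra).
    specialize (A1 z (v pr1 z) Hz ltac:(lra) (Hv z pr1 P1 Hz)).
    specialize (A2 z (v pr2 z) Hz ltac:(lra) (Hv z pr2 P2 Hz)).
    specialize (A3 z (v pr3 z) Hz ltac:(lra) (Hv z pr3 P3 Hz)).
    specialize (Hlt z Hz). unfold rho in Hlt.
    assert (Q : forall p q, Rabs (q - p) <= d -> q ^ 2 <= PI ^ 2 ->
      p ^ 2 <= q ^ 2 + (2 * PI + 1) * d).
    { intros p q Hpq Hq.
      assert (Hq' : Rabs q <= PI).
      { rewrite <- (Rabs_pos_eq PI) by lra. apply Rsqr_le_abs_0. unfold Rsqr. nra. }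
      apply Rabs_le_between in Hpq. apply Rabs_le_between in Hq'. nra. }
    pose proof (Q a (v pr1 z) A1 ltac:(nra)).
    pose proof (Q b (v pr2 z) A2 ltac:(nra)).
    pose proof (Q c (v pr3 z) A3 ltac:(nra)). lra. }
  apply le_epsilon. intros d Hd.
  set (d' := Rmin 1 (d / (6 * PI + 3))).
  assert (Hd' : 0 < d' <= 1).
  { unfold d'. split; [|apply Rmin_l]. apply Rmin_pos; [lra|].
    apply Rdiv_lt_0_compat; lra. }
  specialize (Hfin d' Hd').
  assert ((6 * PI + 3) * d' <= d); [|lra].
  apply Rle_trans with ((6 * PI + 3) * (d / (6 * PI + 3))).
  - apply Rmult_le_compat_l; [lra|apply Rmin_r].
  - right. field. lra.
Qed.

(** * Matrix exponential of a Pauli generator *)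

(** In each real or imaginary part of an entry of the exponential one member of every pair vanishes,
    so grouping isolates the cosine or the sine series. *)
Lemma is_series_pairs (f g : nat -> R) (l : R) : is_series f l ->
  (forall k, f (2 * k)%nat + f (2 * k + 1)%nat = g k) -> is_series g l.
Proof.
  intros Hf Hg. apply is_series_Reals. apply is_series_Reals in Hf.
  intros e He. destruct (Hf e He) as [N HN]. exists N. intros n Hn.
  rewrite <- (sum_eq (fun k => f (2 * k)%nat + f (2 * k + 1)%nat)) by auto.
  rewrite <- sum_f_R0_even_odd. apply HN. lia.
Qed.

(** The generator squares to -(a^2 + b^2 + c^2) times the identity. *)
Lemma pauli_pow a b c k :
  let p := (- (a ^ 2 + b ^ 2 + c ^ 2)) ^ k in
  pow_n (pauli_generator a b c) (2 * k)
    = mat2_of (RtoC p) (RtoC 0) (RtoC 0) (RtoC p) /\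
  pow_n (pauli_generator a b c) (2 * k + 1) = pauli_generator (p * a) (p * b) (p * c).
Proof.
  assert (Hodd : forall p, mult (pauli_generator a b c)
      (mat2_of (RtoC p) (RtoC 0) (RtoC 0) (RtoC p))
    = pauli_generator (p * a) (p * b) (p * c)).
  { intros p. rewrite !pauli_generator_mat, mat2_of_mult. mat2_eq. }
  induction k as [|k [IH1 IH2]]; intros p.
  - split; [reflexivity|]. simpl (2 * 0 + 1)%nat.
    change (pow_n ?A 1) with (mult A (one : mat2)). rewrite mat2_of_one. apply Hodd.
  - assert (He : pow_n (pauli_generator a b c) (2 * S k)
      = mat2_of (RtoC p) (RtoC 0) (RtoC 0) (RtoC p)).
    { replace (2 * S k)%nat with (S (2 * k + 1)) by lia.
      change (pow_n ?A (S ?n)) with (mult A (pow_n A n)). rewrite IH2.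
      rewrite !pauli_generator_mat, mat2_of_mult. unfold p. mat2_eq. }
    split; [exact He|].
    replace (2 * S k + 1)%nat with (S (2 * S k)) by lia.
    change (pow_n ?A (S ?n)) with (mult A (pow_n A n)). rewrite He. apply Hodd.
Qed.

(** [m] is the value of the power series of sin r / r; the two clauses describe it at r = 0 as well,
    where a quotient would fail. The first column determines the quaternion. *)
Lemma pauli_exp_entries a b c E :
  is_mat_exp (pauli_generator a b c) E ->
  let r := sqrt (a ^ 2 + b ^ 2 + c ^ 2) in
  exists m, sin r = r * m /\ (r = 0 -> m = 1) /\
    entry E 0 0 = (cos r, - (m * c)) /\ entry E 1 0 = (m * b, - (m * a)).
Proof.
  intros H r.
  pose proof (H 0%nat 0%nat ltac:(lia) ltac:(lia)) as H00.
  pose proof (H 1%nat 0%nat ltac:(lia) ltac:(lia)) as H10. clear H.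
  destruct (is_pseries_sin r) as (m & Hm & Hs). exists m.
  assert (Hr : r ^ 2 = a ^ 2 + b ^ 2 + c ^ 2) by (apply pow2_sqrt; nra).
  assert (Hc := is_pseries_cos r).
  apply is_pseries_R in Hm. apply is_pseries_R in Hc.
  split; [exact Hs|]. split.
  { intros E0. rewrite E0 in Hm. pose proof (is_series_unique _ _ Hm) as U.
    rewrite <- U. apply is_series_unique, is_series_Reals.
    intros e He. exists 0%nat. intros n _.
    rewrite (sum_f_R0_extend _ 0 n); [|lia|].
    - unfold R_dist, sin_n. simpl.
      replace (1 / 1 * 1 - 1) with 0 by field. rewrite Rabs_R0. exact He.
    - intros [|k] Hk; [lia|]. simpl. ring. }
  set (p := fun k => (- (a ^ 2 + b ^ 2 + c ^ 2)) ^ k).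
  assert (Hp : forall k, p k = (-1) ^ k * (r ^ 2) ^ k).
  { intros k. unfold p. rewrite <- Rpow_mult_distr, Hr. f_equal. ring. }
  assert (Heven : forall i j k, (i < 2)%nat -> (j < 2)%nat ->
    entry (mscal (RtoC (/ INR (fact (2 * k)))) (pow_n (pauli_generator a b c) (2 * k))) i j
    = entry (mat2_of (RtoC (/ INR (fact (2 * k)) * p k)) (RtoC 0) (RtoC 0)
               (RtoC (/ INR (fact (2 * k)) * p k))) i j).
  { intros i j k _ _. destruct (pauli_pow a b c k) as [-> _].
    rewrite mat2_of_mscal. f_equal. unfold p. mat2_eq. }
  assert (Hodd : forall i j k, (i < 2)%nat -> (j < 2)%nat ->
    entry (mscal (RtoC (/ INR (fact (2 * k + 1))))
             (pow_n (pauli_generator a b c) (2 * k + 1))) i j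
    = entry (let q := / INR (fact (2 * k + 1)) * p k in
             pauli_generator (q * a) (q * b) (q * c)) i j).
  { intros i j k _ _. destruct (pauli_pow a b c k) as [_ ->].
    rewrite pauli_mscal. f_equal. unfold p. cbv zeta. f_equal; ring. }
  assert (HC : is_series (fun k => / INR (fact (2 * k)) * p k) (cos r)).
  { eapply is_series_ext; [|exact Hc]. intros k. rewrite Hp. unfold cos_n, Rdiv.
    match goal with |- ?u = ?v => change (@eq R u v) end. ring. }
  assert (HS : forall x, is_series (fun k => / INR (fact (2 * k + 1)) * p k * x) (m * x)).
  { intros x. apply is_series_ext with
      (a := fun k => scal x (sin_n k * (r ^ 2) ^ k)).
    - intros k. rewrite Hp. unfold sin_n, Rdiv, scal; simpl. unfold mult; simpl.
      match goal with |- ?u = ?v => change (@eq R u v) end. ring.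
    - replace (m * x) with (scal x m) by apply Rmult_comm.
      apply (is_series_scal x _ _ Hm). }
  assert (HSn : forall x, is_series (fun k => - (/ INR (fact (2 * k + 1)) * p k * x)) (- (m * x)))
    by (intros x; apply (is_series_opp _ _ (HS x))).
  assert (U : forall (f g : nat -> R) (l l' : R), is_series f l -> is_series g l' ->
     (forall k, f (2 * k)%nat + f (2 * k + 1)%nat = g k) -> l = l').
  { intros f g l l' Hf Hg E0. pose proof (is_series_pairs f g l Hf E0) as Hf'.
    rewrite <- (is_series_unique _ _ Hf'). apply is_series_unique, Hg. }
  split; apply injective_projections.
  - eapply U; [apply (is_series_C_fst _ _ H00)|exact HC|].
    intros k. cbv beta. rewrite Heven, Hodd, pauli_generator_mat by lia. simpl. ring.
  - eapply U; [apply (is_series_C_snd _ _ H00)|apply HSn|].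
    intros k. cbv beta. rewrite Heven, Hodd, pauli_generator_mat by lia. cbv zeta. simpl. ring.
  - eapply U; [apply (is_series_C_fst _ _ H10)|apply HS|].
    intros k. cbv beta. rewrite Heven, Hodd, pauli_generator_mat by lia. cbv zeta. simpl. ring.
  - eapply U; [apply (is_series_C_snd _ _ H10)|apply HSn|].
    intros k. cbv beta. rewrite Heven, Hodd, pauli_generator_mat by lia. cbv zeta. simpl. ring.
Qed.

(** * The propagator in the rotated frame *)

Lemma increment_bound (f f' : R -> R) s e K :
  (forall t, s < t < e -> is_derive f t (f' t)) ->
  (forall t, s <= t <= e -> continuous f t) ->
  (forall t, s < t < e -> Rabs (f' t) <= K) ->
  forall u v, s <= u <= e -> s <= v <= e -> Rabs (f u - f v) <= K * Rabs (u - v).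
Proof.
  intros Df Cf Hf.
  assert (W : forall u v, s <= u <= e -> s <= v <= e -> u <= v ->
    Rabs (f v - f u) <= K * (v - u)).
  { intros u v Hu Hv Huv. rewrite Rmult_minus_distr_l.
    apply (increment_le f (fun t => K * t) f' (fun _ => K)).
    - intros t Ht. apply Df. lra.
    - intros t Ht. auto_derive; [exact I|ring].
    - intros t Ht. apply Cf. lra.
    - intros t Ht. apply (continuous_scal_r (V := R_NormedModule) K (fun t => t)).
      apply continuous_id.
    - intros t Ht. apply Hf. lra.
    - exact Huv. }
  intros u v Hu Hv. destruct (Rle_lt_dec u v) as [H|H].
  - rewrite Rabs_minus_sym, (Rabs_minus_sym u), (Rabs_pos_eq (v - u)) by lra. auto.
  - rewrite (Rabs_pos_eq (u - v)) by lra. apply W; lra.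
Qed.

Lemma sin_minus_id x : Rabs (sin x - x) <= x ^ 2.
Proof.
  pose proof (increment_bound (fun t => sin t - t) (fun t => cos t - 1)
    (- Rabs x) (Rabs x) (Rabs x)) as H.
  replace (sin x - x) with ((sin x - x) - (sin 0 - 0)) by (rewrite sin_0; ring).
  replace (x ^ 2) with (Rabs x * Rabs (x - 0)).
  2:{ rewrite Rminus_0_r, <- Rabs_mult, Rabs_pos_eq; nra. }
  assert (Hx := Rabs_pos x).
  apply H; [| | | |lra].
  - intros t _. auto_derive; [exact I|ring].
  - intros t _. apply (ex_derive_continuous (V := R_NormedModule)).
    auto_derive. exact I.
  - intros t Ht. rewrite <- cos_0. eapply Rle_trans; [apply cos_lipschitz|].
    rewrite Rminus_0_r. apply Rabs_le. lra.
  - split; [|apply Rle_abs]. pose proof (Rle_abs (- x)) as Hn.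
    rewrite Rabs_Ropp in Hn. lra.
Qed.

Lemma one_minus_cos x : 0 <= 1 - cos x <= x ^ 2 / 2.
Proof.
  replace x with (2 * (x / 2)) at 1 2 by field. rewrite cos_2a_sin.
  pose proof (sin_lipschitz (x / 2) 0) as H. rewrite sin_0, !Rminus_0_r in H.
  apply Rsqr_le_abs_1 in H. unfold Rsqr in H. nra.
Qed.

Section RotatedFrame.

Variables (omega s e eps N2 slope : R) (psi Q0 Q1 Q2 Q3 : R -> R).
Let tau := e - s.
Let mid := (s + e) / 2.
Hypothesis omega_pos : 0 < omega.
Hypothesis s_lt_e : s < e.
Hypothesis Q0_s : Q0 s = 1.
Hypothesis Q1_s : Q1 s = 0.
Hypothesis Q2_s : Q2 s = 0.
Hypothesis Q3_s : Q3 s = 0.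
Hypothesis Q0_cont : forall t, continuous Q0 t.
Hypothesis Q1_cont : forall t, continuous Q1 t.
Hypothesis Q2_cont : forall t, continuous Q2 t.
Hypothesis Q3_cont : forall t, continuous Q3 t.
Hypothesis Q0_derive : forall t, s < t < e ->
  is_derive Q0 t (- omega * (cos (psi t) * Q1 t + sin (psi t) * Q2 t)).
Hypothesis Q1_derive : forall t, s < t < e ->
  is_derive Q1 t (omega * (cos (psi t) * Q0 t + sin (psi t) * Q3 t)).
Hypothesis Q2_derive : forall t, s < t < e ->
  is_derive Q2 t (omega * (sin (psi t) * Q0 t - cos (psi t) * Q3 t)).
Hypothesis Q3_derive : forall t, s < t < e ->
  is_derive Q3 t (omega * (cos (psi t) * Q2 t - sin (psi t) * Q1 t)).
Hypothesis psi_small : forall t, s <= t <= e -> Rabs (psi t) <= eps.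
Hypothesis psi_linear : forall t, s <= t <= e ->
  Rabs (psi t - slope * (t - mid)) <= N2.

(** The linear system is skew-symmetric, so the sum of the four squares stays at its initial value
    1. *)
Lemma rotated_unit t : s <= t <= e ->
  Rabs (Q0 t) <= 1 /\ Rabs (Q1 t) <= 1 /\ Rabs (Q2 t) <= 1 /\ Rabs (Q3 t) <= 1.
Proof.
  intros Ht.
  pose proof (increment_bound
    (fun t => Q0 t * Q0 t + Q1 t * Q1 t + Q2 t * Q2 t + Q3 t * Q3 t)
    (fun _ => 0) s e 0) as H.
  assert (Hsum : Q0 t * Q0 t + Q1 t * Q1 t + Q2 t * Q2 t + Q3 t * Q3 t = 1).
  { specialize (fun H1 H2 H3 => H H1 H2 H3 t s Ht ltac:(lra)).
    cbv beta in H. rewrite Q0_s, Q1_s, Q2_s, Q3_s in H.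
    assert (H0 : Rabs (Q0 t * Q0 t + Q1 t * Q1 t + Q2 t * Q2 t + Q3 t * Q3 t
      - (1 * 1 + 0 * 0 + 0 * 0 + 0 * 0)) <= 0 * Rabs (t - s)).
    { apply H.
      - intros u Hu.
        pose proof (Q0_derive u Hu) as D0. pose proof (Q1_derive u Hu) as D1.
        pose proof (Q2_derive u Hu) as D2. pose proof (Q3_derive u Hu) as D3.
        auto_derive.
        + repeat split; eexists; eassumption.
        + rewrite (is_derive_unique (fun v : R => Q0 v) u _ D0), (is_derive_unique (fun v : R => Q1 v) u _ D1),
            (is_derive_unique (fun v : R => Q2 v) u _ D2), (is_derive_unique (fun v : R => Q3 v) u _ D3). ring.
      - intros u _.
        assert (Hsq : forall Q : R -> R, continuous Q u -> continuous (fun v => Q v * Q v) u)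
          by (intros Q HQ; apply (continuous_mult (K := R_AbsRing)); exact HQ).
        apply (continuous_plus (V := R_NormedModule)
          (fun v => Q0 v * Q0 v + Q1 v * Q1 v + Q2 v * Q2 v) (fun v => Q3 v * Q3 v)); auto.
        apply (continuous_plus (V := R_NormedModule)
          (fun v => Q0 v * Q0 v + Q1 v * Q1 v) (fun v => Q2 v * Q2 v)); auto.
        apply (continuous_plus (V := R_NormedModule)
          (fun v => Q0 v * Q0 v) (fun v => Q1 v * Q1 v)); auto.
      - intros u _. rewrite Rabs_R0. lra. }
    pose proof (Rabs_pos (Q0 t * Q0 t + Q1 t * Q1 t + Q2 t * Q2 t + Q3 t * Q3 t
      - (1 * 1 + 0 * 0 + 0 * 0 + 0 * 0))).
    assert (E : Q0 t * Q0 t + Q1 t * Q1 t + Q2 t * Q2 t + Q3 t * Q3 t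
      - (1 * 1 + 0 * 0 + 0 * 0 + 0 * 0) = 0) by (apply Rabs_eq_0; lra).
    lra. }
  repeat split; apply Rabs_le; nra.
Qed.

Lemma Rabs_mul_le a b A B : Rabs a <= A -> Rabs b <= B -> Rabs (a * b) <= A * B.
Proof.
  intros Ha Hb. rewrite Rabs_mult. apply Rmult_le_compat; auto using Rabs_pos.
Qed.

Lemma trig_combination_le x a b A B : Rabs a <= A -> Rabs b <= B ->
  Rabs (a * cos x + b * sin x) <= A + B.
Proof.
  intros Ha Hb. eapply Rle_trans; [apply Rabs_triang|].
  pose proof (Rabs_mul_le a (cos x) A 1 Ha (Rabs_le _ _ (COS_bound x))).
  pose proof (Rabs_mul_le b (sin x) B 1 Hb (Rabs_le _ _ (SIN_bound x))). lra.
Qed.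

Lemma psi_bounds t : s <= t <= e ->
  Rabs (sin (psi t)) <= eps /\ Rabs (cos (psi t) - 1) <= eps /\
  Rabs (sin (psi t) - psi t) <= eps ^ 2 /\ Rabs (1 - cos (psi t)) <= eps ^ 2 / 2.
Proof.
  intros Ht. specialize (psi_small t Ht).
  pose proof (sin_lipschitz (psi t) 0) as H1. rewrite sin_0, !Rminus_0_r in H1.
  pose proof (cos_lipschitz (psi t) 0) as H2. rewrite cos_0, Rminus_0_r in H2.
  pose proof (sin_minus_id (psi t)) as H3.
  pose proof (one_minus_cos (psi t)) as H4.
  assert (H5 : psi t ^ 2 <= eps ^ 2).
  { apply Rabs_le_between in psi_small. nra. }
  split; [lra|split; [lra|split; [lra|]]].
  rewrite Rabs_pos_eq; lra.
Qed.

(** Variation of constants: for psi = 0 the solution is (cos, sin, 0, 0) of omega (t - s). Rotating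
    (Q0, Q1) onward by omega (x - t) gives a quantity that psi alone makes move, at speed at most 4
    omega eps. *)
Lemma rotated_first_order x : s <= x <= e ->
  Rabs (Q1 x - sin (omega * (x - s))) <= 4 * omega * tau * eps /\
  Rabs (Q0 x - cos (omega * (x - s))) <= 4 * omega * tau * eps.
Proof.
  intros Hx.
  assert (Heps : 0 <= eps).
  { eapply Rle_trans; [apply Rabs_pos|apply (psi_small s); lra]. }
  assert (HK : 4 * omega * eps * Rabs (x - s) <= 4 * omega * tau * eps).
  { rewrite Rabs_pos_eq by lra. unfold tau.
    apply Rle_trans with (4 * omega * eps * (e - s)); [|lra].
    apply Rmult_le_compat_l; [|lra].
    apply Rmult_le_pos; lra. }
  assert (Hb : forall t, s < t < x ->
    Rabs (omega * ((cos (psi t) - 1) * Q0 t + sin (psi t) * Q3 t)) <= 2 * omega * eps /\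
    Rabs (omega * ((1 - cos (psi t)) * Q1 t + - sin (psi t) * Q2 t)) <= 2 * omega * eps).
  { intros t Ht. destruct (psi_bounds t ltac:(lra)) as (B1 & B2 & _).
    destruct (rotated_unit t ltac:(lra)) as (U0 & U1 & U2 & U3).
    rewrite !Rabs_mult, (Rabs_pos_eq omega) by lra.
    split.
    - pose proof (Rabs_lin_le _ _ _ _ _ _ B2 B1 U0 U3). nra.
    - rewrite Rabs_minus_sym in B2. rewrite <- Rabs_Ropp in B1.
      pose proof (Rabs_lin_le _ _ _ _ _ _ B2 B1 U1 U2). nra. }
  split.
  - pose proof (increment_bound
      (fun t => Q1 t * cos (omega * (x - t)) + Q0 t * sin (omega * (x - t)))
      (fun t => (omega * ((cos (psi t) - 1) * Q0 t + sin (psi t) * Q3 t)) * cos (omega * (x - t))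
              + (omega * ((1 - cos (psi t)) * Q1 t + - sin (psi t) * Q2 t)) * sin (omega * (x - t)))
      s x (4 * omega * eps)) as H.
    specialize (fun H1 H2 H3 => H H1 H2 H3 x s ltac:(lra) ltac:(lra)).
    cbv beta in H. rewrite Q0_s, Q1_s, Rminus_eq_0, Rmult_0_r, cos_0, sin_0 in H.
    replace (Q1 x - sin (omega * (x - s))) with
      (Q1 x * 1 + Q0 x * 0 - (0 * cos (omega * (x - s)) + 1 * sin (omega * (x - s)))) by ring.
    eapply Rle_trans; [apply H|exact HK].
    + intros t Ht. pose proof (Q0_derive t ltac:(lra)) as D0.
      pose proof (Q1_derive t ltac:(lra)) as D1. auto_derive.
      * repeat split; eexists; eassumption.
      * rewrite (is_derive_unique (fun v : R => Q0 v) t _ D0), (is_derive_unique (fun v : R => Q1 v) t _ D1).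
        unfold Rminus. ring.
    + intros t _. apply (continuous_plus (V := R_NormedModule));
        apply (continuous_mult (K := R_AbsRing)); auto;
        apply (ex_derive_continuous (V := R_NormedModule)); auto_derive; exact I.
    + intros t Ht. destruct (Hb t Ht) as [B1 B2].
      pose proof (trig_combination_le (omega * (x - t)) _ _ _ _ B1 B2). lra.
  - pose proof (increment_bound
      (fun t => Q0 t * cos (omega * (x - t)) + - Q1 t * sin (omega * (x - t)))
      (fun t => (omega * ((1 - cos (psi t)) * Q1 t + - sin (psi t) * Q2 t)) * cos (omega * (x - t))
              + - (omega * ((cos (psi t) - 1) * Q0 t + sin (psi t) * Q3 t)) * sin (omega * (x - t)))
      s x (4 * omega * eps)) as H.
    specialize (fun H1 H2 H3 => H H1 H2 H3 x s ltac:(lra) ltac:(lra)).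
    cbv beta in H. rewrite Q0_s, Q1_s, Rminus_eq_0, Rmult_0_r, cos_0, sin_0 in H.
    replace (Q0 x - cos (omega * (x - s))) with
      (Q0 x * 1 + - Q1 x * 0 - (1 * cos (omega * (x - s)) + - 0 * sin (omega * (x - s)))) by ring.
    eapply Rle_trans; [apply H|exact HK].
    + intros t Ht. pose proof (Q0_derive t ltac:(lra)) as D0.
      pose proof (Q1_derive t ltac:(lra)) as D1. auto_derive.
      * repeat split; eexists; eassumption.
      * rewrite (is_derive_unique (fun v : R => Q0 v) t _ D0), (is_derive_unique (fun v : R => Q1 v) t _ D1).
        unfold Rminus. ring.
    + intros t _. apply (continuous_plus (V := R_NormedModule));
        apply (continuous_mult (K := R_AbsRing)); auto.
      * apply (ex_derive_continuous (V := R_NormedModule)); auto_derive; exact I.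
      * apply (continuous_opp (V := R_NormedModule)); auto.
      * apply (ex_derive_continuous (V := R_NormedModule)); auto_derive; exact I.
    + intros t Ht. destruct (Hb t Ht) as [B1 B2]. rewrite <- Rabs_Ropp in B1.
      pose proof (trig_combination_le (omega * (x - t)) _ _ _ _ B2 B1). lra.
Qed.

(** In the interaction picture the first-order contribution to Q2 is
    omega int psi(t) cos(2 omega (t - mid)) dt, whose kernel is even about the
    midpoint, so the linear part of psi drops out. *)
Lemma rotated_second_order :
  Rabs (Q2 e) <= omega * tau * (8 * (omega * tau) * eps ^ 2 + 2 * eps ^ 2 + N2).
Proof.
  assert (Heps : 0 <= eps).
  { eapply Rle_trans; [apply Rabs_pos|apply (psi_small s); lra]. }
  (* A primitive of (t - mid) cos (2 omega (t - mid)). It is even about the midpoint, so its values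
     at both ends agree and the slope contributes nothing. *)
  set (F := fun t => (t - mid) * sin (2 * omega * (t - mid)) / (2 * omega)
              + cos (2 * omega * (t - mid)) / (4 * omega ^ 2)).
  assert (DF : forall t, is_derive F t ((t - mid) * cos (2 * omega * (t - mid)))).
  { intros t. unfold F. auto_derive; [nra|]. unfold Rminus. field. lra. }
  assert (EF : F e = F s).
  { assert (Ey : s - mid = - (e - mid)) by (unfold mid; field).
    unfold F. rewrite Ey.
    replace (2 * omega * - (e - mid)) with (- (2 * omega * (e - mid))) by ring.
    rewrite sin_neg, cos_neg. field. lra. }
  pose proof (increment_bound
    (fun t => Q2 t * cos (omega * (e - t)) + - Q3 t * sin (omega * (e - t))
              - omega * slope * F t)
    (fun t => omega * (sin (psi t) * (Q0 t * cos (omega * (e - t)) + Q1 t * sin (omega * (e - t)))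
        + (1 - cos (psi t)) * (Q3 t * cos (omega * (e - t)) + Q2 t * sin (omega * (e - t)))
        - slope * ((t - mid) * cos (2 * omega * (t - mid)))))
    s e (omega * (8 * (omega * tau) * eps ^ 2 + 2 * eps ^ 2 + N2))) as H.
  specialize (fun H1 H2 H3 => H H1 H2 H3 e s ltac:(lra) ltac:(lra)).
  cbv beta in H.
  rewrite Q2_s, Q3_s, EF, Rminus_eq_0, Rmult_0_r, cos_0, sin_0 in H.
  rewrite (Rabs_pos_eq (e - s)) in H by lra. fold tau in H.
  replace (Q2 e) with (Q2 e * 1 + - Q3 e * 0 - omega * slope * F s
    - (0 * cos (omega * tau) + - 0 * sin (omega * tau) - omega * slope * F s)) by ring.
  eapply Rle_trans; [apply H|right; ring].
  - intros t Ht. pose proof (Q2_derive t Ht) as D2. pose proof (Q3_derive t Ht) as D3.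
    pose proof (DF t) as D.
    auto_derive.
    + repeat split; eexists; eassumption.
    + rewrite (is_derive_unique (fun v : R => Q2 v) t _ D2), (is_derive_unique (fun v : R => Q3 v) t _ D3),
        (is_derive_unique (fun v : R => F v) t _ D). unfold Rminus. ring.
  - intros t _. apply (continuous_minus (V := R_NormedModule)).
    + apply (continuous_plus (V := R_NormedModule));
        apply (continuous_mult (K := R_AbsRing)); auto.
      * apply (ex_derive_continuous (V := R_NormedModule)); auto_derive; exact I.
      * apply (continuous_opp (V := R_NormedModule)); auto.
      * apply (ex_derive_continuous (V := R_NormedModule)); auto_derive; exact I.
    + apply (continuous_scal_r (V := R_NormedModule) (omega * slope) F).
      apply (ex_derive_continuous (V := R_NormedModule)). eexists; apply DF.
  - intros t Ht. assert (Ht' : s <= t <= e) by lra.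
    destruct (psi_bounds t Ht') as (B1 & _ & B3 & B4).
    destruct (rotated_unit t Ht') as (U0 & U1 & U2 & U3).
    destruct (rotated_first_order t Ht') as [A1 A0].
    specialize (psi_linear t Ht').
    (* With Q0 and Q1 at zeroth order the coefficient of sin psi is cos of the difference of omega
       (t - s) and omega (e - t): the even kernel. *)
    assert (Ek : cos (2 * omega * (t - mid))
      = cos (omega * (t - s)) * cos (omega * (e - t))
        + sin (omega * (t - s)) * sin (omega * (e - t))).
    { rewrite <- cos_minus. f_equal. unfold mid. field. }
    rewrite Rabs_mult, (Rabs_pos_eq omega) by lra.
    apply Rmult_le_compat_l; [lra|].
    (* Three errors: zeroth order for Q0 and Q1 costs 8 omega tau eps^2, the coupling through 1 -
       cos psi costs eps^2, and replacing sin psi by the linear part costs eps^2 + N2. *)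
    replace (sin (psi t) * (Q0 t * cos (omega * (e - t)) + Q1 t * sin (omega * (e - t)))
        + (1 - cos (psi t)) * (Q3 t * cos (omega * (e - t)) + Q2 t * sin (omega * (e - t)))
        - slope * ((t - mid) * cos (2 * omega * (t - mid))))
      with (sin (psi t) * ((Q0 t - cos (omega * (t - s))) * cos (omega * (e - t))
                 + (Q1 t - sin (omega * (t - s))) * sin (omega * (e - t)))
        + (1 - cos (psi t)) * (Q3 t * cos (omega * (e - t)) + Q2 t * sin (omega * (e - t)))
        + ((sin (psi t) - psi t) + (psi t - slope * (t - mid))) * cos (2 * omega * (t - mid)))
      by (rewrite Ek; ring).
    pose proof (Rabs_mul_le _ _ _ _ B1 (trig_combination_le (omega * (e - t)) _ _ _ _ A0 A1)) as T1.
    pose proof (Rabs_mul_le _ _ _ _ B4 (trig_combination_le (omega * (e - t)) _ _ _ _ U3 U2)) as T2.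
    assert (T3 : Rabs ((sin (psi t) - psi t) + (psi t - slope * (t - mid))) <= eps ^ 2 + N2).
    { eapply Rle_trans; [apply Rabs_triang|]. lra. }
    pose proof (Rabs_mul_le _ _ _ 1 T3
      (Rabs_le _ _ (COS_bound (2 * omega * (t - mid))))) as T4.
    eapply Rle_trans; [apply Rabs_triang|].
    eapply Rle_trans; [apply Rplus_le_compat_r, Rabs_triang|]. lra.
Qed.

End RotatedFrame.

(** * One-sided derivatives and clamping *)

Lemma is_derive_on_C_fst D (f : R -> C) x l :
  is_derive_on (V := C_R_NormedModule) D f x l ->
  is_derive_on D (fun t => fst (f t)) x (fst l).
Proof.
  intros H.
  refine (filterdiff_comp (U := R_NormedModule) (V := C_R_NormedModule)
    (W := R_NormedModule) f fst (fun y => scal y l) fst H _).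
  apply (filterdiff_linear (K := R_AbsRing) (U := C_R_NormedModule)
    (V := R_NormedModule) fst).
  apply (is_linear_fst (U := R_NormedModule) (V := R_NormedModule)).
Qed.

Lemma is_derive_on_C_snd D (f : R -> C) x l :
  is_derive_on (V := C_R_NormedModule) D f x l ->
  is_derive_on D (fun t => snd (f t)) x (snd l).
Proof.
  intros H.
  refine (filterdiff_comp (U := R_NormedModule) (V := C_R_NormedModule)
    (W := R_NormedModule) f snd (fun y => scal y l) snd H _).
  apply (filterdiff_linear (K := R_AbsRing) (U := C_R_NormedModule)
    (V := R_NormedModule) snd).
  apply (is_linear_snd (U := R_NormedModule) (V := R_NormedModule)).
Qed.

Lemma is_derive_on_interior (D : R -> Prop) (f : R -> R) x l :
  is_derive_on D f x l -> locally x D -> is_derive f x l.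
Proof.
  intros [Hl H] HD. split; [exact Hl|]. intros x' Hx' eps.
  assert (Hw : is_filter_lim (within D (locally x)) x').
  { intros P HP. specialize (Hx' P HP). unfold within.
    apply filter_imp with (2 := Hx'). auto. }
  specialize (H x' Hw eps). unfold within in H.
  apply filter_imp with (2 := filter_and _ _ HD H).
  intros y [H1 H2]. apply H2, H1.
Qed.

Lemma is_derive_on_filterlim (D : R -> Prop) (f : R -> R) x l :
  is_derive_on D f x l -> filterlim f (within D (locally x)) (locally (f x)).
Proof.
  intros H.
  refine (filterdiff_continuous_aux (K := R_AbsRing) (U := R_NormedModule)
    (V := R_NormedModule) f (ex_intro _ (fun y : R => scal y l) H) x _).
  intros P HP. exact (filter_le_within D P HP).
Qed.

Definition clamp (s e t : R) : R := Rmax s (Rmin e t).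

Lemma clamp_in s e t : s <= e -> s <= clamp s e t <= e.
Proof.
  intros H. unfold clamp. split; [apply Rmax_l|].
  apply Rmax_lub; [exact H|apply Rmin_l].
Qed.

Lemma clamp_id s e t : s <= t <= e -> clamp s e t = t.
Proof.
  intros H. unfold clamp. rewrite Rmin_right, Rmax_right; lra.
Qed.

Lemma clamp_lipschitz s e x y : Rabs (clamp s e y - clamp s e x) <= Rabs (y - x).
Proof.
  unfold clamp, Rmin. destruct (Rle_dec e y), (Rle_dec e x); unfold Rmax;
  repeat match goal with |- context [Rle_dec ?a ?b] => destruct (Rle_dec a b) end;
    split_Rabs; lra.
Qed.

Lemma clamp_continuous s e t : continuous (clamp s e) t.
Proof.
  apply filterlim_locally. intros eps. exists eps. intros y Hy.
  exact (Rle_lt_trans _ _ _ (clamp_lipschitz s e t y) Hy).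
Qed.

(** Makes the mean value theorem applicable to functions with one-sided
    derivatives at the end points. *)
Lemma clamp_extend (D : R -> Prop) (f f' : R -> R) s e : s < e ->
  (forall t, s <= t <= e -> D t) ->
  (forall t, s <= t <= e -> is_derive_on D f t (f' t)) ->
  let h := fun t => f (clamp s e t) in
  (forall t, continuous h t) /\ (forall t, s < t < e -> is_derive h t (f' t)) /\
  (forall t, s <= t <= e -> h t = f t).
Proof.
  intros Hse HD Hf h. split; [|split].
  - intros t. assert (Hc := clamp_in s e t ltac:(lra)).
    unfold h. apply (filterlim_comp _ _ _ (clamp s e) f (locally t)
      (within D (locally (clamp s e t)))).
    + intros P HP. unfold within in HP.
      apply (clamp_continuous s e t) in HP. unfold filtermap in *.
      apply filter_imp with (2 := HP). intros y Hy. apply Hy, HD, clamp_in. lra.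
    + eapply is_derive_on_filterlim. apply Hf, Hc.
  - intros t Ht.
    assert (HI : locally t (fun y => s < y < e)).
    { apply (open_and (fun y => s < y) (fun y => y < e) (open_gt s) (open_lt e)).
      exact Ht. }
    apply is_derive_ext_loc with (f := f).
    + apply filter_imp with (2 := HI). intros y Hy. unfold h.
      rewrite clamp_id by lra. reflexivity.
    + apply (is_derive_on_interior D); [apply Hf; lra|].
      apply filter_imp with (2 := HI). intros y Hy. apply HD. lra.
  - intros t Ht. unfold h. rewrite clamp_id by exact Ht. reflexivity.
Qed.

(** * Locality of the Magnus terms *)

Lemma magnus_S_ext (Om Om' : nat -> R -> mat2) A A' u :
  (forall m, Om m u = Om' m u) -> A u = A' u ->
  forall j n, magnus_S Om A j n u = magnus_S Om' A' j n u.
Proof.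
  intros HO HA j. induction j as [|j IH]; intros n; simpl.
  - rewrite HA. reflexivity.
  - apply sum_n_m_ext. intros m. rewrite HO, IH. reflexivity.
Qed.

(** Allows the pulse to be replaced by its clamped version, which is continuous on the whole
    line. *)
Lemma magnus_term_ext A A' s e n : 
  (forall t, s <= t <= e -> A t = A' t) ->
  forall t, s <= t <= e -> magnus_term A s n t = magnus_term A' s n t.
Proof.
  intros HA. induction n as [n IH] using lt_wf_ind. intros t Ht.
  unfold magnus_term. rewrite !(strong_rec_eq _ _ n).
  apply mk_matrix_ext. intros i j _ _.
  apply (RInt_ext (V := C_R_CompleteNormedModule)). intros u Hu.
  rewrite Rmin_left, Rmax_right in Hu by lra. f_equal.
  apply sum_n_m_ext. intros k. f_equal. apply magnus_S_ext.
  - intros m. destruct (Nat.ltb_spec m n) as [Hm|Hm]; [|reflexivity].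
    apply (IH m Hm u). lra.
  - apply HA. lra.
Qed.

Lemma is_magnus_generator_ext A A' s e Om : s <= e ->
  (forall t, s <= t <= e -> A t = A' t) ->
  is_magnus_generator A s e Om -> is_magnus_generator A' s e Om.
Proof.
  intros Hse HA H i j Hi Hj.
  eapply is_series_ext; [|exact (H i j Hi Hj)].
  intros n. cbv beta. rewrite (magnus_term_ext A A' s e (S n) HA) by lra. reflexivity.
Qed.

(** * Trigonometric bounds and the branch of the arctangent *)

Lemma sin_ge_mul_cos y : 0 <= y <= PI / 2 -> y * cos y <= sin y.
Proof.
  intros Hy.
  pose proof (increment_le (fun _ => 0) (fun t => sin t - t * cos t)
    (fun _ => 0) (fun t => t * sin t) 0 y) as H.
  cbv beta in H. rewrite sin_0, Rminus_eq_0, Rabs_R0 in H.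
  assert (0 <= sin y - y * cos y - (0 - 0 * cos 0)); [|lra].
  apply H.
  - intros t _. apply (is_derive_const 0 t).
  - intros t _. auto_derive; [exact I|ring].
  - intros t _. apply continuous_const.
  - intros t _. apply (ex_derive_continuous (V := R_NormedModule)). auto_derive. exact I.
  - intros t Ht. apply Rmult_le_pos; [lra|].
    apply sin_ge_0; lra.
  - lra.
Qed.

(** Passing to the half angle, which stays below PI / 2, gives a slope that is positive for every
    kappa < PI. A bound linear in x is wanted so that x cancels in the final quotient. *)
Lemma sin_linear_lower kappa x : 0 < kappa < PI -> 0 <= x <= kappa ->
  cos (kappa / 2) ^ 2 * x <= sin x.
Proof.
  intros Hk Hx. replace (sin x) with (2 * sin (x / 2) * cos (x / 2)).
  2:{ rewrite <- sin_2a. f_equal. field. }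
  pose proof (sin_ge_mul_cos (x / 2) ltac:(lra)) as H.
  assert (H1 : cos (kappa / 2) <= cos (x / 2)) by (apply cos_decr_1; lra).
  assert (H2 : 0 < cos (kappa / 2)) by (apply cos_gt_0; lra).
  assert (H3 : 0 <= x / 2) by lra.
  apply Rle_trans with (2 * (x / 2 * cos (x / 2)) * cos (x / 2)).
  - assert (cos (kappa / 2) ^ 2 <= cos (x / 2) ^ 2) by (apply pow_incr; lra).
    apply (Rmult_le_compat_r x) in H0; [|lra]. lra.
  - apply Rmult_le_compat_r; [lra|]. lra.
Qed.

Lemma Rabs_atan_le x : Rabs (atan x) <= Rabs x.
Proof.
  pose proof (lipschitz_1 atan (fun t => / (1 + Rsqr t)) x 0) as H.
  rewrite atan_0, !Rminus_0_r in H. apply H.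
  - apply is_derive_atan.
  - intros t. pose proof (Rle_0_sqr t).
    rewrite Rabs_pos_eq by (left; apply Rinv_0_lt_compat; lra).
    rewrite <- Rinv_1. apply Rinv_le_contravar; lra.
Qed.


Lemma sin_cos_atan x : 0 < cos (atan x) /\ sin (atan x) = x * cos (atan x).
Proof.
  assert (H : 0 < cos (atan x)) by (pose proof (Ratan.atan_bound x); apply cos_gt_0; lra).
  split; [exact H|]. rewrite <- (tan_atan x) at 2. unfold tan. field. lra.
Qed.

(** Parallel to (a, b) and of the same orientation: these two facts fix the angle modulo 2 PI and
    spare further case distinctions. *)
Lemma atan2_direction a b : a <> 0 \/ b <> 0 ->
  a * sin (atan2 b a) = b * cos (atan2 b a) /\
  0 < a * cos (atan2 b a) + b * sin (atan2 b a).
Proof.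
  intros Hab. unfold atan2.
  destruct (sin_cos_atan (b / a)) as [Hc Hs].
  assert (Hq : a <> 0 -> a * sin (atan (b / a)) = b * cos (atan (b / a))).
  { intros Ha. rewrite Hs. field. exact Ha. }
  assert (Hp : a <> 0 -> a * (a * cos (atan (b / a)) + b * sin (atan (b / a)))
     = (a ^ 2 + b ^ 2) * cos (atan (b / a))).
  { intros Ha. rewrite Hs. field. exact Ha. }
  destruct (Rlt_dec 0 a) as [Ha|Ha].
  - split; [apply Hq; lra|]. specialize (Hp ltac:(lra)).
    apply (Rmult_lt_reg_l a); [exact Ha|]. rewrite Hp, Rmult_0_r.
    apply Rmult_lt_0_compat; [nra|exact Hc].
  - destruct (Rlt_dec a 0) as [Ha'|Ha'].
    + specialize (Hp ltac:(lra)). specialize (Hq ltac:(lra)).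
      assert (Hn : 0 < a * - cos (atan (b / a)) + b * - sin (atan (b / a))).
      { apply (Rmult_lt_reg_l (- a)); [lra|]. rewrite Rmult_0_r.
        replace (- a * (a * - cos (atan (b / a)) + b * - sin (atan (b / a))))
          with (a * (a * cos (atan (b / a)) + b * sin (atan (b / a)))) by ring.
        rewrite Hp. apply Rmult_lt_0_compat; [nra|exact Hc]. }
      destruct (Rle_dec 0 b) as [Hb|Hb].
      * rewrite neg_sin, neg_cos. split; [lra|exact Hn].
      * replace (atan (b / a) - PI) with (- (PI - atan (b / a))) by ring.
        rewrite sin_neg, cos_neg, sin_PI_x, Rtrigo_facts.cos_pi_minus.
        split; [lra|exact Hn].
    + assert (a = 0) as -> by lra.
      destruct (Rlt_dec 0 b); [rewrite sin_PI2, cos_PI2; lra|].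
      destruct (Rlt_dec b 0); [rewrite sin_neg, cos_neg, sin_PI2, cos_PI2; lra|].
      exfalso. destruct Hab; lra.
Qed.

Lemma atan2_polar l theta : 0 < l ->
  exists k : Z, atan2 (l * sin theta) (l * cos theta) = theta + 2 * PI * IZR k.
Proof.
  intros Hl. set (al := atan2 (l * sin theta) (l * cos theta)).
  destruct (atan2_direction (l * cos theta) (l * sin theta)) as [H1 H2].
  { destruct (Req_dec (cos theta) 0) as [Hc|Hc].
    - right. pose proof (sin2_cos2 theta) as H. unfold Rsqr in H.
      rewrite Hc in H. intros E.
      apply Rmult_integral in E. destruct E as [E|E]; [lra|]. rewrite E in H. lra.
    - left. intros E. apply Rmult_integral in E. destruct E; lra. }
  fold al in H1, H2.
  assert (Hs : sin (al - theta) = 0).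
  { rewrite sin_minus. apply (Rmult_eq_reg_l l); [|lra]. lra. }
  assert (Hc : 0 < cos (al - theta)).
  { rewrite cos_minus. apply (Rmult_lt_reg_l l); [exact Hl|]. lra. }
  assert (Hc1 : cos (al - theta) = 1).
  { pose proof (sin2_cos2 (al - theta)) as H. unfold Rsqr in H. rewrite Hs in H. nra. }
  (* The half angle turns cos = 1 into sin = 0; a multiple of PI for the half is a multiple of 2 PI
     for the whole. *)
  assert (Hh : sin ((al - theta) / 2) = 0).
  { pose proof (cos_2a_sin ((al - theta) / 2)) as H.
    replace (2 * ((al - theta) / 2)) with (al - theta) in H by field.
    rewrite Hc1 in H. nra. }
  destruct (sin_eq_0_0 _ Hh) as [k Hk]. exists k. lra.
Qed.

(** * Restriction to a segment *)

(** After subtraction of the primitive of the affine part the mean value theorem applies; (t -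
    mid)^2 / 2 has equal values at both ends, so the slope disappears. *)
Lemma RInt_midpoint (phi : R -> R) s e theta slope N : s < e ->
  (forall t, continuous phi t) ->
  (forall t, s <= t <= e ->
     Rabs (phi t - theta - slope * (t - (s + e) / 2)) <= N) ->
  Rabs (/ (e - s) * RInt phi s e - theta) <= N.
Proof.
  intros Hse Hc Hb. set (mid := (s + e) / 2) in *.
  pose proof (increment_bound
    (fun x => RInt phi s x - theta * x - slope * (x - mid) ^ 2 / 2)
    (fun x => phi x - theta - slope * (x - mid)) s e N) as H.
  specialize (fun H1 H2 H3 => H H1 H2 H3 e s ltac:(lra) ltac:(lra)).
  cbv beta in H. rewrite (RInt_point s phi) in H.
  assert (D : forall x, is_derive (fun x => RInt phi s x - theta * x - slope * (x - mid) ^ 2 / 2)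
    x (phi x - theta - slope * (x - mid))).
  { intros x.
    assert (DI : is_derive (fun x => RInt phi s x) x (phi x)).
    { apply (is_derive_RInt (V := R_NormedModule) phi (RInt phi s) s x).
      - exists (mkposreal 1 Rlt_0_1). intros v _.
        apply (RInt_correct (V := R_CompleteNormedModule)).
        apply (ex_RInt_continuous (V := R_CompleteNormedModule)). intros; apply Hc.
      - apply Hc. }
    set (J := fun x => RInt phi s x) in *.
    change (is_derive (fun x => J x - theta * x - slope * (x - mid) ^ 2 / 2) x
      (phi x - theta - slope * (x - mid))).
    auto_derive; [repeat split; eexists; exact DI|].
    rewrite (is_derive_unique (fun v : R => J v) x _ DI). unfold Rminus. field. }
  assert (H' : Rabs (RInt phi s e - theta * e - slope * (e - mid) ^ 2 / 2
     - (0 - theta * s - slope * (s - mid) ^ 2 / 2)) <= N * Rabs (e - s)).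
  { apply H.
    - intros t _. apply D.
    - intros t _. apply (ex_derive_continuous (V := R_NormedModule)).
      eexists; apply D.
    - intros t Ht. apply Hb. lra. }
  rewrite (Rabs_pos_eq (e - s)) in H' by lra.
  replace (RInt phi s e - theta * e - slope * (e - mid) ^ 2 / 2
     - (0 - theta * s - slope * (s - mid) ^ 2 / 2))
    with ((/ (e - s) * RInt phi s e - theta) * (e - s)) in H'
    by (unfold mid; field; lra).
  rewrite Rabs_mult, (Rabs_pos_eq (e - s)) in H' by lra.
  apply (Rmult_le_reg_r (e - s)); lra.
Qed.

(** Taylor expansion about the midpoint to first and second order, from |phi'| <= M beta and |phi''|
    <= M beta^2. The sign of beta comes from the bound on phi'. *)
Lemma pulse_class_segment M beta T phi s e : 0 < M -> 0 <= s -> s < e -> e <= T ->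
  pulse_class M beta T phi ->
  0 <= beta /\
  let phic := fun t => phi (clamp s e t) in
  let mid := (s + e) / 2 in
  (forall t, continuous phic t) /\
  (forall t, s <= t <= e -> phic t = phi t) /\
  exists slope, forall t, s <= t <= e ->
    Rabs (phi t - phi mid) <= M * (beta * (e - s)) /\
    Rabs (phi t - phi mid - slope * (t - mid)) <= M * (beta * (e - s)) ^ 2.
Proof.
  intros HM Hs Hse He (D & HD0 & HD).
  assert (Hbeta : 0 <= beta).
  { destruct (HD 1%nat s ltac:(lra)) as [_ H]. pose proof (Rabs_pos (D 1%nat s)).
    simpl in H. rewrite Rmult_1_r in H. nra. }
  split; [exact Hbeta|]. intros phic mid.
  assert (Hext : forall k, let h := fun t => D k (clamp s e t) in
    (forall t, continuous h t) /\ (forall t, s < t < e -> is_derive h t (D (S k) t)) /\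
    (forall t, s <= t <= e -> h t = D k t)).
  { intros k. apply (clamp_extend (fun y => 0 <= y <= T) (D k) (D (S k))); [exact Hse| |].
    - intros; lra.
    - intros t Ht. apply HD. lra. }
  assert (E0 : forall t, phic t = D 0%nat (clamp s e t)).
  { intros t. unfold phic. symmetry. apply HD0.
    pose proof (clamp_in s e t ltac:(lra)). lra. }
  destruct (Hext 0%nat) as (C0 & D0 & _). destruct (Hext 1%nat) as (C1 & D1 & I1).
  assert (Hphic : forall t, s <= t <= e -> phic t = phi t).
  { intros t Ht. unfold phic. rewrite clamp_id by exact Ht. reflexivity. }
  split; [|split; [exact Hphic|]].
  { intros t. apply continuous_ext with (2 := C0 t). intros u. symmetry. apply E0. }
  assert (Hmid : s <= mid <= e) by (unfold mid; lra).
  assert (Hlen : forall t, s <= t <= e -> Rabs (t - mid) <= e - s).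
  { intros t Ht. apply Rabs_le. lra. }
  exists (D 1%nat mid). intros t Ht.
  rewrite <- (Hphic t Ht), <- (Hphic mid Hmid), !E0.
  assert (HMb : 0 <= M * beta ^ 2) by (apply Rmult_le_pos; [lra|apply pow_le, Hbeta]).
  split.
  - pose proof (increment_bound _ _ s e (M * beta) D0 (fun t _ => C0 t)) as H.
    eapply Rle_trans; [apply (fun H1 => H H1 t mid Ht Hmid)|].
    + intros u Hu. destruct (HD 1%nat u ltac:(lra)) as [_ B]. simpl in B. lra.
    + rewrite <- Rmult_assoc. apply Rmult_le_compat_l; [nra|auto].
  - assert (Hslope : forall u, s <= u <= e ->
      Rabs (D 1%nat u - D 1%nat mid) <= M * beta ^ 2 * (e - s)).
    { intros u Hu. rewrite <- (I1 u Hu), <- (I1 mid Hmid).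
      eapply Rle_trans;
        [apply (increment_bound _ _ s e (M * beta ^ 2) D1 (fun t _ => C1 t))|].
      - intros v Hv. destruct (HD 2%nat v ltac:(lra)) as [_ B]. exact B.
      - exact Hu.
      - exact Hmid.
      - apply Rmult_le_compat_l; auto. }
    pose proof (increment_bound
      (fun u => D 0%nat (clamp s e u) - D 1%nat mid * u)
      (fun u => D 1%nat u - D 1%nat mid) s e (M * beta ^ 2 * (e - s))) as H.
    replace (D 0%nat (clamp s e t) - D 0%nat (clamp s e mid) - D 1%nat mid * (t - mid))
      with ((D 0%nat (clamp s e t) - D 1%nat mid * t)
            - (D 0%nat (clamp s e mid) - D 1%nat mid * mid)) by ring.
    eapply Rle_trans; [apply (fun H1 H2 H3 => H H1 H2 H3 t mid Ht Hmid)|].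
    + intros u Hu. apply (is_derive_minus (fun u => D 0%nat (clamp s e u))
        (fun u => D 1%nat mid * u)); [apply D0, Hu|].
      auto_derive; [exact I|ring].
    + intros u _. apply (continuous_minus (V := R_NormedModule)); [apply C0|].
      apply (continuous_scal_r (V := R_NormedModule) (D 1%nat mid) (fun u => u)).
      apply continuous_id.
    + intros u Hu. apply Hslope. lra.
    + replace (M * (beta * (e - s)) ^ 2) with (M * beta ^ 2 * (e - s) * (e - s)) by ring.
      apply Rmult_le_compat_l; [|auto]. apply Rmult_le_pos; lra.
Qed.

(** First column of the propagator, as a quaternion seen from a frame rotated
    by [theta] about the Z axis. *)
Lemma propagator_rotated T omega phi U s e theta : 0 <= s -> s < e -> e <= T ->
  is_propagator T omega phi U ->
  let psi := fun t => phi t - theta in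
  exists Q0 Q1 Q2 Q3 : R -> R,
    (Q0 s = 1 /\ Q1 s = 0 /\ Q2 s = 0 /\ Q3 s = 0) /\
    (forall t, continuous Q0 t /\ continuous Q1 t /\ continuous Q2 t /\ continuous Q3 t) /\
    (forall t, s < t < e ->
      is_derive Q0 t (- omega * (cos (psi t) * Q1 t + sin (psi t) * Q2 t)) /\
      is_derive Q1 t (omega * (cos (psi t) * Q0 t + sin (psi t) * Q3 t)) /\
      is_derive Q2 t (omega * (sin (psi t) * Q0 t - cos (psi t) * Q3 t)) /\
      is_derive Q3 t (omega * (cos (psi t) * Q2 t - sin (psi t) * Q1 t))) /\
    Q0 e = fst (entry (U e s) 0 0) /\
    Q1 e = - snd (entry (U e s) 1 0) * cos theta + fst (entry (U e s) 1 0) * sin theta /\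
    Q2 e = snd (entry (U e s) 1 0) * sin theta + fst (entry (U e s) 1 0) * cos theta.
Proof.
  intros Hs Hse He HU psi.
  destruct (HU s ltac:(lra)) as [HU0 HU1].
  set (u0 := fun t => fst (entry (U t s) 0 0)). set (u3 := fun t => snd (entry (U t s) 0 0)).
  set (u2 := fun t => fst (entry (U t s) 1 0)). set (u1 := fun t => snd (entry (U t s) 1 0)).
  (* Rebuilds the propagator from its entries so that [mat2_of_mult] can compute the product. *)
  assert (Hmul : forall t i, (i < 2)%nat ->
    entry (mult (pulse_rhs omega phi t) (U t s)) i 0 =
    entry (mult (pulse_rhs omega phi t)
      (mat2_of (entry (U t s) 0 0) (entry (U t s) 0 1)
               (entry (U t s) 1 0) (entry (U t s) 1 1))) i 0).
  { intros t i Hi. f_equal. }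
  assert (Hd : forall t, s <= t <= e ->
    is_derive_on (fun y => s <= y <= T) u0 t
      (omega * cos (phi t) * u1 t - omega * sin (phi t) * u2 t) /\
    is_derive_on (fun y => s <= y <= T) u3 t
      (- (omega * cos (phi t) * u2 t) - omega * sin (phi t) * u1 t) /\
    is_derive_on (fun y => s <= y <= T) u2 t
      (omega * cos (phi t) * u3 t + omega * sin (phi t) * u0 t) /\
    is_derive_on (fun y => s <= y <= T) u1 t
      (- (omega * cos (phi t) * u0 t) + omega * sin (phi t) * u3 t)).
  { intros t Ht. specialize (HU1 t ltac:(lra)).
    pose proof (HU1 0%nat 0%nat ltac:(lia) ltac:(lia)) as H0.
    pose proof (HU1 1%nat 0%nat ltac:(lia) ltac:(lia)) as H1.
    rewrite Hmul in H0, H1 by lia. unfold pulse_rhs in H0, H1.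
    rewrite pauli_generator_mat, mat2_of_mult in H0, H1.
    pose proof (is_derive_on_C_fst _ _ _ _ H0) as F0.
    pose proof (is_derive_on_C_snd _ _ _ _ H0) as S0.
    pose proof (is_derive_on_C_fst _ _ _ _ H1) as F1.
    pose proof (is_derive_on_C_snd _ _ _ _ H1) as S1.
    assert (X : forall (f : R -> R) l l', is_derive_on (fun y => s <= y <= T) f t l ->
      l = l' -> is_derive_on (fun y => s <= y <= T) f t l') by (intros f l l' Hf <-; exact Hf).
    split; [|split; [|split]].
    - apply (X _ _ _ F0). unfold u1, u2. simpl. ring.
    - apply (X _ _ _ S0). unfold u1, u2. simpl. ring.
    - apply (X _ _ _ F1). unfold u0, u3. simpl. ring.
    - apply (X _ _ _ S1). unfold u0, u3. simpl. ring. }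
  assert (HDm : forall t, s <= t <= e -> s <= t <= T) by (intros; lra).
  destruct (clamp_extend (fun y => s <= y <= T) u0 _ s e Hse HDm (fun t Ht => proj1 (Hd t Ht)))
    as (C0 & D0 & I0).
  destruct (clamp_extend (fun y => s <= y <= T) u3 _ s e Hse HDm (fun t Ht => proj1 (proj2 (Hd t Ht))))
    as (C3 & D3 & I3).
  destruct (clamp_extend (fun y => s <= y <= T) u2 _ s e Hse HDm (fun t Ht => proj1 (proj2 (proj2 (Hd t Ht)))))
    as (C2 & D2 & I2).
  destruct (clamp_extend (fun y => s <= y <= T) u1 _ s e Hse HDm (fun t Ht => proj2 (proj2 (proj2 (Hd t Ht)))))
    as (C1 & D1 & I1).
  set (h0 := fun t => u0 (clamp s e t)) in *. set (h1 := fun t => u1 (clamp s e t)) in *.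
  set (h2 := fun t => u2 (clamp s e t)) in *. set (h3 := fun t => u3 (clamp s e t)) in *.
  change (forall t, s <= t <= e -> h0 t = u0 t) in I0.
  change (forall t, s <= t <= e -> h1 t = u1 t) in I1.
  change (forall t, s <= t <= e -> h2 t = u2 t) in I2.
  change (forall t, s <= t <= e -> h3 t = u3 t) in I3.
  assert (Hinit : u0 s = 1 /\ u1 s = 0 /\ u2 s = 0 /\ u3 s = 0).
  { unfold u0, u1, u2, u3. rewrite HU0, mat2_of_one. simpl. auto. }
  destruct Hinit as (N0 & N1 & N2 & N3).
  (* A matrix q0 - i (q1 X + q2 Y + q3 Z) has first column (q0 - i q3, q2 - i q1); the pair (q1, q2)
     is then turned by -theta. *)
  exists h0, (fun t => - h1 t * cos theta + h2 t * sin theta),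
    (fun t => h1 t * sin theta + h2 t * cos theta), (fun t => - h3 t).
  assert (Hcs := sin2_cos2 theta). unfold Rsqr in Hcs.
  split; [|split; [|split]].
  - cbv beta. rewrite I0, I1, I2, I3, N0, N1, N2, N3 by lra. repeat split; ring.
  - intros t. split; [apply C0|]. split; [|split].
    + apply (continuous_plus (V := R_NormedModule));
        apply (continuous_mult (K := R_AbsRing)); try apply continuous_const.
      * apply (continuous_opp (V := R_NormedModule)), C1.
      * apply C2.
    + apply (continuous_plus (V := R_NormedModule));
        apply (continuous_mult (K := R_AbsRing)); try apply continuous_const;
        [apply C1|apply C2].
    + apply (continuous_opp (V := R_NormedModule)), C3.
  - intros t Ht.
    specialize (D0 t Ht). specialize (D1 t Ht). specialize (D2 t Ht). specialize (D3 t Ht).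
    rewrite <- (I0 t), <- (I1 t), <- (I2 t), <- (I3 t) in * by lra.
    unfold psi. rewrite cos_minus, sin_minus.
    assert (K : forall x, x = x * (sin theta * sin theta + cos theta * cos theta))
      by (intros; rewrite Hcs; ring).
    split; [|split; [|split]].
    + replace (- omega * _) with
        (omega * cos (phi t) * h1 t - omega * sin (phi t) * h2 t); [exact D0|].
      rewrite (K (omega * cos (phi t) * h1 t - omega * sin (phi t) * h2 t)). ring.
    + auto_derive; [split; [eexists; exact D1|split; [eexists; exact D2|exact I]]|].
      rewrite (is_derive_unique (fun v : R => h1 v) t _ D1),
        (is_derive_unique (fun v : R => h2 v) t _ D2). ring.
    + auto_derive; [split; [eexists; exact D1|split; [eexists; exact D2|exact I]]|].
      rewrite (is_derive_unique (fun v : R => h1 v) t _ D1),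
        (is_derive_unique (fun v : R => h2 v) t _ D2). ring.
    + auto_derive; [eexists; exact D3|].
      rewrite (is_derive_unique (fun v : R => h3 v) t _ D3).
      match goal with |- ?l = _ => rewrite (K l) end. ring.
  - cbv beta. rewrite I0, I1, I2 by lra. auto.
Qed.

(** * Bias of the estimator *)

Lemma segment_bias M kappa T beta omega phi U s e a b c :
  0 < M -> 0 < kappa < PI -> 0 <= s -> s < e -> e <= T -> 0 < omega ->
  omega * (e - s) <= kappa ->
  pulse_class M beta T phi -> is_propagator T omega phi U ->
  let d := beta * (e - s) in
  let c0 := cos (kappa / 2) ^ 2 in
  M * d * exp (4 * kappa) < 1 + cos kappa -> 8 * (M * d) <= c0 ->
  is_magnus_generator (pulse_rhs omega phi) s e (pauli_generator a b c) ->
  is_mat_exp (pauli_generator a b c) (U e s) ->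
  angle_dist_le (atan2 b a) (/ (e - s) * RInt phi s e)
    ((2 * ((8 * kappa + 2) * M ^ 2 + M) / c0 + M) * d ^ 2).
Proof.
  intros HM Hk Hs Hse He Ho Hok Hphi HU d c0 Hd1 Hd2 HMag HExp.
  destruct (pulse_class_segment M beta T phi s e HM Hs Hse He Hphi)
    as (Hbeta & Hcont & Heq & slope & Hlin).
  set (phic := fun t => phi (clamp s e t)) in *.
  change (forall t, s <= t <= e -> phic t = phi t) in Heq.
  set (mid := (s + e) / 2) in *. set (theta := phi mid) in *.
  set (eps := M * d). set (N := M * d ^ 2).
  assert (Hd0 : 0 <= d) by (apply Rmult_le_pos; lra).
  assert (Heps : 0 <= eps) by (apply Rmult_le_pos; lra).
  assert (Hc0 : 0 < c0).
  { apply pow_lt, cos_gt_0; lra. }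
  set (x := omega * (e - s)) in *.
  assert (Hx : 0 < x) by (apply Rmult_lt_0_compat; lra).
  assert (Hnorm : a ^ 2 + b ^ 2 + c ^ 2 <= PI ^ 2).
  { refine (magnus_norm_le_PI omega s e phic theta eps kappa a b c Hcont
      (Rlt_le _ _ Ho) (Rlt_le _ _ Hse) Hk Hok Heps Hd1 _ _).
    - intros t Ht. rewrite Heq by exact Ht. apply Hlin, Ht.
    - apply is_magnus_generator_ext with (A := pulse_rhs omega phi); [lra| |exact HMag].
      intros t Ht. unfold pulse_rhs. rewrite Heq by exact Ht. reflexivity. }
  destruct (propagator_rotated T omega phi U s e theta Hs Hse He HU)
    as (Q0 & Q1 & Q2 & Q3 & (I0 & I1 & I2 & I3) & HC & HD & E0 & E1 & E2).
  destruct (pauli_exp_entries a b c _ HExp) as (m & Hm & Hm0 & X00 & X10).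
  set (r := sqrt (a ^ 2 + b ^ 2 + c ^ 2)) in *.
  rewrite X00 in E0. rewrite X10 in E1, E2. simpl fst in E0, E1, E2.
  simpl snd in E1, E2.
  assert (Hpsi1 : forall t, s <= t <= e -> Rabs (phi t - theta) <= eps)
    by (intros t Ht; apply Hlin, Ht).
  assert (Hpsi2 : forall t, s <= t <= e ->
    Rabs (phi t - theta - slope * (t - mid)) <= N) by (intros t Ht; apply Hlin, Ht).
  destruct (rotated_first_order omega s e eps (fun t => phi t - theta) Q0 Q1 Q2 Q3
    Ho Hse I0 I1 I2 I3 (fun t => proj1 (HC t)) (fun t => proj1 (proj2 (HC t)))
    (fun t => proj1 (proj2 (proj2 (HC t)))) (fun t => proj2 (proj2 (proj2 (HC t))))
    (fun t Ht => proj1 (HD t Ht)) (fun t Ht => proj1 (proj2 (HD t Ht)))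
    (fun t Ht => proj1 (proj2 (proj2 (HD t Ht))))
    (fun t Ht => proj2 (proj2 (proj2 (HD t Ht)))) Hpsi1 e ltac:(lra)) as [F1 F0].
  pose proof (rotated_second_order omega s e eps N slope (fun t => phi t - theta)
    Q0 Q1 Q2 Q3
    Ho Hse I0 I1 I2 I3 (fun t => proj1 (HC t)) (fun t => proj1 (proj2 (HC t)))
    (fun t => proj1 (proj2 (proj2 (HC t)))) (fun t => proj2 (proj2 (proj2 (HC t))))
    (fun t Ht => proj1 (HD t Ht)) (fun t Ht => proj1 (proj2 (HD t Ht)))
    (fun t Ht => proj1 (proj2 (proj2 (HD t Ht))))
    (fun t Ht => proj2 (proj2 (proj2 (HD t Ht)))) Hpsi1 Hpsi2) as F2.
  replace (4 * omega * (e - s) * eps) with (4 * x * eps) in F0, F1 by (unfold x; ring).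
  fold x in F0, F1, F2.
  assert (Hr : 0 <= r <= PI).
  { split; [apply sqrt_pos|]. rewrite <- (sqrt_pow2 PI) by lra.
    apply sqrt_le_1_alt. exact Hnorm. }
  (* Excludes r = PI, which the limit z -> 1 leaves open: cos r is the scalar part of the
     propagator, within 4 x eps <= eps exp (4 kappa) of cos x. *)
  assert (Hcosr : -1 < cos r).
  { rewrite <- E0. apply Rabs_le_between in F0.
    assert (cos kappa <= cos x) by (apply cos_decr_1; lra).
    assert (4 * x * eps <= eps * exp (4 * kappa)); [|unfold eps in *; lra].
    pose proof (exp_ineq1_le (4 * kappa)). nra. }
  (* Positivity of sin r / r: the vector part of the propagator points along (a, b, c), not opposite
     to it. *)
  assert (Hmpos : 0 < m).
  { destruct (proj1 Hr) as [Hr0|Hr0].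
    - assert (r < PI).
      { destruct (proj2 Hr) as [H|H]; [exact H|]. rewrite H, cos_PI in Hcosr. lra. }
      assert (Hsr : 0 < sin r) by (apply sin_gt_0; lra).
      rewrite Hm in Hsr. nra.
    - rewrite Hm0 by auto. lra. }
  (* Coordinates of (a, b) in the rotated frame; with p > 0, [eta] is the angle of (a, b) measured
     from theta. *)
  set (p := a * cos theta + b * sin theta). set (q := b * cos theta - a * sin theta).
  assert (Ep : Q1 e = m * p) by (rewrite E1; unfold p; ring).
  assert (Eq : Q2 e = m * q) by (rewrite E2; unfold q; ring).
  (* sin x is at least c0 x, and the error 4 x eps takes at most half of it because 8 M d <= c0. *)
  assert (HQ1 : c0 / 2 * x <= Q1 e).
  { apply Rabs_le_between in F1.
    pose proof (sin_linear_lower kappa x Hk ltac:(lra)) as L. fold c0 in L.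
    unfold eps in *. nra. }
  set (C1 := (8 * kappa + 2) * M ^ 2 + M).
  assert (HQ2 : Rabs (Q2 e) <= x * (C1 * d ^ 2)).
  { eapply Rle_trans; [exact F2|]. apply Rmult_le_compat_l; [lra|].
    unfold C1, N, eps. assert (0 <= (M * d) ^ 2) by apply pow2_ge_0. nra. }
  assert (HQ1pos : 0 < Q1 e).
  { eapply Rlt_le_trans; [|exact HQ1]. apply Rmult_lt_0_compat; lra. }
  assert (Hp : 0 < p) by (rewrite Ep in HQ1pos; nra).
  set (eta := atan (q / p)).
  destruct (sin_cos_atan (q / p)) as [Hce Hse']. fold eta in Hce, Hse'.
  set (l := p / cos eta).
  assert (Hl : 0 < l) by (apply Rdiv_lt_0_compat; assumption).
  assert (Lc : l * cos eta = p) by (unfold l; field; lra).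
  assert (Ls : l * sin eta = q) by (rewrite Hse'; unfold l; field; lra).
  assert (Hcs := sin2_cos2 theta). unfold Rsqr in Hcs.
  assert (La : l * cos (theta + eta) = a).
  { rewrite cos_plus. replace (l * (cos theta * cos eta - sin theta * sin eta))
      with (cos theta * (l * cos eta) - sin theta * (l * sin eta)) by ring.
    rewrite Lc, Ls. unfold p, q.
    transitivity (a * (sin theta * sin theta + cos theta * cos theta)); [ring|].
    rewrite Hcs. ring. }
  assert (Lb : l * sin (theta + eta) = b).
  { rewrite sin_plus. replace (l * (sin theta * cos eta + cos theta * sin eta))
      with (sin theta * (l * cos eta) + cos theta * (l * sin eta)) by ring.
    rewrite Lc, Ls. unfold p, q.
    transitivity (b * (sin theta * sin theta + cos theta * cos theta)); [ring|].
    rewrite Hcs. ring. }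
  destruct (atan2_polar l (theta + eta) Hl) as [k Hat].
  rewrite La, Lb in Hat.
  (* The common factor x cancels in Q2 / Q1, so the bound does not degrade for small omega tau. *)
  assert (Heta : Rabs eta <= 2 * C1 / c0 * d ^ 2).
  { eapply Rle_trans; [apply Rabs_atan_le|].
    replace (q / p) with (Q2 e / Q1 e) by (rewrite Ep, Eq; field; lra).
    unfold Rdiv at 1. rewrite Rabs_mult, Rabs_inv, (Rabs_pos_eq (Q1 e)) by lra.
    apply (Rmult_le_reg_r (Q1 e)); [exact HQ1pos|].
    rewrite Rmult_assoc, Rinv_l, Rmult_1_r by lra.
    eapply Rle_trans; [exact HQ2|].
    replace (x * (C1 * d ^ 2)) with (2 * C1 / c0 * d ^ 2 * (c0 / 2 * x)) by (field; lra).
    apply Rmult_le_compat_l; [|exact HQ1].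
    apply Rmult_le_pos; [|apply pow2_ge_0].
    apply Rmult_le_pos; [|left; apply Rinv_0_lt_compat; exact Hc0].
    unfold C1. assert (0 <= M ^ 2) by apply pow2_ge_0. nra. }
  assert (Hbar : Rabs (/ (e - s) * RInt phi s e - theta) <= N).
  { replace (RInt phi s e) with (RInt phic s e).
    - apply (RInt_midpoint phic s e theta slope N Hse Hcont).
      intros t Ht. rewrite Heq by exact Ht. apply Hpsi2, Ht.
    - apply RInt_ext. intros t Ht. rewrite Rmin_left, Rmax_right in Ht by lra.
      apply Heq. lra. }
  exists k. rewrite Hat.
  replace (theta + eta + 2 * PI * IZR k - / (e - s) * RInt phi s e - 2 * PI * IZR k)
    with (eta - (/ (e - s) * RInt phi s e - theta)) by ring.
  eapply Rle_trans; [apply Rabs_triang|]. rewrite Rabs_Ropp.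
  fold C1. rewrite Rmult_plus_distr_r. apply Rplus_le_compat; [exact Heta|exact Hbar].
Qed.

(** [K] and [delta] are fixed before T, beta, omega, L and phi, so the bound is uniform in all of
    them. Small step size is expressed by [delta], and any [kappa] in [PI / 2, PI) covers amplitudes
    with omega tau up to PI / 2. *)
Theorem theorem4 :
  forall M kappa : R, 0 < M -> 0 < kappa < PI ->
  exists K delta : R, 0 < K /\ 0 < delta /\
  forall (T beta omega : R) (L : nat) (phi : R -> R) (U : R -> R -> mat2)
         (a b c : nat -> R),
    0 < T -> (1 <= L)%nat -> 0 < omega ->
    pulse_class M beta T phi ->
    is_propagator T omega phi U ->
    let tau := T / INR L in
    let psi := fun j : nat => atan2 (b j) (a j) in
    let phibar := fun j : nat =>
      / tau * RInt phi ((INR j - 1) * tau) (INR j * tau) in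
    omega * tau <= kappa ->
    beta * tau <= delta ->
    (forall j : nat, (1 <= j <= L)%nat ->
       is_magnus_generator (pulse_rhs omega phi)
         ((INR j - 1) * tau) (INR j * tau)
         (pauli_generator (a j) (b j) (c j)) /\
       is_mat_exp (pauli_generator (a j) (b j) (c j))
         (U (INR j * tau) ((INR j - 1) * tau))) ->
    forall j : nat, (1 <= j <= L)%nat ->
      angle_dist_le (psi j) (phibar j) (K * (beta ^ 2 * T ^ 2 / INR L ^ 2)).
Proof.
  intros M kappa HM Hk.
  set (c0 := cos (kappa / 2) ^ 2).
  assert (Hc0 : 0 < c0) by (apply pow_lt, cos_gt_0; lra).
  assert (Hck : 0 < 1 + cos kappa).
  { assert (cos PI < cos kappa) by (apply cos_decreasing_1; lra).
    rewrite cos_PI in H. lra. }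
  set (ex := exp (4 * kappa)). assert (Hex : 0 < ex) by apply exp_pos.
  (* The quotient bounds the angle between (a, b) and the midpoint direction, the last M the
     distance of the average pulse from its midpoint value. *)
  exists (2 * ((8 * kappa + 2) * M ^ 2 + M) / c0 + M).
  (* The first entry keeps the scalar part above -1, its factor 2 making the inequality strict; the
     second keeps the component along the axis above half of its lower bound. *)
  exists (Rmin ((1 + cos kappa) / (2 * (M * ex))) (c0 / (8 * M))).
  assert (HMe : 0 < M * ex) by (apply Rmult_lt_0_compat; assumption).
  split; [|split].
  - assert (0 < M ^ 2) by (apply pow_lt, HM).
    assert (0 < 2 * ((8 * kappa + 2) * M ^ 2 + M) / c0); [|lra].
    apply Rdiv_lt_0_compat; [nra|exact Hc0].
  - apply Rmin_pos; apply Rdiv_lt_0_compat; lra.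
  - intros T beta omega L phi U a b c HT HL Ho Hphi HU tau psi phibar Hok Hbt Hseg j Hj.
    assert (HLpos : 0 < INR L) by (apply lt_0_INR; lia).
    assert (Htau : 0 < tau) by (apply Rdiv_lt_0_compat; assumption).
    assert (HLT : INR L * tau = T) by (unfold tau; field; lra).
    assert (Hj1 : 1 <= INR j) by (apply (le_INR 1); lia).
    assert (HjL : INR j <= INR L) by (apply le_INR; lia).
    destruct (Hseg j Hj) as [HMag HExp].
    assert (Hlen : INR j * tau - (INR j - 1) * tau = tau) by ring.
    pose proof (segment_bias M kappa T beta omega phi U ((INR j - 1) * tau) (INR j * tau)
      (a j) (b j) (c j) HM Hk) as H.
    rewrite Hlen in H.
    replace (beta ^ 2 * T ^ 2 / INR L ^ 2) with ((beta * tau) ^ 2)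
      by (unfold tau; field; lra).
    apply H; auto.
    + apply Rmult_le_pos; lra.
    + lra.
    + rewrite <- HLT. apply Rmult_le_compat_r; lra.
    + assert (Hb1 : beta * tau <= (1 + cos kappa) / (2 * (M * ex))).
      { eapply Rle_trans; [exact Hbt|apply Rmin_l]. }
      apply (Rmult_le_compat_r (M * ex)) in Hb1; [|lra].
      replace ((1 + cos kappa) / (2 * (M * ex)) * (M * ex))
        with ((1 + cos kappa) / 2) in Hb1 by (field; lra).
      fold ex. lra.
    + assert (Hb2 : beta * tau <= c0 / (8 * M)).
      { eapply Rle_trans; [exact Hbt|apply Rmin_r]. }
      apply (Rmult_le_compat_r (8 * M)) in Hb2; [|lra].
      replace (c0 / (8 * M) * (8 * M)) with c0 in Hb2 by (field; lra).
      fold c0. lra.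
Qed.
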